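(* On the Poincaré disk, $$L^2_+(\mathcal G_H)=\overline{I_0\big(x^{1/2}L^2(\mathbb D)\big)}^{L^2}\ \stackrel{\perp}{\oplus}\ \mathrm{span}_{L^2}\big(\widehat{I_{p,2q}}:p\ge0,q\ge1\big)\ \stackrel{\perp}{\oplus}\ \mathrm{span}_{L^2}\big(\overline{\widehat{I_{p,2q}}}:p\ge0,q\ge1\big),$$ where the sums are $L^2(\mathcal G_H)$-orthogonal, and the families $\{\widehat{I_{p,2q}}\}_{p\ge0,q\ge1}$ and $\{\overline{\widehat{I_{p,2q}}}\}_{p\ge0,q\ge1}$ are each $L^2(\mathcal G_H)$-orthonormal. (Here $\mathrm{span}_{L^2}$ denotes the closed linear span.)
   Context: Poincaré disk: $\mathbb D=\{|z|\le1\}$ with metric $g=c^{-2}|dz|^2$, $c(z)=\frac{1-|z|^2}{2}$, bdf $x=\frac{1-|z|^2}{1+|z|^2}$; $L^2(\mathbb D)$ is with respect to the hyperbolic area $dV_H$, and $x^{\delta}L^2(\mathbb D)=\{x^\delta u:u\in L^2(\mathbb D)\}$. The geodesic space is $\mathcal G_H=(\mathbb R/2\pi\mathbb Z)_\beta\times\mathbb R_a$, the geodesic labeled $(\beta,a)$ being $z_{\beta,a}(t)=e^{i\beta}\frac{(2+ia)\tanh(t/2)+ia}{ia\tanh(t/2)-2+ia}$, $t\in\mathbb R$ (unit speed); $L^2(\mathcal G_H)$ uses $d\beta\,da$. The antipodal scattering relation $\mathcal S_A(\beta,a)=(\beta+\pi+2\tan^{-1}a,-a)$ reverses orientation of geodesics;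 $L^2_\pm(\mathcal G_H)=\{h\in L^2(\mathcal G_H):h\circ\mathcal S_A=\pm h\}$. $I_0f(\beta,a)=\int_{\mathbb R}f(z_{\beta,a}(t))dt$. For integers $p\ge0$, $q\ge1$, $I_{p,q}(\beta,a)=\int_{\mathbb R}z_{\beta,a}(t)^p\,\dot z_{\beta,a}(t)^q\,dt$ (the X-ray transform of the symmetric tensor $z^p\,dz^q$), which lies in $L^2(\mathcal G_H)$, and $\widehat{I_{p,q}}=I_{p,q}/\|I_{p,q}\|_{L^2(\mathcal G_H)}$. *)

(* Defs.v *)
From HB Require Import structures.
From mathcomp Require Import all_boot all_order all_algebra.
From mathcomp Require Import all_classical all_reals all_analysis.
From mathcomp Require Import complex.

Set Implicit Arguments.
Unset Strict Implicit.
Unset Printing Implicit Defensive.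

Import Order.TTheory GRing.Theory Num.Theory.
Import numFieldNormedType.Exports.

Local Open Scope classical_set_scope.
Local Open Scope ring_scope.

Section PoincareDisk.
Variable R : realType.

Local Notation C := (R[i]).

Definition cre (z : C) : R := @complex.Re R z.
Definition cim (z : C) : R := @complex.Im R z.


Definition leb1 := @lebesgue_measure R.
Definition leb2 := (leb1 \x leb1)%E.

Definition csq (z : C) : R := cre z ^+ 2 + cim z ^+ 2.

Definition cmeas (h : R * R -> C) :=
  measurable_fun setT (fun x => cre (h x)) /\ measurable_fun setT (fun x => cim (h x)).

Definition cint (g : R -> C) : C :=
  Complex (Rintegral leb1 setT (fun t => cre (g t)))
          (Rintegral leb1 setT (fun t => cim (g t))).

(** Functions on G_H are represented by functions h : R * R -> C, (beta, a),
    2pi-periodic in beta; L^2(G_H) integrals are taken over the fundamental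
    domain [0, 2pi) x R w.r.t. d(beta) d(a). *)
Definition GHdom : set (R * R) := [set x | 0 <= x.1 < 2 * pi].

Definition beta_periodic (h : R * R -> C) :=
  forall b a, h (b + 2 * pi, a) = h (b, a).

Definition nrm2GH (h : R * R -> C) : \bar R :=
  (\int[leb2]_(x in GHdom) (csq (h x))%:E)%E.

Definition L2GH (h : R * R -> C) :=
  [/\ cmeas h, beta_periodic h & (nrm2GH h < +oo)%E].

Definition ipGH (h g : R * R -> C) : C :=
  Complex (Rintegral leb2 GHdom (fun x => cre (h x * (g x)^*%C)))
          (Rintegral leb2 GHdom (fun x => cim (h x * (g x)^*%C))).

Definition normGH (h : R * R -> C) : R := Num.sqrt (fine (nrm2GH h)).

Definition L2closure (S : set (R * R -> C)) : set (R * R -> C) :=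
  [set h | L2GH h /\ forall e : R, 0 < e ->
     exists g, S g /\ (nrm2GH (fun x => (h x - g x)%R) < e%:E)%E].

Definition lincomb (S : set (R * R -> C)) : set (R * R -> C) :=
  [set g | exists (n : nat) (c : 'I_n -> C) (v : 'I_n -> R * R -> C),
     (forall i, S (v i)) /\ g = (fun x => \sum_(i < n) c i * v i x)].

Definition L2span (S : set (R * R -> C)) := L2closure (lincomb S).

Definition SA (x : R * R) : R * R := (x.1 + pi + 2 * atan x.2, - x.2).

Definition L2plus : set (R * R -> C) :=
  [set h | L2GH h /\ {ae leb2, forall x, h (SA x) = h x}].

Definition tanhR (t : R) : R := (expR t - expR (- t)) / (expR t + expR (- t)).

Definition expi (b : R) : C := Complex (cos b) (sin b).

Definition zgeo (b a t : R) : C :=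
  let th := Complex (tanhR (t / 2)) 0 in
  expi b * ((Complex 2 a * th + Complex 0 a) /
            (Complex 0 a * th - Complex 2 0 + Complex 0 a)).

Definition zdot (b a t : R) : C :=
  Complex (derive1 (fun s => cre (zgeo b a s)) t)
          (derive1 (fun s => cim (zgeo b a s)) t).

Definition Ipq (p q : nat) : R * R -> C :=
  fun x => cint (fun t => zgeo x.1 x.2 t ^+ p * zdot x.1 x.2 t ^+ q).

Definition Ihat (p q : nat) : R * R -> C :=
  fun x => Ipq p q x / Complex (normGH (Ipq p q)) 0.

Definition Ihat_conj (p q : nat) : R * R -> C :=
  fun x => (Ihat p q x)^*%C.

(** Points z = x + iy of the disk are represented by pairs (x, y) : R * R;
    the (open) disk, hyperbolic area density c(z)^{-2} = 4/(1-|z|^2)^2,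
    and the boundary defining function x = (1-|z|^2)/(1+|z|^2). *)
Definition r2 (p : R * R) : R := p.1 ^+ 2 + p.2 ^+ 2.
Definition Disk : set (R * R) := [set p | r2 p < 1].
Definition hypdens (p : R * R) : R := 4 / (1 - r2 p) ^+ 2.
Definition bdf (p : R * R) : R := (1 - r2 p) / (1 + r2 p).

Definition L2D (u : R * R -> C) :=
  cmeas u /\ (\int[leb2]_(p in Disk) (csq (u p) * hypdens p)%:E < +oo)%E.

Definition xhalfL2D : set (R * R -> C) :=
  [set f | exists u, L2D u /\
     forall p, Disk p -> f p = Complex (Num.sqrt (bdf p)) 0 * u p].

Definition toR2 (z : C) : R * R := (cre z, cim z).

Definition I0 (f : R * R -> C) : R * R -> C :=
  fun x => cint (fun t => f (toR2 (zgeo x.1 x.2 t))).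

End PoincareDisk.

(* Main.v *)
(* The coordinate [gam = beta + atan a + pi/2] straightens geodesics: in the Klein model the geodesic
   [(beta, a)] is the chord [e^{i gam} (- s + i c tanh t)], where [c = cos (atan a)], [s = sin (atan a)],
   and the scattering relation is [gam -> gam + pi], [s -> - s].  A Santalo formula turns the pairing
   of [I0 f] with [e^{i m gam} c^2 s^j] into the integral of [f] against the average over directions
   of a ridge function, which vanishes for [j < m]; so the range of [I0] is orthogonal to these
   functions and their conjugates.  The integrand of [I_{p,q}] is [z^p] times a power of the Riccati
   field satisfied by the geodesics, so [I_{p,2q}] is a contour integral depending only on the
   endpoints, and equals, up to a constant, [e^{i m gam} c^2 s^(odd m) (c^2)^(q-1) P (c^2)] with
   [m = p + 2 q] and [P] a moment polynomial of degree [p/2] with [P 0 <> 0].  Hence [I_{p,2q}] is a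
   combination of the [e^{i m gam} c^2 s^j], [j < m], and is orthogonal to the range of [I0].  The same
   fact gives the orthogonality of [I_{p,2q}] and [I_{p',2q'}] for [p + 2q = p' + 2q'], [q < q'],
   because the product of the two polynomials can be redistributed so that the first factor comes from
   the X-ray transform of a function.  For completeness, the transforms [I0] of [kap^p x^(2l+2)] supply
   on each frequency [m] the remaining degrees, so that a function orthogonal to everything is
   orthogonal to all [e^{i m gam} c^2 s^j] of the right parity, hence to all of them by its invariance;
   these functions are total. *)

From HB Require Import structures.
From mathcomp Require Import all_boot all_order all_algebra.
From mathcomp Require Import all_classical all_reals all_analysis.
From mathcomp Require Import measurable_realfun complex ring lra.
Require Import Defs.

Set Implicit Arguments.
Unset Strict Implicit.
Unset Printing Implicit Defensive.

Import Order.TTheory GRing.Theory Num.Theory.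
Import numFieldNormedType.Exports.
Local Open Scope classical_set_scope.
Local Open Scope ring_scope.

(** * Change of variables *)

(** Changes of variables are proved for nonnegative measurable functions, as equalities of measures,
    so that Tonelli applies freely and signed integrands enter last. The oscillating kernel fits
    this scheme because a ridge function is bounded by 1: [1 + ridge] is a nonnegative weight whose
    mean over directions is known, and comparing the phases [th] and [th + pi] isolates the ridge
    term.

    A function in [x^{1/2} L^2] is only known to be integrable along almost every geodesic, and a
    divergent integral takes a default value, so [I0] is not visibly linear on this space. Hence
    orthogonality to the range is checked on one transform at a time, while the projection is taken
    on a subspace of transforms whose integrals all converge. Its closure could a priori be smaller,
    but it contains the transforms that completeness uses, so the final remainder vanishes anyway.

    Elements of [L2GH] are functions and not classes modulo null sets; statements up to null sets
    are therefore derived from vanishing norms. *)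

Section Pushforward.
Local Open Scope ereal_scope.
Context d d' (T1 : measurableType d) (T2 : measurableType d') (R : realType).

Definition pushm (m : {measure set T1 -> \bar R}) (f : T1 -> T2)
    (mf : measurable_fun setT f) : {measure set T2 -> \bar R} :=
  measure_function_pushforward__canonical__measure_function_Measure m mf.

Lemma ge0_integral_mrestr (m : {measure set T1 -> \bar R}) (D : set T1)
    (mD : measurable D) (f : T1 -> \bar R) :
  measurable_fun setT f -> (forall x, 0 <= f x) ->
  \int[mrestr m mD]_x f x = \int[m]_(x in D) f x.
Proof.
move=> mf f0.
rewrite -(setUv D) ge0_integral_setU//=; last 3 first.
- exact: measurableC.
- by rewrite setUv.
- exact/disj_setPCl.
rewrite [X in _ + X]null_set_integral//= ?adde0; last 3 first.
- exact: measurableC.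
- exact: measurable_funTS.
- by rewrite /mrestr setICl measure0.
by apply: eq_measure_integral => A mA AD; rewrite -[in RHS](setIidl AD).
Qed.

Lemma ge0_integral_pushm (m : {measure set T1 -> \bar R}) (f : T1 -> T2)
    (mf : measurable_fun setT f) (g : T2 -> \bar R) :
  measurable_fun setT g -> (forall y, 0 <= g y) ->
  \int[pushm m mf]_y g y = \int[m]_x g (f x).
Proof. by move=> mg g0; rewrite ge0_integral_pushforward//= preimage_setT. Qed.

End Pushforward.

Section ChangeOfVariables.
Variable R : realType.
Local Notation mu := (@lebesgue_measure R).
Local Notation mu2 := (mu \x mu)%E.

Lemma measurable_affine (k c : R) :
  measurable_fun [set: measurableTypeR R] (fun x : measurableTypeR R => (k * x + c)%R : measurableTypeR R).
Proof. by apply: measurable_funD => //; apply: measurable_funM. Qed.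

(** Uniqueness of Lebesgue measure: the rescaled pushforward agrees with it on half-open intervals,
    whose preimages are again half-open intervals. *)
Lemma lebesgue_measure_affine (k c : R) (A : set R) : 0 < k -> measurable A ->
  mu A = (k%:E * mu ((fun x => (k * x + c)%R) @^-1` A))%E.
Proof.
move=> k0 mA.
pose m := mscale (NngNum (ltW k0)) (pushm mu (measurable_affine k c)).
transitivity (m A); last by [].
apply: lebesgue_measure_unique => //= _ [[a b]] _ <-.
rewrite /m /mscale /pushm/= /pushforward/=.
rewrite (_ : _ @^-1` _ = `](a - c) / k, (b - c) / k]%classic); last first.
  by apply/seteqP; split => x/=; rewrite !in_itv/= ltr_pdivrMr// ler_pdivlMr//
    ltrBlDr lerBrDr ![x * k]mulrC.
rewrite !lebesgue_measure_itv/= !lte_fin ltr_pM2r ?invr_gt0// ltrD2r.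
case: ifPn => ab; last by rewrite mule0.
rewrite -!EFinB -EFinM; congr (_%:E); field; exact: lt0r_neq0.
Qed.

Lemma ge0_integral_affine (k c : R) (g : R -> \bar R) : 0 < k ->
  measurable_fun setT g -> (forall x, (0 <= g x)%E) ->
  (\int[mu]_x g x = k%:E * \int[mu]_x g (k * x + c)%R)%E.
Proof.
move=> k0 mg g0.
pose m := mscale (NngNum (ltW k0)) (pushm mu (measurable_affine k c)).
rewrite (@eq_measure_integral _ _ _ _ m)/=; last first.
  by move=> A mA _; rewrite (lebesgue_measure_affine c k0 mA).
rewrite ge0_integral_mscale// ge0_integral_pushm//.
Qed.

Lemma ge0_integral_shift (c : R) (g : R -> \bar R) :
  measurable_fun setT g -> (forall x, (0 <= g x)%E) ->
  (\int[mu]_x g (x + c)%R = \int[mu]_x g x)%E.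
Proof.
move=> mg g0; rewrite [RHS](ge0_integral_affine c ltr01)// mul1e.
by under [RHS]eq_integral do rewrite mul1r.
Qed.

Lemma ge0_integral_opp (g : R -> \bar R) :
  measurable_fun setT g -> (forall x, (0 <= g x)%E) ->
  (\int[mu]_x g (- x)%R = \int[mu]_x g x)%E.
Proof.
move=> mg g0.
have mf : measurable_fun [set: measurableTypeR R] (-%R : R -> measurableTypeR R).
  exact: oppr_measurable.
rewrite [RHS](@eq_measure_integral _ _ _ _ (pushm mu mf))/=; last first.
  by move=> A mA _; rewrite -[LHS]lebesgue_measureN.
by rewrite ge0_integral_pushm//.
Qed.

Lemma measurable_hypograph (w : R -> R) : measurable_fun setT w ->
  measurable [set z : R * R | 0 <= z.2 < w z.1].
Proof.
move=> mw.
rewrite (_ : [set _ | _] = (setT `&` ((fun z : R * R => 0 <= z.2) @^-1` [set true]))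
   `&` (setT `&` ((fun z : R * R => z.2 < w z.1) @^-1` [set true]))); last first.
  by apply/seteqP; split => z/=; [move=> /andP[-> ->]|case => -[_ ->] [_ ->]].
apply: measurableI.
  by apply: measurable_fun_ler.
by apply: measurable_fun_ltr => //; exact: measurableT_comp.
Qed.

(* The weight is encoded as the length of the fibres of its hypograph, so that
   [E |-> \int_(phi^-1 E) w] is visibly a measure. *)
Lemma ge0_integral_hypograph (w : R -> R) (g : R -> \bar R)
    (mw : measurable_fun setT w) : (forall x, 0 <= w x) ->
  measurable_fun setT g -> (forall x, (0 <= g x)%E) ->
  (\int[mrestr mu2 (measurable_hypograph mw)]_z g z.1 = \int[mu]_x (g x * (w x)%:E))%E.
Proof.
move=> w0 mg g0.
have mH := measurable_hypograph mw.
rewrite ge0_integral_mrestr//=; last exact: measurableT_comp.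
have mF : measurable_fun setT
   ((fun z : R * R => g z.1) \_ [set z : R * R | 0 <= z.2 < w z.1]).
  apply/(measurable_restrictT _ mH); apply: measurable_funTS; exact: measurableT_comp.
rewrite integral_mkcond fubini_tonelli1//=; last first.
  by apply: erestrict_ge0 => z _.
apply: eq_integral => x _; rewrite /fubini_F/=.
transitivity (\int[mu]_(y in `[0%R, w x[) (g x))%E.
  rewrite [RHS]integral_mkcond; apply: eq_integral => y _.
  rewrite !patchE/=; congr (if _ then _ else _).
rewrite integral_cst//= lebesgue_measure_itv/= lte_fin; case: ifPn => [|].
  by rewrite oppr0 addr0.
by rewrite -leNgt => wx; rewrite (_ : w x = 0) ?mule0//; apply: le_anti; rewrite wx/=.
Qed.

End ChangeOfVariables.

(** * Substitution along an increasing function of the line *)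

Section Substitution.
Variable R : realType.
Local Notation mu := (@lebesgue_measure R).
Local Notation mu2 := (mu \x mu)%E.
Variables (phi w : R -> R) (l r : R).
Hypotheses (dphi : forall x : R, is_derive x (1:R) phi (w x)) (w0 : forall x, 0 < w x)
  (cw : continuous w) (phir : phi x @[x --> +oo] --> r)
  (phil : phi x @[x --> -oo] --> l).

Let cphi : continuous phi.
Proof. by move=> x; apply: differentiable_continuous; apply/derivable1_diffP. Qed.

Let phi1E (x : R) : derive1 phi x = w x.
Proof. by rewrite derive1E; apply: derive_val. Qed.

Let phi_lt : {homo phi : x y / x < y}.
Proof.
move=> x y xy; have [z] := @MVT R phi w x y xy (fun z _ => dphi z) (continuous_subspaceT cphi).
by move=> _ /eqP; rewrite subr_eq => /eqP ->; rewrite ltrDr mulr_gt0// subr_gt0.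
Qed.

Let phi_le : {homo phi : x y / x <= y}.
Proof. by move=> x y; rewrite le_eqVlt => /orP[/eqP->//|/phi_lt/ltW]. Qed.

Let phi_ltr x : phi x < r.
Proof.
rewrite (@lt_le_trans _ _ (phi (x + 1)))// ?phi_lt ?ltrDl//.
have <- := cvg_lim _ phir => //; apply: limr_ge; first by apply/cvg_ex; exists r.
near=> y; apply: phi_le; near: y; by apply: nbhs_pinfty_ge; rewrite num_real.
Unshelve. all: by end_near. Qed.

Let phi_gtl x : l < phi x.
Proof.
rewrite (@le_lt_trans _ _ (phi (x - 1)))// ?phi_lt ?ltrBlDr ?ltrDl//.
have <- := cvg_lim _ phil => //; apply: limr_le; first by apply/cvg_ex; exists l.
near=> y; apply: phi_le; near: y; by apply: nbhs_ninfty_le; rewrite num_real.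
Unshelve. all: by end_near. Qed.

Let mw : measurable_fun setT w. Proof. exact: continuous_measurable_fun. Qed.
Let mphi : measurable_fun setT phi. Proof. exact: continuous_measurable_fun. Qed.

Let int_ray a : (\int[mu]_(t in `]a, +oo[) (w t)%:E = (r - phi a)%:E)%E.
Proof.
rewrite integral_itv_obnd_cbnd; last by apply: measurable_funTS; exact/measurable_EFinP.
rewrite (@ge0_continuous_FTC2y R w phi a r)//.
- by move=> x _; exact/ltW.
- exact: continuous_subspaceT.
- apply: cvg_at_right_filter; exact: cphi.
Qed.

Let int_all : (\int[mu]_t (w t)%:E = (r - l)%:E)%E.
Proof.
(* The left half-line is reflected onto [[0, +oo[], where the fundamental theorem of calculus on an
   unbounded ray applies. *)
have dphiN (x : R) : is_derive x (1:R) (fun y => - phi (- y)) (w (- x)).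
  have dN : is_derive x (1:R) (fun y : R => - y) (- 1) by apply: is_deriveN.
  have := @is_deriveN _ _ _ _ _ _ _ (is_derive1_comp (dphi (- x)) dN).
  by rewrite mulrN1 opprK.
have intN : (\int[mu]_(t in `[0%R, +oo[) (w (- t)%R)%:E = (phi 0 - l)%:E)%E.
  rewrite (@ge0_continuous_FTC2y R _ (fun y => - phi (- y)) 0 (- l))//.
  - by rewrite oppr0 -EFinB opprK addrC.
  - by move=> x _; exact/ltW.
  - apply: continuous_subspaceT => x; apply: continuous_comp; [exact: opp_continuous|exact: cw].
  - apply: cvgN; exact/cvgNy_compNP.
  - apply: cvg_at_right_filter; apply: cvgN; apply: continuous_comp; [exact: opp_continuous|exact: cphi].
  - by move=> x _; rewrite derive1E; apply: derive_val.
have mwE : measurable_fun setT (fun t => (w t)%:E) by exact/measurable_EFinP.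
rewrite -(setUv `]-oo, 0%R]) setCitvl ge0_integral_setU//=; last 3 first.
- exact: measurable_funTS.
- by move=> x _; rewrite lee_fin ltW.
- by rewrite -setCitvl; exact/disj_setPCl.
rewrite int_ray (_ : (0:R) = - 0); last by rewrite oppr0.
rewrite (ge0_integration_by_substitutionNy (a := 0)) ?oppr0//; last 2 first.
- exact: continuous_subspaceT.
- by move=> x _; exact: ltW.
by rewrite intN -EFinD; congr EFin; ring.
Qed.

(** Both sides integrate [g] against a measure: Lebesgue measure on []l, r[], and the image under
    [phi] of [w dx]. The two measures agree on the rays []x, +oo[] by the fundamental theorem of
    calculus, and these rays generate the Borel sets. *)
Lemma ge0_integral_substitution (g : R -> \bar R) :
  measurable_fun setT g -> (forall x, (0 <= g x)%E) ->
  (\int[mu]_(y in `]l, r[) g y = \int[mu]_x (g (phi x) * (w x)%:E))%E.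
Proof.
move=> mg g0.
have mH := measurable_hypograph mw.
have mpf : measurable_fun setT (fun z : R * R => phi z.1 : measurableTypeR R).
  exact: measurableT_comp.
pose m2 := pushm (mrestr mu2 mH) mpf.
have mI : measurable (`]l, r[ : set (measurableTypeR R)) by [].
pose m1 := mrestr mu mI.
have w0' x : 0 <= w x by exact: ltW.
have m2E (h : R -> \bar R) : measurable_fun setT h -> (forall x, (0 <= h x)%E) ->
   (\int[m2]_y h y = \int[mu]_x (h (phi x) * (w x)%:E))%E.
  move=> mh h0; rewrite ge0_integral_pushm//.
  exact: (ge0_integral_hypograph mw w0' (measurableT_comp mh mphi) (fun x => h0 (phi x))).
rewrite -m2E// -(ge0_integral_mrestr mu mI)//.
apply: eq_measure_integral => A mA _.
refine (@measure_unique _ R (measurableTypeR R) (@RGenOInfty.G R) (fun k => `](- k%:R)%R, +oo[%classic) _ _ _ _ _ m2 _ _ A mA) => //.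
- exact: RGenOInfty.measurableE.
- move=> _ _ [x ->] [y ->]; exists (Num.max x y).
  by apply/seteqP; split => z/=; rewrite !in_itv/= !andbT gt_max; [case=> -> ->|move/andP].
- by move=> k; exists (- k%:R).
- apply/seteqP; split => // x _; exists (Num.trunc `|x|).+1 => //=.
  rewrite in_itv/= andbT ltrNl; apply: le_lt_trans (ler_norm _) _.
  by rewrite normrN; apply: Num.Theory.truncnS_gt.
- move=> A' [x ->].
  have mIx : measurable (`]x, +oo[ : set (measurableTypeR R)) by [].
  transitivity (\int[m2]_y (\1_(`]x, +oo[) y)%:E)%E; last by rewrite integral_indic ?setIT.
  rewrite m2E//; last exact/measurable_EFinP.
  (* Three kinds of rays: those containing the whole image of [phi], those missing it, and those
     that start at a value of [phi]. *)
  have [xl|lx] := leP x l.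
    transitivity (mu `]l, r[%classic).
      congr (mu _); apply/seteqP; split => y/=; first by case.
      by move=> /[dup] + ->; rewrite !in_itv/= andbT => /andP[/(le_lt_trans xl) ->].
    transitivity (r - l)%:E.
      by rewrite lebesgue_measure_itv/= lte_fin (lt_trans (phi_gtl 0) (phi_ltr 0)).
    rewrite -int_all; apply: eq_integral => t _.
    by rewrite indicE mem_set ?mul1e//= in_itv/= andbT (le_lt_trans xl).
  have [rx|xr] := leP r x.
    transitivity (0%:E : \bar R); last first.
      rewrite integral0_eq// => t _; rewrite indicE memNset ?mul0e//= in_itv/= andbT.
      by apply/negP; rewrite -leNgt (le_trans _ rx)// ltW.
    transitivity (mu set0); last by rewrite measure0.
    congr (mu _); apply/seteqP; split => y//=.
    by rewrite !in_itv/= andbT => -[xy /andP[_ yr]]; have := lt_trans yr (le_lt_trans rx xy); rewrite ltxx.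
  have [x' <-] : exists x', phi x' = x.
    have [a ax] : exists a, phi a <= x.
      near (-oo%R : set_system R) => a; exists a; near: a.
      by apply: (cvgr_le l).
    have [b xb] : exists b, x <= phi b.
      near (+oo%R : set_system R) => b; exists b; near: b.
      by apply: (cvgr_ge r).
    have ab : a <= b.
      by rewrite leNgt; apply/negP => /phi_lt; rewrite ltNge (le_trans ax xb).
    have [|c _ <-] := @IVT R phi a b x ab (continuous_subspaceT cphi); last by exists c.
    by rewrite ge_min le_max ax xb orbT.
  transitivity (mu `]phi x', r[%classic).
    congr (mu _); apply/seteqP; split => y/=; rewrite !in_itv/= andbT; first by case=> -> /andP[].
    by move=> /andP[/[dup] h -> ->]; rewrite (lt_trans (phi_gtl x')).
  rewrite lebesgue_measure_itv/= lte_fin phi_ltr -EFinB -int_ray integral_mkcond.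
  apply: eq_integral => t _; rewrite patchE indicE.
  have -> : (phi t \in `]phi x', +oo[%classic) = (t \in `]x', +oo[%classic).
    apply/idP/idP; rewrite !inE/= !in_itv/= !andbT; last exact: phi_lt.
    by apply: contraTT; rewrite -!leNgt; apply: phi_le.
  by case: ifPn => _; rewrite ?mul1e ?mul0e.
(* The exhausting rays have finite measure because []l, r[] is bounded. *)
- move=> k; rewrite /m1 /mrestr.
  apply: le_lt_trans (le_measure mu _ _ (@subIsetr _ _ _)) _; rewrite ?inE//=.
    exact: measurableI.
  by rewrite lebesgue_measure_itv/=; case: ifPn => _; rewrite -?EFinB ltry.
Unshelve. all: by end_near. Qed.

End Substitution.

(** * The hyperbolic disk and its Klein model *)

Section Hyperbolic.
Variable R : realType.
Implicit Types t a : R.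

Definition cosca a : R := cos (atan a).
Definition sinca a : R := sin (atan a).
Definition sech t : R := 2 / (expR t + expR (- t)).

Lemma expRDN_gt0 t : 0 < expR t + expR (- t).
Proof. by rewrite addr_gt0// expR_gt0. Qed.

Lemma sech_gt0 t : 0 < sech t.
Proof. by rewrite divr_gt0// expRDN_gt0. Qed.

Lemma sqr_sech t : sech t ^+ 2 = 1 - tanhR t ^+ 2.
Proof.
rewrite /sech /tanhR expRN; have := expR_gt0 t; set e := expR t => e0.
have e1 : e != 0 by rewrite lt0r_neq0.
have e2 : e * e + 1 != 0 by rewrite lt0r_neq0//; nra.
by field; rewrite e1 e2.
Qed.

Lemma sech_le1 t : sech t <= 1.
Proof. by rewrite -ler_sqr ?nnegrE ?(ltW (sech_gt0 t))// sqr_sech expr1n lerBlDr lerDl sqr_ge0. Qed.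

Lemma sqr_tanhR_lt1 t : tanhR t ^+ 2 < 1.
Proof. by rewrite -subr_gt0 -sqr_sech exprn_gt0// sech_gt0. Qed.

Lemma tanhR_bound t : -1 < tanhR t < 1.
Proof.
by rewrite -ltr_norml -[X in _ < X]normr1 -ltr_sqr ?nnegrE// !real_normK ?num_real// expr1n sqr_tanhR_lt1.
Qed.

Lemma tanhRN t : tanhR (- t) = - tanhR t.
Proof. by rewrite /tanhR opprK [expR (- t) + expR t]addrC -mulNr opprB. Qed.

Lemma sechN t : sech (- t) = sech t.
Proof. by rewrite /sech opprK [expR (- t) + _]addrC. Qed.

Global Instance is_derive_tanhR t : is_derive t (1:R) (@tanhR R) (sech t ^+ 2).
Proof.
have dN : is_derive t (1:R) (fun y : R => - y) (- 1) by apply: is_deriveN.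
have dE := is_derive1_comp (is_derive_expR (- t)) dN.
have d0 : (@expR R + (@expR R \o -%R)) t != 0 by rewrite /= lt0r_neq0// expRDN_gt0.
have dB := is_deriveB (is_derive_expR t) dE.
have dV := is_deriveV d0 (is_deriveD (is_derive_expR t) dE).
apply: is_derive_eq (is_deriveM dB dV) _.
have E1 : (@expR R + (@expR R \o -%R)) t = expR t + expR (- t) by [].
have E2 : (@expR R - (@expR R \o -%R)) t = expR t - expR (- t) by [].
rewrite /GRing.scale/= E1 ?E2 /sech /tanhR !expRN.
have := expR_gt0 t; set e := expR t => e0.
have e1 : e != 0 by rewrite lt0r_neq0.
have e2 : e * e + 1 != 0 by rewrite lt0r_neq0//; nra.
by field; rewrite e1 e2.
Qed.

Global Instance is_derive_sech t : is_derive t (1:R) sech (- sech t * tanhR t).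
Proof.
have dN : is_derive t (1:R) (fun y : R => - y) (- 1) by apply: is_deriveN.
have dE := is_derive1_comp (is_derive_expR (- t)) dN.
have d0 : (@expR R + (@expR R \o -%R)) t != 0 by rewrite /= lt0r_neq0// expRDN_gt0.
have dV := is_deriveV d0 (is_deriveD (is_derive_expR t) dE).
apply: is_derive_eq (is_deriveM (is_derive_cst (2:R) t 1) dV) _.
have E1 : (@expR R + (@expR R \o -%R)) t = expR t + expR (- t) by [].
have E2 : (@expR R - (@expR R \o -%R)) t = expR t - expR (- t) by [].
rewrite /GRing.scale/= E1 ?E2 /sech /tanhR !expRN.
have := expR_gt0 t; set e := expR t => e0.
have e1 : e != 0 by rewrite lt0r_neq0.
have e2 : e * e + 1 != 0 by rewrite lt0r_neq0//; nra.
by field; rewrite e1 e2.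
Qed.

Lemma continuous_tanhR : continuous (@tanhR R).
Proof. by move=> x; apply: differentiable_continuous; apply/derivable1_diffP. Qed.

Lemma continuous_sech : continuous sech.
Proof. by move=> x; apply: differentiable_continuous; apply/derivable1_diffP. Qed.

Lemma cvgy_tanhR : @tanhR R t @[t --> +oo] --> (1:R).
Proof.
rewrite (_ : @tanhR R = fun t => (1 - expR (- t) ^+ 2) / (1 + expR (- t) ^+ 2)); last first.
  apply/funext => t; rewrite /tanhR !expRN; have := expR_gt0 t; set e := expR t => e0.
  have e1 : e != 0 by rewrite lt0r_neq0.
  have e2 : e * e + 1 != 0 by rewrite lt0r_neq0//; nra.
  have e3 : 1 + e * e != 0 by rewrite addrC.
  by field; rewrite ?e1 ?e2 ?e3.
have h : expR (- t) ^+ 2 @[t --> +oo] --> (0 : R).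
  have -> : (0:R) = 0 ^+ 2 by rewrite expr0n.
  by apply: (cvg_comp (fun t : R => expR (- t)) (fun y : R => y ^+ 2)); [exact: cvgr_expR|exact: exprn_continuous].
rewrite [X in _ --> X](_ : _ = (1 - 0) / (1 + 0) :> R); last by rewrite subr0 addr0 divr1.
apply: cvgM; first by apply: cvgB => //; exact: cvg_cst.
apply: cvgV; first by rewrite addr0 oner_neq0.
by apply: cvgD => //; exact: cvg_cst.
Qed.

Lemma cvgNy_tanhR : @tanhR R t @[t --> -oo] --> (- 1 : R).
Proof.
apply/cvgNy_compNP; rewrite (_ : _ \o _ = fun t => - tanhR t); last first.
  by apply/funext => t /=; rewrite tanhRN.
exact: cvgN cvgy_tanhR.
Qed.

Lemma cosca_gt0 a : 0 < cosca a.
Proof. by rewrite /cosca cos_atan invr_gt0 sqrtr_gt0 ltr_pwDl// sqr_ge0. Qed.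

Lemma cosca_le1 a : cosca a <= 1.
Proof. exact: cos_le1. Qed.

Lemma sqr_sinca a : sinca a ^+ 2 = 1 - cosca a ^+ 2.
Proof. by rewrite sin2cos2. Qed.

Lemma sqr_cosca a : cosca a ^+ 2 = (1 + a ^+ 2)^-1.
Proof. by rewrite /cosca cos_atan exprVn sqr_sqrtr// addr_ge0// sqr_ge0. Qed.

Lemma sincaE a : sinca a = a * cosca a.
Proof.
rewrite -{2}[a](atanK) /tan /sinca /cosca divfK// lt0r_neq0//; exact: cosca_gt0.
Qed.

Lemma coscaN a : cosca (- a) = cosca a.
Proof. by rewrite /cosca atanN cosN. Qed.

Lemma sincaN a : sinca (- a) = - sinca a.
Proof. by rewrite /sinca atanN sinN. Qed.

Lemma sinca_norm_le1 a : `|sinca a| <= 1.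
Proof. by rewrite ler_norml sin_geN1 sin_le1. Qed.

Global Instance is_derive_sinca a : is_derive a (1:R) sinca (cosca a ^+ 3).
Proof.
have := is_derive1_comp (is_derive_sin (atan a)) (is_derive1_atan a).
by move/is_derive_eq; apply; rewrite -sqr_cosca -[cos _]/(cosca a) -exprS.
Qed.

Lemma continuous_cosca : continuous cosca.
Proof. by move=> x; apply: continuous_comp; [exact: continuous_atan|exact: continuous_cos]. Qed.

Lemma continuous_sinca : continuous sinca.
Proof. by move=> x; apply: continuous_comp; [exact: continuous_atan|exact: continuous_sin]. Qed.

Lemma cvgy_sinca : sinca a @[a --> +oo] --> (1:R).
Proof.
rewrite -(@sin_pihalf R); apply: continuous_cvg; [exact: continuous_sin|exact: cvgy_atan].
Qed.

Lemma cvgNy_sinca : sinca a @[a --> -oo] --> (-1:R).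
Proof.
apply/cvgNy_compNP; rewrite (_ : _ \o _ = fun t => - sinca t); last first.
  by apply/funext => t /=; rewrite sincaN.
exact: cvgN cvgy_sinca.
Qed.

End Hyperbolic.

(** * Integrals of periodic functions over one period *)

Section Periodic.
Variable R : realType.
Local Notation mu := (@lebesgue_measure R).

Definition arc : set R := [set x | 0 <= x < 2 * pi].

Lemma arcE : arc = `[0, 2 * pi[%classic.
Proof. by apply/seteqP; split => x; rewrite /arc/= in_itv. Qed.

Lemma measurable_arc : measurable arc.
Proof. by rewrite arcE. Qed.

Lemma pi2_gt0 : 0 < 2 * pi :> R.
Proof. by rewrite mulr_gt0// pi_gt0. Qed.

Lemma periodicz (T : Type) (k : R -> T) (P : R) : (forall x, k (x + P) = k x) ->
  forall (n : int) x, k (x + n%:~R * P) = k x.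
Proof.
move=> kP.
have kn (n : nat) x : k (x + n%:R * P) = k x.
  elim: n => [|n IH]; first by rewrite mul0r addr0.
  by rewrite -natr1 mulrDl mul1r addrA kP.
case=> n x; first exact: kn.
by rewrite -[in RHS](subrK (n.+1%:R * P) x) kn NegzE mulrNz mulNr.
Qed.

Lemma integral_itv_shift (k : R -> \bar R) (a b c : R) :
  measurable_fun setT k -> (forall x, (0 <= k x)%E) ->
  (\int[mu]_(x in `[a, b[) k (x + c)%R = \int[mu]_(x in `[(a + c)%R, (b + c)%R[) k x)%E.
Proof.
move=> mk k0.
rewrite integral_mkcond [RHS]integral_mkcond.
rewrite -[RHS](ge0_integral_shift c)/=.
- apply: eq_integral => x _; rewrite !patchE.
  rewrite (_ : (x + c \in _) = (x \in `[a, b[%classic))//.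
  by apply/idP/idP; rewrite !inE/= !in_itv/= lerD2r ltrD2r.
- have mI : measurable (`[(a + c)%R, (b + c)%R[ : set (measurableTypeR R)) by [].
  by apply/(measurable_restrictT _ mI); exact: measurable_funTS.
- exact: erestrict_ge0.
Qed.

Variable k : R -> \bar R.
Hypotheses (mk : measurable_fun setT k) (k0 : forall x, (0 <= k x)%E)
  (kP : forall x, k (x + 2 * pi) = k x).

(** Modulo the period, [c] becomes a point [d] of [arc]; the window from [d] is cut at [2 * pi], and
    the part beyond, moved back by one period, fills [[0, d[]. *)
Lemma ge0_integral_period (c : R) :
  (\int[mu]_(x in `[c, (c + 2 * pi)%R[) k x = \int[mu]_(x in arc) k x)%E.
Proof.
have P0 := pi2_gt0; rewrite arcE.
pose n := Num.floor (c / (2 * pi)).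
pose d := c - n%:~R * (2 * pi).
have d0 : 0 <= d by rewrite subr_ge0 -ler_pdivlMr// Num.Theory.floor_le_tmp.
have dP : d < 2 * pi.
  by rewrite ltrBlDr -[X in _ < X + _]mul1r -mulrDl -ltr_pdivrMr// addrC -intrD1 Num.Theory.floorD1_gt.
have -> : c = d + n%:~R * (2 * pi) by rewrite subrK.
rewrite [X in `[_, X[%classic]addrAC -integral_itv_shift//.
under eq_integral do rewrite periodicz//.
have split2 (a b e : R) : a <= b -> b <= e ->
  (\int[mu]_(x in `[a, e[) k x = \int[mu]_(x in `[a, b[) k x + \int[mu]_(x in `[b, e[) k x)%E.
  move=> ab be; rewrite (@itv_bndbnd_setU _ _ (BLeft a) (BLeft b) (BLeft e))// ge0_integral_setU//.
  - exact: measurable_funTS.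
  - apply/disj_setPS => x []/=; rewrite !in_itv/= => /andP[_ xb] /andP[bx _].
    by move: (lt_le_trans xb bx); rewrite ltxx.
rewrite (split2 _ (2 * pi)) ?(ltW dP)//; last by rewrite lerDr.
rewrite [RHS](split2 _ d) ?(ltW dP)// addeC; congr (_ + _)%E.
have := integral_itv_shift 0 d (2 * pi) mk k0; rewrite add0r => <-.
by under eq_integral do rewrite kP.
Qed.

Lemma ge0_integral_arc_shift (c : R) :
  (\int[mu]_(x in arc) k (x + c)%R = \int[mu]_(x in arc) k x)%E.
Proof. by rewrite arcE integral_itv_shift// add0r addrC ge0_integral_period arcE. Qed.

End Periodic.

Section Measurability.
Variable R : realType.

(** The inverse is continuous off 0, and the single point 0, with the convention [0^-1 = 0], is
    split off. *)
Lemma measurable_inv : measurable_fun [set: R] (fun x : R => x^-1).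
Proof.
have m0 : measurable ([set 0] : set R) by exact: measurable_set1.
rewrite -(setvU [set 0]); apply/measurable_funU => //; first exact: measurableC.
split; last exact: measurable_fun_set1.
apply: open_continuous_measurable_fun.
  by rewrite openC; exact: closed_eq.
by move=> x; rewrite inE/= => /eqP x0; exact: inv_continuous.
Qed.

Lemma measurable_cos : measurable_fun [set: R] (@cos R).
Proof. by apply: continuous_measurable_fun; exact: continuous_cos. Qed.

Lemma measurable_sin : measurable_fun [set: R] (@sin R).
Proof. by apply: continuous_measurable_fun; exact: continuous_sin. Qed.

Lemma measurable_atan : measurable_fun [set: R] (@atan R).
Proof. by apply: continuous_measurable_fun; exact: continuous_atan. Qed.

Lemma measurable_cosca : measurable_fun [set: R] (@cosca R).
Proof. by apply: continuous_measurable_fun; exact: continuous_cosca. Qed.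

Lemma measurable_sinca : measurable_fun [set: R] (@sinca R).
Proof. by apply: continuous_measurable_fun; exact: continuous_sinca. Qed.

Lemma measurable_tanhR : measurable_fun [set: R] (@tanhR R).
Proof. by apply: continuous_measurable_fun; exact: continuous_tanhR. Qed.

Lemma measurable_sech : measurable_fun [set: R] (@sech R).
Proof. by apply: continuous_measurable_fun; exact: continuous_sech. Qed.

Lemma measurable_sqrt : measurable_fun [set: R] (@Num.sqrt R).
Proof. by apply: continuous_measurable_fun; exact: sqrt_continuous. Qed.

End Measurability.

(** Recursion on the body of the function. Leaves are closed from the context, which is why
    measurability facts are often introduced just before a call. *)
Ltac mfun :=
  first [ assumption | exact: measurable_fst | exact: measurable_snd |
  lazymatch goal with
  | |- measurable_fun _ (fun x => x) => exact: measurable_id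
  | |- measurable_fun _ (fun _ => ?c) => exact: measurable_cst
  | |- measurable_fun _ (fun x => (@?f x, @?g x)) =>
      apply: (@measurable_fun_pair _ _ _ _ _ _ f g); mfun
  | |- measurable_fun _ (fun x => ((@?f x)%:E)) => apply/measurable_EFinP; mfun
  | |- measurable_fun _ (fun x => (@?f x * @?g x)%E) =>
      apply: (@emeasurable_funM _ _ _ _ f g); mfun
  | |- measurable_fun _ (fun x => (@?f x + @?g x)%E) =>
      apply: (@emeasurable_funD _ _ _ _ f g); mfun
  | |- measurable_fun _ (fun x => (@?f x - @?g x)%R) =>
      apply: (@measurable_funB _ _ _ _ f g); mfun
  | |- measurable_fun _ (fun x => (@?f x + @?g x)%R) =>
      apply: (@measurable_funD _ _ _ _ f g); mfun
  | |- measurable_fun _ (fun x => (- @?f x)%R) =>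
      apply: (@measurable_funN _ _ _ _ f); mfun
  | |- measurable_fun _ (fun x => (@?f x * @?g x)%R) =>
      apply: (@measurable_funM _ _ _ _ f g); mfun
  | |- measurable_fun _ (fun x => (@?f x ^+ ?n)%R) =>
      apply: (@measurable_funX _ _ _ _ f n); mfun
  | |- measurable_fun _ (fun x => ((@?f x)^-1)%R) =>
      apply: (measurableT_comp (@measurable_inv _) (_ : measurable_fun _ f)); mfun
  | |- measurable_fun _ (fun x => Num.max (@?f x) (@?g x)) =>
      apply: (@measurable_maxr _ _ _ _ f g); mfun
  | |- measurable_fun _ (fun x => cos (@?f x)) =>
      apply: (measurableT_comp (@measurable_cos _) (_ : measurable_fun _ f)); mfun
  | |- measurable_fun _ (fun x => sin (@?f x)) =>
      apply: (measurableT_comp (@measurable_sin _) (_ : measurable_fun _ f)); mfun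
  | |- measurable_fun _ (fun x => atan (@?f x)) =>
      apply: (measurableT_comp (@measurable_atan _) (_ : measurable_fun _ f)); mfun
  | |- measurable_fun _ (fun x => cosca (@?f x)) =>
      apply: (measurableT_comp (@measurable_cosca _) (_ : measurable_fun _ f)); mfun
  | |- measurable_fun _ (fun x => sinca (@?f x)) =>
      apply: (measurableT_comp (@measurable_sinca _) (_ : measurable_fun _ f)); mfun
  | |- measurable_fun _ (fun x => tanhR (@?f x)) =>
      apply: (measurableT_comp (@measurable_tanhR _) (_ : measurable_fun _ f)); mfun
  | |- measurable_fun _ (fun x => sech (@?f x)) =>
      apply: (measurableT_comp (@measurable_sech _) (_ : measurable_fun _ f)); mfun
  | |- measurable_fun _ (fun x => Num.sqrt (@?f x)) =>
      apply: (measurableT_comp (@measurable_sqrt _) (_ : measurable_fun _ f)); mfun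
  | |- measurable_fun _ (fun x => (@?f x).1) =>
      apply: (measurableT_comp measurable_fst (_ : measurable_fun _ f)); mfun
  | |- measurable_fun _ (fun x => (@?f x).2) =>
      apply: (measurableT_comp measurable_snd (_ : measurable_fun _ f)); mfun
  end | exact: measurable_id | exact: mulrl_measurable | exact: oppr_measurable ].

(** * Polar coordinates in the plane *)

Section Polar.
Variable R : realType.
Local Notation mu := (@lebesgue_measure R).
Local Notation mu2 := (mu \x mu)%E.
Local Notation hpos r := ((Num.max r 0)%:E) (only parsing).

Lemma ge0_integral_arc_pi (k : R -> \bar R) : measurable_fun setT k ->
  (forall x, (0 <= k x)%E) -> (forall x, k (x + 2 * pi) = k x) ->
  (\int[mu]_(x in `](- (pi / 2))%R, (pi / 2)%R[) k x +
   \int[mu]_(x in `](- (pi / 2))%R, (pi / 2)%R[) k (x + pi)%R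
  = \int[mu]_(x in @arc R) k x)%E.
Proof.
move=> mk k0 kP.
have mk' : measurable_fun setT (fun x : R => k (x + pi)).
  by apply: (measurableT_comp mk); mfun.
have itvoo (f : R -> \bar R) : measurable_fun setT f ->
  (\int[mu]_(x in `](- (pi / 2))%R, (pi / 2)%R[) f x = \int[mu]_(x in `[(- (pi / 2))%R, (pi / 2)%R[) f x)%E.
  by move=> mf; rewrite -(integral_itv_bndoo true true)//; exact: measurable_funTS.
rewrite !itvoo// integral_itv_shift//.
rewrite (_ : - (pi / 2) + pi = pi / 2); last by field.
rewrite -(ge0_integral_period mk k0 kP (- (pi / 2))).
rewrite (_ : - (pi / 2) + 2 * pi = pi / 2 + pi); last by field.
rewrite -ge0_integral_setU//=; last 2 first.
- exact: measurable_funTS.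
- apply/disj_setPS => x []/=; rewrite !in_itv/= => /andP[_ xb] /andP[bx _].
  by move: (lt_le_trans xb bx); rewrite ltxx.
rewrite -itv_bndbnd_setU// bnd_simp.
  by have := pi_ge0 R; lra.
by rewrite lerDl pi_ge0.
Qed.

Lemma measurable_pos : measurable_fun setT (fun z : R * R => ((0 < z.1)%R%:R)%:E : \bar R).
Proof.
apply/measurable_EFinP.
have mb : measurable_fun setT (fun z : R * R => 0 < z.1) by apply: measurable_fun_ltr.
exact: (measurableT_comp (_ : measurable_fun setT (fun b : bool => b%:R : R)) mb).
Qed.

Lemma measurable_neg : measurable_fun setT (fun z : R * R => ((z.1 < 0)%R%:R)%:E : \bar R).
Proof.
apply/measurable_EFinP.
have mb : measurable_fun setT (fun z : R * R => z.1 < 0) by apply: measurable_fun_ltr.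
exact: (measurableT_comp (_ : measurable_fun setT (fun b : bool => b%:R : R)) mb).
Qed.

Lemma ge0_integral_opp2 (G : R * R -> \bar R) : measurable_fun setT G ->
  (forall z, (0 <= G z)%E) -> (\int[mu2]_z G (- z.1, - z.2)%R = \int[mu2]_z G z)%E.
Proof.
move=> mG G0.
have mGN : measurable_fun setT (fun z : R * R => G (- z.1, - z.2)).
  by apply: (measurableT_comp mG); mfun.
rewrite !fubini_tonelli1/=; [|by []|by []|by []|by []].
rewrite -[RHS]ge0_integral_opp; last 2 first.
- exact: measurable_fun_fubini_tonelli_F.
- by move=> x; exact: integral_ge0.
apply: eq_integral => x _; rewrite /fubini_F/= -[RHS]ge0_integral_opp//.
exact: measurable_fun_pair2.
Qed.

Section Ray.
Variable F : R * R -> \bar R.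
Hypotheses (mF : measurable_fun setT F) (F0 : forall z, (0 <= F z)%E).

(** The factor [Num.max r 0] is the polar Jacobian [r], cut off so that the integral can run over
    the whole line. *)
Definition ray (w : R) : \bar R :=
  (\int[mu]_r (F (r * cos w, r * sin w)%R * hpos r))%E.

Lemma ray2pi w : ray (w + 2 * pi) = ray w.
Proof. by rewrite /ray mulrC mulr_natr cosD2pi sinD2pi. Qed.

Lemma measurable_ray : measurable_fun setT ray.
Proof.
apply: (@measurable_fun_fubini_tonelli_F _ _ _ _ _ mu
  (fun z : R * R => F (z.2 * cos z.1, z.2 * sin z.1)%R * hpos z.2)%E).
  apply: emeasurable_funM; last by mfun.
  by apply: (measurableT_comp mF); mfun.
by move=> z; rewrite mule_ge0// lee_fin le_max lexx orbT.
Qed.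

Lemma ray_ge0 w : (0 <= ray w)%E.
Proof. by apply: integral_ge0 => r _; rewrite mule_ge0// lee_fin le_max lexx orbT. Qed.

(* In the half plane [x > 0] substitute [y = x v], then [x = r cos (atan v)]. *)
Lemma ge0_integral_half_polar :
  (\int[mu2]_z (F z * ((0 < z.1)%R%:R)%:E) =
   \int[mu]_(w in `](- (pi / 2))%R, (pi / 2)%R[) ray w)%E.
Proof.
have mpos := measurable_pos.
have mh : measurable_fun setT (fun z : R * R => F (z.1, z.1 * z.2)%R * hpos z.1)%E.
  apply: emeasurable_funM; last by mfun.
  by apply: (measurableT_comp mF); mfun.
have h0 (z : R * R) : (0 <= F (z.1, z.1 * z.2)%R * hpos z.1)%E.
  by rewrite mule_ge0// lee_fin le_max lexx orbT.
rewrite fubini_tonelli1; last 2 first.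
- by apply: emeasurable_funM.
- by move=> z; rewrite mule_ge0// lee_fin ler0n.
transitivity (\int[mu]_x \int[mu]_v (F (x, x * v)%R * hpos x))%E.
  apply: eq_integral => x _; rewrite /fubini_F/=.
  have [x0|x0] := ltP 0 x; last first.
    by under eq_integral do rewrite mule0; under [RHS]eq_integral do rewrite mule0.
  have mFx : measurable_fun setT (fun y => F (x, y)) by exact: measurable_fun_pair2.
  under eq_integral do rewrite mule1.
  rewrite (ge0_integral_affine 0 x0)// muleC.
  rewrite ge0_integralZr//=; last 2 first.
  - by apply: (measurableT_comp mFx); mfun.
  - by rewrite lee_fin ltW.
  by under eq_integral do rewrite addr0.
have := @fubini_tonelli _ _ _ _ R mu mu _ mh h0; rewrite /= => ->.
transitivity (\int[mu]_v (ray (atan v) * ((1 + v ^+ 2)^-1)%:E))%E; last first.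
  apply/esym; apply: (ge0_integral_substitution (phi := @atan R)) => //.
  - by move=> x; rewrite -sqr_cosca exprn_gt0// cosca_gt0.
  - rewrite (_ : (fun _ => _) = (fun y => y ^+ 2) \o @cosca R); last first.
      by apply/funext => x /=; rewrite sqr_cosca.
    by move=> x; apply: continuous_comp; [exact: continuous_cosca|exact: exprn_continuous].
  - exact: cvgy_atan.
  - apply/cvgNy_compNP; rewrite (_ : _ \o _ = fun t => - atan t); last first.
      by apply/funext => t /=; rewrite atanN.
    exact: cvgN (@cvgy_atan R).
  - exact: measurable_ray.
  - exact: ray_ge0.
apply: eq_integral => v _.
have c0 := cosca_gt0 v.
rewrite (ge0_integral_affine 0 c0)//; last 2 first.
- exact: (measurable_fun_pair1 v mh).
- by move=> x; exact: (h0 (x, v)).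
rewrite -sqr_cosca /ray muleC -!ge0_integralZr//=; last first.
- by rewrite lee_fin ltW.
- by move=> x _; exact: (h0 (_, v)).
- exact: (measurableT_comp (measurable_fun_pair1 v mh) (measurable_affine (cosca v) 0)).
- by rewrite lee_fin exprn_ge0// ltW.
- by move=> x _; rewrite mule_ge0// lee_fin le_max lexx orbT.
- apply: emeasurable_funM; last by mfun.
  by apply: (measurableT_comp mF); mfun.
apply: eq_integral => r _; rewrite addr0 -/(cosca v) -/(sinca v) sincaE.
rewrite -!muleA -!EFinM; congr (F (_, _) * _%:E)%E; first by ring.
  by ring.
rewrite expr2 [RHS]mulrA; congr (_ * _); by rewrite maxr_pMl ?(ltW c0)// mul0r [r * _]mulrC.
Qed.

End Ray.

Variable F : R * R -> \bar R.
Hypotheses (mF : measurable_fun setT F) (F0 : forall z, (0 <= F z)%E).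

(** The central symmetry carries the half plane [z.1 < 0] to the one already treated, and the line
    [z.1 = 0] is negligible. *)
Lemma ge0_integral_polar : (\int[mu2]_z F z = \int[mu]_(w in @arc R) ray F w)%E.
Proof.
have mFN : measurable_fun setT (fun z : R * R => F (- z.1, - z.2)).
  by apply: (measurableT_comp mF); mfun.
rewrite -ge0_integral_arc_pi; last 3 first.
- exact: measurable_ray.
- exact: ray_ge0.
- exact: ray2pi.
have rayN w : ray F (w + pi) = ray (fun z => F (- z.1, - z.2)) w.
  by rewrite /ray cosDpi sinDpi; apply: eq_integral => r _; rewrite !mulrN.
under [X in (_ + X)%E]eq_integral do rewrite rayN.
rewrite -!ge0_integral_half_polar//.
have -> : (\int[mu2]_z (F (- z.1, - z.2)%R * ((0 < z.1)%R%:R)%:E) =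
  \int[mu2]_z (F z * ((z.1 < 0)%R%:R)%:E))%E.
  rewrite -[RHS]ge0_integral_opp2//.
  - by apply: eq_integral => z _; rewrite /= oppr_lt0.
  - by apply: emeasurable_funM => //; exact: measurable_neg.
  - by move=> z; rewrite mule_ge0// lee_fin ler0n.
rewrite -ge0_integralD//=; last 4 first.
- by move=> z _; rewrite mule_ge0// lee_fin ler0n.
- by apply: emeasurable_funM => //; exact: measurable_pos.
- by move=> z _; rewrite mule_ge0// lee_fin ler0n.
- by apply: emeasurable_funM => //; exact: measurable_neg.
have mFF : measurable_fun setT (fun z : R * R => F z * ((0 < z.1)%R%:R)%:E + F z * ((z.1 < 0)%R%:R)%:E)%E.
  by apply: emeasurable_funD; apply: emeasurable_funM => //; [exact: measurable_pos|exact: measurable_neg].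
rewrite !fubini_tonelli1; [|by []| |by []|by []]; last first.
  by move=> z; rewrite adde_ge0// mule_ge0// lee_fin ler0n.
have mT : measurable ([set: R] `\ 0 : set (measurableTypeR R)) by exact: measurableD.
rewrite -(integral_setD1 mT); last first.
  apply: measurable_funTS; exact: measurable_fun_fubini_tonelli_F.
rewrite -[RHS](integral_setD1 mT); last first.
  apply: measurable_funTS; apply: measurable_fun_fubini_tonelli_F => // z.
  by rewrite adde_ge0// mule_ge0// lee_fin ler0n.
apply: eq_integral => x; rewrite inE/= => -[_ /eqP x0]; rewrite /fubini_F.
apply: eq_integral => y _ /=.
by case: ltgtP x0 => //= _ _; rewrite mule0 mule1 ?add0e ?adde0.
Qed.

End Polar.

(** * The measure on geodesic points in the Klein and Poincare models *)

Section Klein.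
Variable R : realType.
Local Notation mu := (@lebesgue_measure R).
Local Notation mu2 := (mu \x mu)%E.
Implicit Types (k z : R * R) (a t g : R).

Definition klein a t : R * R := (- sinca a, cosca a * tanhR t).
Definition rot g k : R * R := (k.1 * cos g - k.2 * sin g, k.1 * sin g + k.2 * cos g).
Definition klein2disk k : R * R :=
  (k.1 / (1 + Num.sqrt (1 - r2 k)), k.2 / (1 + Num.sqrt (1 - r2 k))).
(** Density, in the Klein disk, of the image of [cosca a ^+ 2 da dt]. [ddens] is the same measure
    read in the Poincare disk, namely [bdf] times hyperbolic area. Both are extended by 0 to the
    plane. *)
Definition kdens k : R := if r2 k < 1 then (1 - r2 k)^-1 else 0.
Definition ddens z : R := if r2 z < 1 then bdf z * hypdens z else 0.

Lemma measurable_r2 : measurable_fun setT (@r2 R).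
Proof. by rewrite /r2; mfun. Qed.

Lemma measurable_disk : measurable (@Disk R).
Proof.
rewrite (_ : @Disk R = setT `&` ((fun z => r2 z < 1) @^-1` [set true])); last first.
  by apply/seteqP; split => z; rewrite setTI.
by apply: (measurable_fun_ltr measurable_r2 (measurable_cst _)).
Qed.

Lemma measurable_kdens : measurable_fun setT kdens.
Proof.
rewrite /kdens; apply: measurable_fun_ifT => //; last first.
  by apply: (measurableT_comp (@measurable_inv _)); apply: measurable_funB => //; exact: measurable_r2.
by apply: measurable_fun_ltr => //; exact: measurable_r2.
Qed.

Lemma measurable_ddens : measurable_fun setT ddens.
Proof.
rewrite /ddens /bdf /hypdens; have h := measurable_r2; apply: measurable_fun_ifT => //; last by mfun.
by apply: measurable_fun_ltr.
Qed.

Lemma measurable_klein2disk : measurable_fun setT klein2disk.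
Proof. by rewrite /klein2disk; have h := measurable_r2; mfun. Qed.

Lemma measurable_rot g : measurable_fun setT (rot g).
Proof. by rewrite /rot; mfun. Qed.

Lemma kdens_ge0 k : 0 <= kdens k.
Proof. by rewrite /kdens; case: ifPn => // h; rewrite invr_ge0 subr_ge0 ltW. Qed.

Lemma ddens_ge0 z : 0 <= ddens z.
Proof.
rewrite /ddens /bdf /hypdens; case: ifPn => // h.
have r0 : 0 <= r2 z by rewrite /r2 addr_ge0// sqr_ge0.
by rewrite mulr_ge0// divr_ge0// ?exprn_ge0// ?subr_ge0 ?(ltW h)// addr_ge0.
Qed.

Lemma r2_klein a t : r2 (klein a t) = 1 - (cosca a * sech t) ^+ 2.
Proof. have h1 := sqr_sinca a; have h2 := sqr_sech t.
transitivity (sinca a ^+ 2 + cosca a ^+ 2 * tanhR t ^+ 2); first by rewrite /r2/=; ring.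
by rewrite h1 -[tanhR t ^+ 2](subKr 1) -h2; ring. Qed.

Lemma r2_klein_lt1 a t : r2 (klein a t) < 1.
Proof. by rewrite r2_klein ltrBlDr ltrDl exprn_gt0// mulr_gt0// ?cosca_gt0// sech_gt0. Qed.

Lemma r2_rot g k : r2 (rot g k) = r2 k.
Proof. by rewrite /r2/=; have := cos2Dsin2 g; move: (cos g) (sin g) => c s; nra. Qed.

Let subst_tanh_scaled c (G : R -> \bar R) : 0 < c -> measurable_fun setT G ->
  (forall x, (0 <= G x)%E) ->
  (\int[mu]_(y in `](- c)%R, c[) G y = \int[mu]_t (G (c * tanhR t)%R * (c * sech t ^+ 2)%:E))%E.
Proof.
move=> c0 mG G0; apply: (ge0_integral_substitution (phi := fun t => c * tanhR t)) => //.
- by move=> x; rewrite mulr_gt0// exprn_gt0// sech_gt0.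
- move=> x; apply: cvgM; first exact: cvg_cst.
  by apply: (cvg_comp (@sech R) (fun y => y ^+ 2)); [exact: continuous_sech|exact: exprn_continuous].
- by rewrite -[X in _ --> X]mulr1; apply: cvgM; [exact: cvg_cst|exact: cvgy_tanhR].
- by rewrite -[X in _ --> X]mulrN1; apply: cvgM; [exact: cvg_cst|exact: cvgNy_tanhR].
Qed.

(** With [c = cosca a], the area element of the chord coordinates is [c^4 sech^2 t da dt] and
    [1 - r2 = c^2 sech^2 t]; the quotient leaves the weight [c^2]. The substitution is made in [t]
    first, then in [a]. *)
Lemma ge0_integral_klein (G : R * R -> \bar R) : measurable_fun setT G ->
  (forall k, (0 <= G k)%E) ->
  (\int[mu]_a ((\int[mu]_t G (klein a t)) * (cosca a ^+ 2)%:E) =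
   \int[mu2]_k (G k * (kdens k)%:E))%E.
Proof.
move=> mG G0.
have mGk : measurable_fun setT (fun k => G k * (kdens k)%:E)%E.
  by apply: emeasurable_funM => //; apply/measurable_EFinP; exact: measurable_kdens.
have Gk0 k : (0 <= G k * (kdens k)%:E)%E by rewrite mule_ge0// lee_fin kdens_ge0.
rewrite fubini_tonelli1//.
pose L p := (\int[mu]_s (G (p, s) * (kdens (p, s))%:E))%E.
have mL : measurable_fun setT L by apply: (@measurable_fun_fubini_tonelli_F _ _ _ _ _ mu (fun k => G k * (kdens k)%:E)%E).
have L0 p : (0 <= L p)%E by apply: integral_ge0 => s _.
transitivity (\int[mu]_p L p)%E; last by [].
have inner a : (\int[mu]_t G (klein a t) = L (- sinca a)%R * (cosca a)%:E)%E.
  have c0 := cosca_gt0 a.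
  pose H s := (G (- sinca a, s)%R * (kdens (- sinca a, s)%R * cosca a)%:E)%E.
  have mGk1 : measurable_fun setT (fun s => G (- sinca a, s)%R * (kdens (- sinca a, s)%R)%:E)%E.
    exact: (measurable_fun_pair2 (- sinca a) mGk).
  have mH : measurable_fun setT H.
    rewrite /H; under eq_fun do rewrite EFinM muleA.
    exact: emeasurable_funM.
  have H0 s : (0 <= H s)%E by rewrite mule_ge0// lee_fin mulr_ge0 ?kdens_ge0// ltW.
  transitivity (\int[mu]_s H s)%E; last first.
    rewrite /L -ge0_integralZr//=; last first.
    - by rewrite lee_fin ltW.
    by apply: eq_integral => s _; rewrite -muleA -EFinM.
  transitivity (\int[mu]_(s in `](- cosca a)%R, (cosca a)%R[) H s)%E; last first.
    rewrite integral_mkcond; apply: eq_integral => s _; rewrite patchE.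
    case: ifPn => //; rewrite notin_setE/= in_itv/= => h.
    rewrite /H /kdens ifF ?mul0r ?mule0//; apply/negbTE; rewrite -leNgt /r2/= sqrrN sqr_sinca.
    move/negP: h; rewrite -ltr_norml -leNgt => h.
    have : cosca a ^+ 2 <= s ^+ 2 by rewrite -[s ^+ 2]real_normK ?num_real// ler_sqr ?nnegrE// ltW.
    lra.
  rewrite subst_tanh_scaled//; apply: eq_integral => t _.
  rewrite /H -muleA -EFinM -/(klein a t) /kdens r2_klein_lt1 r2_klein.
  rewrite (_ : _ * _ * _ = 1) ?mule1//.
  move: (sech t) (cosca a) c0 (sech_gt0 t) => S c c0' S0.
  by rewrite subKr exprMn; field; rewrite !lt0r_neq0.
transitivity (\int[mu]_a (L (- sinca a)%R * (cosca a ^+ 3)%:E))%E.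
  by apply: eq_integral => a _; rewrite inner -muleA -EFinM -exprS.
rewrite -(ge0_integral_opp mL)//.
transitivity (\int[mu]_(p in `](-1)%R, 1%R[) L (- p)%R)%E.
  apply/esym; apply: (@ge0_integral_substitution R (@sinca R) (fun a => cosca a ^+ 3) (- 1) 1 _ _ _ _ _ (fun p => L (- p)%R)) => //.
  - by move=> x; rewrite exprn_gt0// cosca_gt0.
  - by move=> x; apply: (cvg_comp (@cosca R) (fun y => y ^+ 3)); [exact: continuous_cosca|exact: exprn_continuous].
  - exact: cvgy_sinca.
  - exact: cvgNy_sinca.
  - by apply: (measurableT_comp mL); mfun.
rewrite integral_mkcond; apply: eq_integral => p _; rewrite patchE.
case: ifPn => //; rewrite notin_setE/= in_itv/= => h.
rewrite /L integral0_eq// => s _; rewrite /kdens ifF ?mule0//; apply/negbTE; rewrite -leNgt /r2/= sqrrN.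
move/negP: h; rewrite -ltr_norml -leNgt => h.
have : 1 <= p ^+ 2 by rewrite -[p ^+ 2]real_normK ?num_real// -[1](expr1n _ 2) ler_sqr ?nnegrE.
by have := sqr_ge0 s; lra.
Qed.

Lemma tanhR_half (e : R) : tanhR e = 2 * tanhR (e / 2) / (1 + tanhR (e / 2) ^+ 2).
Proof.
rewrite /tanhR !expRN (_ : expR e = expR (e / 2) ^+ 2); last first.
  by rewrite -expRM_natl; congr expR; field.
have := expR_gt0 (e / 2); set x := expR (e / 2) => x0.
have x1 : x != 0 by rewrite lt0r_neq0.
have x2 : 0 < x ^+ 2 by rewrite exprn_gt0.
field; rewrite ?x1/= !lt0r_neq0//; nra.
Qed.

Lemma sech_half (e : R) : sech e = (1 - tanhR (e / 2) ^+ 2) / (1 + tanhR (e / 2) ^+ 2).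
Proof.
rewrite /sech /tanhR !expRN (_ : expR e = expR (e / 2) ^+ 2); last first.
  by rewrite -expRM_natl; congr expR; field.
have := expR_gt0 (e / 2); set x := expR (e / 2) => x0.
have x1 : x != 0 by rewrite lt0r_neq0.
have x2 : 0 < x ^+ 2 by rewrite exprn_gt0.
field; rewrite ?x1/= !lt0r_neq0//; nra.
Qed.

Lemma tanhR_half_sech (e : R) : tanhR (e / 2) = tanhR e / (1 + sech e).
Proof.
rewrite [tanhR e]tanhR_half sech_half; have h : 1 + tanhR (e / 2) ^+ 2 != 0.
  by rewrite lt0r_neq0// ltr_pwDl// sqr_ge0.
move: (tanhR _) h => u h.
have -> : 1 + (1 - u ^+ 2) / (1 + u ^+ 2) = 2 / (1 + u ^+ 2) by field.
by field.
Qed.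

(* Both [r = tanh e] in the Klein model and [r = tanh (e / 2)] in the Poincare
   model parametrize a ray issued from the origin. *)
Lemma ge0_integral_radial (H : R -> \bar R) w : measurable_fun setT H ->
  (forall x, (0 <= H x)%E) ->
  (\int[mu]_r (H (r / (1 + Num.sqrt (1 - r ^+ 2)))%R * (kdens (r * cos w, r * sin w))%:E * (Num.max r 0)%:E) =
   \int[mu]_r (H r * (ddens (r * cos w, r * sin w))%:E * (Num.max r 0)%:E))%E.
Proof.
move=> mH H0.
have r2E r : r2 (r * cos w, r * sin w) = r ^+ 2.
  by rewrite /r2/= !exprMn -mulrDr cos2Dsin2 mulr1.
have supp (D : R * R -> R) r : (forall z, ~~ (r2 z < 1) -> D z = 0) -> r \notin `](-1)%R, 1%R[%classic ->
   D (r * cos w, r * sin w) = 0.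
  move=> D0; rewrite notin_setE/= in_itv/= => h; apply: D0; rewrite r2E -leNgt.
  move/negP: h; rewrite -ltr_norml -leNgt => h.
  by rewrite -[r ^+ 2]real_normK ?num_real// -[1](expr1n _ 2) ler_sqr ?nnegrE.
transitivity (\int[mu]_e (H (tanhR (e / 2)) * (Num.max (tanhR e) 0)%:E))%E.
  transitivity (\int[mu]_(r in `](-1)%R, 1%R[) (H (r / (1 + Num.sqrt (1 - r ^+ 2)))%R * (kdens (r * cos w, r * sin w))%:E * (Num.max r 0)%:E))%E.
    rewrite [RHS]integral_mkcond; apply: eq_integral => r _; rewrite patchE.
    case: ifPn => // h; rewrite (supp kdens)// ?mule0 ?mul0e// => z.
    by rewrite /kdens => /negbTE->.
  rewrite (subst_tanh_scaled (c := 1))//; last 2 first.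
  - have mk := measurable_kdens.
    apply: emeasurable_funM; last by mfun.
    apply: emeasurable_funM; first by apply: (measurableT_comp mH); mfun.
    by apply/measurable_EFinP; apply: (measurableT_comp mk); mfun.
  - by move=> r; rewrite !mule_ge0// lee_fin ?kdens_ge0// le_max lexx orbT.
  apply: eq_integral => e _; rewrite !mul1r tanhR_half_sech -sqr_sech.
  rewrite sqrtr_sqr gtr0_norm ?sech_gt0// -!muleA -!EFinM.
  rewrite /kdens r2E sqr_tanhR_lt1 -sqr_sech.
  congr (_ * _%:E)%E; have := sech_gt0 e => /lt0r_neq0 h; by field.
transitivity (\int[mu]_(r in `](-1)%R, 1%R[) (H r * (ddens (r * cos w, r * sin w))%:E * (Num.max r 0)%:E))%E; last first.
  rewrite [LHS]integral_mkcond; apply: eq_integral => r _; rewrite patchE.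
  case: ifPn => // h; rewrite (supp ddens)// ?mule0 ?mul0e// => z.
  by rewrite /ddens => /negbTE->.
apply/esym; transitivity (\int[mu]_e (H (tanhR (e / 2)) * (ddens (tanhR (e / 2) * cos w, tanhR (e / 2) * sin w))%:E *
    (Num.max (tanhR (e / 2)) 0)%:E * (sech (e / 2) ^+ 2 / 2)%:E))%E.
  apply: (@ge0_integral_substitution R (fun e => tanhR (e / 2)) (fun e => sech (e / 2) ^+ 2 / 2) (- 1) 1 _ _ _ _ _
    (fun r => (H r * (ddens (r * cos w, r * sin w))%:E * (Num.max r 0)%:E)%E)).
  - move=> x; have dh : is_derive x (1:R) (fun y : R => y / 2) (2^-1).
      by apply: is_derive_eq (is_deriveM (is_derive_id x 1) (is_derive_cst (2^-1 : R) x 1)) _; rewrite /GRing.scale/=; ring.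
    exact: (@is_derive1_comp R (@tanhR R) (fun y => y / 2) x _ _ (is_derive_tanhR (x / 2)) dh).
  - by move=> x; rewrite divr_gt0// exprn_gt0// sech_gt0.
  - move=> x; apply: cvgM; last exact: cvg_cst.
    apply: (cvg_comp (fun y : R => sech (y / 2)) (fun y => y ^+ 2)); last exact: exprn_continuous.
    apply: (cvg_comp (fun y : R => y / 2) (@sech R)); last exact: continuous_sech.
    by apply: cvgM; [exact: cvg_id|exact: cvg_cst].
  - apply: (cvg_comp (fun y : R => y / 2) (@tanhR R)); last exact: cvgy_tanhR.
    by apply: gt0_cvgMly => //; exact: cvg_id.
  - apply: (cvg_comp (fun y : R => y / 2) (@tanhR R)); last exact: cvgNy_tanhR.
    by apply: gt0_cvgMlNy => //; exact: cvg_id.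
  - have mk := measurable_ddens.
    apply: emeasurable_funM; last by mfun.
    apply: emeasurable_funM => //.
    by apply/measurable_EFinP; apply: (measurableT_comp mk); mfun.
  - by move=> r; rewrite !mule_ge0// lee_fin ?ddens_ge0// le_max lexx orbT.
apply: eq_integral => e _; rewrite -!muleA -!EFinM; congr (_ * _%:E)%E.
rewrite [tanhR e]tanhR_half sqr_sech /ddens r2E sqr_tanhR_lt1 /bdf /hypdens r2E.
have := sqr_tanhR_lt1 (e / 2); move: (tanhR _) => u u1.
have h1 : 0 < 1 + u ^+ 2 by rewrite ltr_pwDl// sqr_ge0.
have -> : 2 * u / (1 + u ^+ 2) = u * (2 / (1 + u ^+ 2)) by ring.
rewrite -[in RHS](mul0r (2 / (1 + u ^+ 2))) -maxr_pMl ?divr_ge0// ?ltW//.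
have h2 : 1 - u ^+ 2 != 0 by rewrite lt0r_neq0// subr_gt0.
by field; rewrite h2 lt0r_neq0.
Qed.

Definition kpoint g a t : R * R := klein2disk (rot g (klein a t)).

(** The rotation only shifts the polar angle and the map from the Klein to the Poincare model is
    radial, so polar coordinates reduce the claim to a single ray. *)
Lemma ge0_integral_kpoint (F : R * R -> \bar R) g : measurable_fun setT F ->
  (forall z, (0 <= F z)%E) ->
  (\int[mu]_a ((\int[mu]_t F (kpoint g a t)) * (cosca a ^+ 2)%:E) =
   \int[mu2]_(z in @Disk R) (F z * (bdf z * hypdens z)%:E))%E.
Proof.
move=> mF F0.
have mk := measurable_kdens; have md := measurable_ddens.
have mk2 := measurable_klein2disk; have mr := measurable_rot g.
have mFd : measurable_fun setT (fun z => F z * (ddens z)%:E)%E.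
  by apply: emeasurable_funM => //; exact/measurable_EFinP.
have Fd0 z : (0 <= F z * (ddens z)%:E)%E by rewrite mule_ge0// lee_fin ddens_ge0.
have mFk : measurable_fun setT (fun k => F (klein2disk k) * (kdens k)%:E)%E.
  by apply: emeasurable_funM; [exact: measurableT_comp|exact/measurable_EFinP].
have Fk0 k : (0 <= F (klein2disk k) * (kdens k)%:E)%E by rewrite mule_ge0// lee_fin kdens_ge0.
have mFrk : measurable_fun setT (fun k => F (klein2disk (rot g k)) * (kdens k)%:E)%E.
  apply: emeasurable_funM; last exact/measurable_EFinP.
  by apply: (measurableT_comp mF); exact: measurableT_comp.
transitivity (\int[mu2]_z (F z * (ddens z)%:E))%E; last first.
  rewrite [RHS]integral_mkcond; apply: eq_integral => z _; rewrite patchE /ddens.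
  have -> : (z \in @Disk R) = (r2 z < 1) by apply/idP/idP; rewrite inE.
  by case: ifPn; rewrite ?mule0.
rewrite (ge0_integral_klein (G := fun k => F (klein2disk (rot g k))))//; last first.
  by apply: (measurableT_comp mF); exact: measurableT_comp.
have Frk0 k : (0 <= F (klein2disk (rot g k)) * (kdens k)%:E)%E by rewrite mule_ge0// lee_fin kdens_ge0.
rewrite (ge0_integral_polar mFrk Frk0) (ge0_integral_polar mFd Fd0).
transitivity (\int[mu]_(w in @arc R) ray (fun k => F (klein2disk k) * (kdens k)%:E)%E (w + g)%R)%E.
  apply: eq_integral => w _; rewrite /ray; apply: eq_integral => r _; congr (_ * _)%E.
  have -> : rot g (r * cos w, r * sin w) = (r * cos (w + g), r * sin (w + g)).
    by rewrite /rot/= cosD sinD; congr (_, _); ring.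
  congr (_ * _%:E)%E; rewrite /kdens /r2/= !exprMn -!mulrDr.
  by rewrite !cos2Dsin2.
rewrite (ge0_integral_arc_shift (measurable_ray mFk Fk0) (ray_ge0 Fk0) (ray2pi _)).
apply: eq_integral => w _; rewrite /ray.
rewrite -(ge0_integral_radial w (H := fun r => F (r * cos w, r * sin w)%R))//; last first.
  by apply: (measurableT_comp mF); mfun.
apply: eq_integral => r _; congr (F _ * _ * _)%E.
rewrite /klein2disk /r2/= !exprMn -mulrDr cos2Dsin2 mulr1; congr (_, _); ring.
Qed.

End Klein.

(** * Square integrable functions on the space of geodesics *)

Section ComplexL2.
Variable R : realType.
Local Notation C := (R[i]).
Local Notation mu := (@lebesgue_measure R).
Local Notation mu2 := (mu \x mu)%E.
Local Notation GH := (@GHdom R).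
Implicit Types (f g h u v : R * R -> C) (x y c : C).

Lemma creD x y : cre (x + y) = cre x + cre y. Proof. by case: x y => [a b] [d e]. Qed.
Lemma cimD x y : cim (x + y) = cim x + cim y. Proof. by case: x y => [a b] [d e]. Qed.
Lemma creN x : cre (- x) = - cre x. Proof. by case: x. Qed.
Lemma cimN x : cim (- x) = - cim x. Proof. by case: x. Qed.
Lemma creM x y : cre (x * y) = cre x * cre y - cim x * cim y.
Proof. by case: x y => [a b] [d e]. Qed.
Lemma cimM x y : cim (x * y) = cre x * cim y + cim x * cre y.
Proof. by case: x y => [a b] [d e]. Qed.
Lemma cre_conj x : cre x^*%C = cre x. Proof. by case: x. Qed.
Lemma cim_conj x : cim x^*%C = - cim x. Proof. by case: x. Qed.
Lemma creB x y : cre (x - y) = cre x - cre y. Proof. by rewrite creD creN. Qed.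
Lemma cimB x y : cim (x - y) = cim x - cim y. Proof. by rewrite cimD cimN. Qed.
Definition cE := (creB, cimB, creD, cimD, creN, cimN, creM, cimM, cre_conj, cim_conj).
Lemma cplx_eq x y : cre x = cre y -> cim x = cim y -> x = y.
Proof. by case: x y => [a b] [d e] /= -> ->. Qed.

Lemma csq_ge0 x : 0 <= csq x. Proof. by rewrite addr_ge0// sqr_ge0. Qed.
Lemma csqM x y : csq (x * y) = csq x * csq y. Proof. by rewrite /csq !cE; ring. Qed.
Lemma csqN x : csq (- x) = csq x. Proof. by rewrite /csq !cE; ring. Qed.
Lemma csq_conj x : csq x^*%C = csq x. Proof. by rewrite /csq !cE; ring. Qed.
Lemma csq0 : csq (0 : C) = 0. Proof. by rewrite /csq/= expr0n addr0. Qed.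
Lemma csq_eq0 x : csq x = 0 -> x = 0.
Proof.
move=> /eqP; rewrite paddr_eq0 ?sqr_ge0// !sqrf_eq0 => /andP[/eqP a /eqP b].
exact: cplx_eq.
Qed.
Lemma csqD_le x y : csq (x + y) <= 2 * csq x + 2 * csq y.
Proof.
rewrite -subr_ge0 (_ : _ - _ = csq (x - y)) ?csq_ge0//.
by rewrite /csq !cE; ring.
Qed.
Lemma ler_cre_csq x y : `|cre (x * y)| <= (csq x + csq y) / 2.
Proof.
rewrite cE /csq ler_norml; have := sqr_ge0 (cre x + cre y); have := sqr_ge0 (cre x - cre y).
have := sqr_ge0 (cim x + cim y); have := sqr_ge0 (cim x - cim y).
by move=> *; nra.
Qed.
Lemma ler_cim_csq x y : `|cim (x * y)| <= (csq x + csq y) / 2.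
Proof.
rewrite cE /csq ler_norml; have := sqr_ge0 (cre x + cim y); have := sqr_ge0 (cre x - cim y).
have := sqr_ge0 (cim x + cre y); have := sqr_ge0 (cim x - cre y).
by move=> *; nra.
Qed.

Lemma measurable_GH : measurable GH.
Proof.
rewrite (_ : GH = @arc R `*` setT); last by apply/seteqP; split => z //= [].
by apply: measurableX => //; exact: measurable_arc.
Qed.

Lemma cmeasD h g : cmeas h -> cmeas g -> cmeas (fun z => h z + g z).
Proof.
by move=> [h1 h2] [g1 g2]; split; under eq_fun do rewrite cE; apply: measurable_funD.
Qed.
Lemma cmeasB h g : cmeas h -> cmeas g -> cmeas (fun z => h z - g z).
Proof.
by move=> [h1 h2] [g1 g2]; split; under eq_fun do rewrite cE; apply: measurable_funB.
Qed.
Lemma cmeasM h g : cmeas h -> cmeas g -> cmeas (fun z => h z * g z).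
Proof.
by move=> [h1 h2] [g1 g2]; split; under eq_fun do rewrite cE;
  [apply: measurable_funB|apply: measurable_funD]; apply: measurable_funM.
Qed.
Lemma cmeas_conj h : cmeas h -> cmeas (fun z => (h z)^*%C).
Proof.
move=> [h1 h2]; split; first by under eq_fun do rewrite cre_conj.
by under eq_fun do rewrite cim_conj; apply: measurable_funN.
Qed.
Lemma cmeas_cst c : cmeas (fun _ : R * R => c).
Proof. by split; exact: measurable_cst. Qed.

Lemma measurable_csq h : cmeas h -> measurable_fun setT (fun z => csq (h z)).
Proof. by move=> [h1 h2]; apply: measurable_funD; apply: measurable_funX. Qed.

Lemma measurable_csqE h : cmeas h -> measurable_fun setT (fun z => (csq (h z))%:E).
Proof. by move=> mh; apply/measurable_EFinP; exact: measurable_csq. Qed.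

Lemma nrm2GHD_le h g : cmeas h -> cmeas g ->
  (nrm2GH (fun z => h z + g z)%R <= 2%:E * nrm2GH h + 2%:E * nrm2GH g)%E.
Proof.
move=> mh mg; have mGH := measurable_GH.
have m2 u : cmeas u -> measurable_fun GH (fun z => (csq (u z))%:E).
  by move=> mu'; apply: measurable_funTS; exact: measurable_csqE.
have p2 u z : GH z -> (0 <= (csq (u z))%:E)%E by rewrite lee_fin csq_ge0.
rewrite /nrm2GH /leb2 /leb1 -!ge0_integralZl//=; [|exact: m2|exact: p2|exact: m2|exact: p2].
rewrite -ge0_integralD//=.
- apply: ge0_le_integral => //=.
  + exact: p2.
  + by apply: m2; exact: cmeasD.
  + by apply: emeasurable_funD; apply: measurable_funeM; exact: m2.
  + by move=> z _; rewrite -!EFinM -EFinD lee_fin csqD_le.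
- by move=> z _; rewrite -EFinM lee_fin mulr_ge0// csq_ge0.
- by apply: measurable_funeM; exact: m2.
- by move=> z _; rewrite -EFinM lee_fin mulr_ge0// csq_ge0.
- by apply: measurable_funeM; exact: m2.
Qed.

Lemma nrm2GHZ c h : cmeas h -> nrm2GH (fun z => c * h z)%R = ((csq c)%:E * nrm2GH h)%E.
Proof.
move=> mh; rewrite /nrm2GH /leb2 /leb1 -ge0_integralZl//=.
- by apply: eq_integral => z _; rewrite csqM EFinM.
- exact: measurable_GH.
- by apply: measurable_funTS; exact: measurable_csqE.
- by move=> z _; rewrite lee_fin csq_ge0.
- by rewrite lee_fin csq_ge0.
Qed.

Lemma nrm2GH_ge0 h : (0 <= nrm2GH h)%E.
Proof. by apply: integral_ge0 => z _; rewrite lee_fin csq_ge0. Qed.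

Lemma L2GHD h g : L2GH h -> L2GH g -> L2GH (fun z => h z + g z).
Proof.
move=> [mh ph nh] [mg pg ng]; split; first exact: cmeasD.
  by move=> b a; rewrite ph pg.
apply: le_lt_trans (nrm2GHD_le mh mg) _; rewrite lte_add_pinfty// lte_mul_pinfty//.
Qed.

Lemma L2GHZ c h : L2GH h -> L2GH (fun z => c * h z).
Proof.
move=> [mh ph nh]; split; first by apply: cmeasM => //; exact: cmeas_cst.
  by move=> b a; rewrite ph.
by rewrite nrm2GHZ// lte_mul_pinfty// lee_fin csq_ge0.
Qed.

Lemma L2GHB h g : L2GH h -> L2GH g -> L2GH (fun z => h z - g z).
Proof.
move=> lh lg; have := L2GHD lh (L2GHZ (-1) lg).
by under [X in L2GH X -> _]eq_fun do rewrite mulN1r.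
Qed.

Lemma L2GH_conj h : L2GH h -> L2GH (fun z => (h z)^*%C).
Proof.
move=> [mh ph nh]; split; first exact: cmeas_conj.
  by move=> b a; rewrite ph.
by rewrite /nrm2GH; under eq_integral do rewrite csq_conj.
Qed.

Lemma L2GH0 : L2GH (fun _ => 0 : C).
Proof.
split; [exact: cmeas_cst|by []|].
by rewrite /nrm2GH integral0_eq ?ltry// => z _; rewrite csq0.
Qed.

Definition NGH h : R := fine (nrm2GH h).

Lemma NGH_ge0 h : 0 <= NGH h.
Proof. by rewrite fine_ge0// nrm2GH_ge0. Qed.

Lemma nrm2GHE h : L2GH h -> nrm2GH h = (NGH h)%:E.
Proof. by move=> [_ _ nh]; rewrite /NGH fineK// ge0_fin_numE// nrm2GH_ge0. Qed.

Lemma integrable_csq h : L2GH h -> mu2.-integrable GH (fun z => (csq (h z))%:E).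
Proof.
move=> [mh _ nh]; apply/integrableP; split.
  by apply: measurable_funTS; exact: measurable_csqE.
by under eq_integral do rewrite gee0_abs ?lee_fin ?csq_ge0//.
Qed.

Lemma integrable_ip h g : L2GH h -> L2GH g ->
  mu2.-integrable GH (EFin \o (fun z => cre (h z * (g z)^*%C))) /\
  mu2.-integrable GH (EFin \o (fun z => cim (h z * (g z)^*%C))).
Proof.
move=> lh lg; have [mhg1 mhg2] : cmeas (fun z => h z * (g z)^*%C).
  by case: lh lg => [mh _ _] [mg _ _]; apply: cmeasM => //; exact: cmeas_conj.
have mGH := measurable_GH.
have i2 : mu2.-integrable GH (fun z => ((csq (h z) + csq (g z)))%:E).
  by under eq_fun do rewrite EFinD; apply: integrableD => //; exact: integrable_csq.
have bnd (a : R) x y : `|a| <= (csq x + csq y) / 2 -> (`|a%:E| <= `|(csq x + csq y)%:E|)%E.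
  move=> h1; rewrite lee_fin (le_trans h1)// [leRHS]ger0_norm; last exact: addr_ge0 (csq_ge0 _) (csq_ge0 _).
  by have := csq_ge0 x; have := csq_ge0 y; lra.
split; apply: le_integrable i2 => //; try by apply/measurable_EFinP; exact: measurable_funTS.
  by move=> z _; apply: bnd; apply: le_trans (ler_cre_csq _ _) _; rewrite csq_conj.
by move=> z _; apply: bnd; apply: le_trans (ler_cim_csq _ _) _; rewrite csq_conj.
Qed.

Lemma ipGHDl f g h : L2GH f -> L2GH g -> L2GH h ->
  ipGH (fun z => f z + g z) h = ipGH f h + ipGH g h.
Proof.
move=> lf lg lh; have [a1 a2] := integrable_ip lf lh; have [b1 b2] := integrable_ip lg lh.
have mGH := measurable_GH.
apply: cplx_eq; rewrite /= /leb2 /leb1 -RintegralD//; apply: eq_Rintegral => z _; rewrite mulrDl !cE//.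
Qed.

Lemma ipGHZl c f h : L2GH f -> L2GH h -> ipGH (fun z => c * f z) h = c * ipGH f h.
Proof.
move=> lf lh; have [a1 a2] := integrable_ip lf lh.
have mGH := measurable_GH.
have iZ (k : R) (F : R * R -> R) : mu2.-integrable GH (EFin \o F) -> mu2.-integrable GH (EFin \o (fun z => k * F z)).
  by move=> iF; rewrite (_ : _ \o _ = fun z => (k%:E * (EFin \o F) z)%E)//; exact: integrableZl.
apply: cplx_eq; rewrite !cE /= /leb2 /leb1 -!RintegralZl//.
  rewrite -RintegralB//; [|exact: iZ|exact: iZ].
  by apply: eq_Rintegral => z _; rewrite -mulrA [LHS]creM.
rewrite -RintegralD//; [|exact: iZ|exact: iZ].
by apply: eq_Rintegral => z _; rewrite -mulrA [LHS]cimM.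
Qed.

Lemma ipGHC f h : L2GH f -> L2GH h -> ipGH h f = (ipGH f h)^*%C.
Proof.
move=> lf lh; have [a1 a2] := integrable_ip lf lh.
have mGH := measurable_GH.
apply: cplx_eq; rewrite !cE /= /leb2 /leb1.
  by apply: eq_Rintegral => z _; rewrite !cE; ring.
rewrite -[RHS]mulN1r -RintegralZl//; apply: eq_Rintegral => z _; rewrite !cE; ring.
Qed.

Lemma ipGHBl f g h : L2GH f -> L2GH g -> L2GH h ->
  ipGH (fun z => f z - g z) h = ipGH f h - ipGH g h.
Proof.
move=> lf lg lh; have := ipGHDl lf (L2GHZ (-1) lg) lh.
rewrite ipGHZl// mulN1r => <-.
by rewrite (_ : (fun z => f z - g z) = (fun z => f z + -1 * g z))//; apply/funext => z; rewrite mulN1r.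
Qed.

Lemma ipGHDr f g h : L2GH f -> L2GH g -> L2GH h ->
  ipGH h (fun z => f z + g z) = ipGH h f + ipGH h g.
Proof.
move=> lf lg lh; rewrite (ipGHC (L2GHD lf lg) lh) ipGHDl// (ipGHC lf lh) (ipGHC lg lh).
by apply: cplx_eq; rewrite !cE; ring.
Qed.

Lemma ipGHZr c f h : L2GH f -> L2GH h -> ipGH h (fun z => c * f z) = c^*%C * ipGH h f.
Proof.
move=> lf lh; rewrite (ipGHC (L2GHZ c lf) lh) ipGHZl// (ipGHC lf lh).
by apply: cplx_eq; rewrite !cE; ring.
Qed.

Lemma ipGH0l h : ipGH (fun _ => 0) h = 0.
Proof.
by apply: cplx_eq; rewrite /= /Rintegral integral0_eq// => z _; rewrite !cE /=; congr EFin; ring.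
Qed.

Lemma ipGHxx h : L2GH h -> ipGH h h = Complex (NGH h) 0.
Proof.
move=> lh; apply: cplx_eq => /=.
  rewrite /NGH /nrm2GH /Rintegral; congr fine; apply: eq_integral => z _; congr EFin.
  by rewrite /csq !cE; ring.
by rewrite /Rintegral integral0_eq// => z _; congr EFin; rewrite !cE; ring.
Qed.

Lemma NGHD f g : L2GH f -> L2GH g ->
  NGH (fun z => f z + g z) = NGH f + NGH g + 2 * cre (ipGH f g).
Proof.
move=> lf lg; have lfg := L2GHD lf lg.
have := ipGHxx lfg; rewrite ipGHDl// !ipGHDr// !ipGHxx// (ipGHC lf lg).
by move=> /(congr1 (@cre R)); rewrite !cE /= => <-; ring.
Qed.

Lemma NGHZ c f : L2GH f -> NGH (fun z => c * f z) = csq c * NGH f.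
Proof. by move=> lf; case: (lf) => mf _ _; rewrite /NGH nrm2GHZ// (nrm2GHE lf). Qed.

Lemma NGHB f g : L2GH f -> L2GH g ->
  NGH (fun z => f z - g z) = NGH f + NGH g - 2 * cre (ipGH f g).
Proof.
move=> lf lg; have := NGHD lf (L2GHZ (-1) lg); rewrite NGHZ// ipGHZr//.
rewrite (_ : (fun z => f z + -1 * g z) = fun z => f z - g z); last by apply/funext => z; rewrite mulN1r.
by move=> ->; rewrite /csq !cE /=; ring.
Qed.

(** The norm of [f - t p g], with [p = ipGH f g] and [t] real, is expanded. The optimal [t] is the
    inverse of [NGH g]; the case [NGH g = 0], where [g] need not be the zero function, is handled by
    a large [t]. *)
Lemma cauchy_schwarz f g : L2GH f -> L2GH g -> csq (ipGH f g) <= NGH f * NGH g.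
Proof.
move=> lf lg; set p := ipGH f g.
have key (t : R) : 0 <= NGH f - 2 * t * csq p + t ^+ 2 * csq p * NGH g.
  have := NGH_ge0 (fun z => f z - (Complex t 0 * p) * g z).
  rewrite NGHB//; last exact: L2GHZ.
  rewrite NGHZ// ipGHZr// -/p csqM.
  rewrite (_ : csq (Complex t 0) = t ^+ 2); last by rewrite /csq /= expr0n addr0.
  rewrite (_ : cre _ = t * csq p); first by lra.
  by rewrite /csq !cE /=; ring.
have := csq_ge0 p; rewrite le_eqVlt => /orP[/eqP <-|p0]; first by rewrite mulr_ge0// NGH_ge0.
have := NGH_ge0 g; rewrite le_eqVlt => /orP[/eqP g0|g0].
  (* This [t] turns the inequality into [0 <= -1]. *)
  have := key ((NGH f + 1) / (2 * csq p)); rewrite -g0 mulr0 addr0.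
  rewrite (_ : 2 * _ * _ = NGH f + 1); last by field; rewrite lt0r_neq0.
  by rewrite opprD addrA subrr add0r ler0N1.
have := key (NGH g)^-1.
rewrite (_ : _ + _ = NGH f - csq p / NGH g); last by field; rewrite lt0r_neq0.
by rewrite subr_ge0 ler_pdivrMr.
Qed.

Lemma NGH_csq_ip f g : L2GH f -> L2GH g -> NGH f = 0 -> ipGH f g = 0.
Proof.
move=> lf lg f0; apply: csq_eq0; apply: le_anti.
by rewrite csq_ge0 (le_trans (cauchy_schwarz lf lg))// f0 mul0r.
Qed.

Lemma L2GH_of_closure h g (e : R) : L2GH h -> cmeas g -> beta_periodic g ->
  (nrm2GH (fun z => h z - g z)%R < e%:E)%E -> L2GH g.
Proof.
move=> lh mg pg ng.
have lhg : L2GH (fun z => h z - g z).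
  case: lh => mh ph _; split; first exact: cmeasB.
    by move=> b a; rewrite ph pg.
  exact: lt_trans ng (ltry _).
have := L2GHB lh lhg; congr L2GH; apply/funext => z; ring.
Qed.

(** Elements of [S] close to [h] are automatically square integrable, and only those approximate
    [h]. Thus square integrability of [I0 f] never has to be proved for a general [f]. *)
Lemma L2closure_ortho (S : set (R * R -> C)) h g : L2closure S h -> L2GH g ->
  (forall s, S s -> cmeas s /\ beta_periodic s) ->
  (forall s, S s -> L2GH s -> ipGH s g = 0) -> ipGH h g = 0.
Proof.
move=> [lh clh] lg mS oS; apply: csq_eq0; apply: le_anti; rewrite csq_ge0 andbT.
apply/ler_addgt0Pl => e e0; rewrite addr0.
have g1 : 0 < NGH g + 1 by rewrite ltr_wpDl// NGH_ge0.
have [s [Ss ns]] := clh _ (divr_gt0 e0 g1).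
have [ms ps] := mS _ Ss.
have ls := L2GH_of_closure lh ms ps ns.
have lhs := L2GHB lh ls.
rewrite (_ : ipGH h g = ipGH (fun z => h z - s z) g); last by rewrite ipGHBl// (oS s)// subr0.
apply: le_trans (cauchy_schwarz lhs lg) _.
move: ns; rewrite nrm2GHE// lte_fin => ns.
rewrite -[e](divfK (lt0r_neq0 g1)); apply: ler_pM => //; rewrite ?NGH_ge0// ?lerDl//; exact: ltW.
Qed.

End ComplexL2.

Section AlmostEverywhere.
Variable R : realType.
Local Notation mu := (@lebesgue_measure R).
Local Notation mu2 := (mu \x mu)%E.
Implicit Types P Q : R * R -> Prop.

Lemma ae2_imp P Q : (forall z, P z -> Q z) ->
  {ae mu2, forall z, P z} -> {ae mu2, forall z, Q z}.
Proof.
move=> PQ [N [mN N0 sub]]; exists N; split => // z /= nQ; apply: sub => /= Pz.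
exact/nQ/PQ.
Qed.

Lemma ae2_and P Q : {ae mu2, forall z, P z} -> {ae mu2, forall z, Q z} ->
  {ae mu2, forall z, P z /\ Q z}.
Proof.
move=> [N [mN N0 sub]] [M [mM M0 subM]]; exists (N `|` M); split.
- exact: measurableU.
- by rewrite measureU0.
- move=> z /= nPQ; have [Pz|nP] := pselect (P z); last by left; exact: sub.
  by right; apply: subM => /= Qz; apply: nPQ.
Qed.

End AlmostEverywhere.

(** * Completeness of the space of square integrable functions *)

Section RieszFischer.
Variable R : realType.
Local Notation C := (R[i]).
Local Notation mu := (@lebesgue_measure R).
Local Notation mu2 := (mu \x mu)%E.
Local Notation GH := (@GHdom R).
Implicit Types (f g h : R * R -> C).

Lemma sum_half_le (k : nat) : \sum_(0 <= i < k) (2^-1 : R) ^+ i <= 2 - 2 * 2^-1 ^+ k.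
Proof.
elim: k => [|k IH]; first by rewrite big_nil expr0 mulr1 subrr.
rewrite big_nat_recr//=; apply: le_trans (lerD IH (lexx _)) _.
by rewrite exprS; lra.
Qed.

Lemma nneseries_le (a : nat -> \bar R) (K : \bar R) : (forall n, (0 <= a n)%E) ->
  (forall k, (\sum_(0 <= i < k) a i <= K)%E) -> (\sum_(0 <= i <oo) a i <= K)%E.
Proof.
move=> a0 aK; apply: lime_le; first exact: is_cvg_nneseries.
by apply: nearW => k; exact: aK.
Qed.

Lemma limn_einf_le (a : nat -> \bar R) (K : \bar R) : (forall k, (a k <= K)%E) ->
  (limn_einf a <= K)%E.
Proof.
move=> aK; rewrite limn_einf_lim; apply: lime_le; first exact: is_cvg_einfs.
apply: nearW => k; apply: le_trans (aK k); apply: ereal_inf_le.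
by exists (a k) => //; exists k => /=.
Qed.

Lemma cvg_of_increments (a : nat -> R) (M : R) : 0 <= M ->
  (forall n, `|a n.+1 - a n| <= M * 2^-1 ^+ n) -> cvgn a.
Proof.
move=> M0 aM.
have c1 : cvgn (series (telescope a)).
  apply: normed_cvg; apply: (@series_le_cvg R _ (geometric M 2^-1)).
  - by move=> n; exact: normr_ge0.
  - by move=> n; rewrite /geometric/= mulr_ge0// exprn_ge0// invr_ge0.
  - by move=> n; exact: aM.
  - by apply: is_cvg_geometric_series; rewrite ger0_norm ?invr_ge0// invf_lt1// ltr1n.
rewrite (_ : a = (fun n => a 0%N + series (telescope a) n)); last by apply/funext => n; exact: eq_sum_telescope.
by apply: is_cvgD => //; exact: is_cvg_cst.
Qed.

Variable u : nat -> R * R -> C.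
Hypotheses (lu : forall n, L2GH (u n))
  (cu : forall n m, (n <= m)%N -> NGH (fun z => u m z - u n z) <= 16^-1 ^+ n).

Let d n (z : R * R) : R := csq (u n.+1 z - u n z).
(** With the weights [4 ^+ n] and the rate [16^-1 ^+ n], the integral of [D] is at most the sum of
    the [2^-1 ^+ n]; and where [D] is finite, the increments are at most [Num.sqrt D * 2^-1 ^+ n],
    hence summable. *)
Let D (z : R * R) : \bar R := (\sum_(0 <= n <oo) (4 ^+ n * d n z)%:E)%E.

Let mu_ n : cmeas (u n). Proof. by case: (lu n). Qed.

Let md n : measurable_fun setT (fun z => (4 ^+ n * d n z)%:E).
Proof.
apply/measurable_EFinP; apply: measurable_funM => //.
by apply: measurable_csq; exact: cmeasB.
Qed.

Let d0 n z : (0 <= (4 ^+ n * d n z)%:E)%E.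
Proof. by rewrite lee_fin mulr_ge0// ?exprn_ge0// csq_ge0. Qed.

Let mD : measurable_fun setT D.
Proof. by apply: ge0_emeasurable_sum => // k z _ _; exact: d0. Qed.

Let D0 z : (0 <= D z)%E.
Proof. by apply: nneseries_ge0 => n _ _; exact: d0. Qed.

Let intD : (\int[mu2]_(z in GH) D z <= 2%:E)%E.
Proof.
rewrite /D integral_nneseries//; last 2 first.
- exact: measurable_GH.
- by move=> n; apply: measurable_funTS; exact: md.
apply: nneseries_le => [n|k]; first by apply: integral_ge0.
have E n : (\int[mu2]_(z in GH) (4 ^+ n * d n z)%:E = (4 ^+ n * NGH (fun z => u n.+1 z - u n z))%:E)%E.
  rewrite EFinM -nrm2GHE; last exact: L2GHB.
  rewrite /nrm2GH /leb2 /leb1 -ge0_integralZl//=.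
  - exact: measurable_GH.
  - by apply: measurable_funTS; apply: measurable_csqE; exact: cmeasB.
  - by move=> z _; rewrite lee_fin csq_ge0.
under eq_bigr do rewrite E.
rewrite sumEFin lee_fin; apply: (@le_trans _ _ (\sum_(0 <= i < k) (2^-1 : R) ^+ i)).
  apply: ler_sum => i _; apply: le_trans (ler_wpM2l _ (cu (leqnSn i))) _; first by rewrite exprn_ge0.
  rewrite -exprMn; apply: lerXn2r; rewrite ?nnegrE; lra.
by apply: le_trans (sum_half_le k) _; rewrite gerBl mulr_ge0// exprn_ge0.
Qed.

Let aeD : {ae mu2, forall z, GH z -> (D z < +oo)%E}.
Proof.
have : mu2.-integrable GH D.
  apply/integrableP; split; first exact: measurable_funTS.
  under eq_integral do rewrite gee0_abs//.
  exact: le_lt_trans intD (ltry _).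
move=> iD; have : {ae mu2, forall z, GH z -> D z \is a fin_num}.
  by apply: integrable_ae => //; exact: measurable_GH.
apply: ae2_imp => z + Gz => /(_ Gz).
by rewrite ge0_fin_numE.
Qed.

Let cvgu (p : C -> R) z : (forall x y, p (x - y) = p x - p y) -> (forall x, p x ^+ 2 <= csq x) ->
  (D z < +oo)%E -> cvgn (fun n => p (u n z)).
Proof.
move=> pB pcsq Dz.
have Dfin : D z = (fine (D z))%:E by rewrite fineK// ge0_fin_numE.
apply: (@cvg_of_increments _ (Num.sqrt (fine (D z)))); first exact: sqrtr_ge0.
move=> n; rewrite -pB -ler_sqr ?nnegrE// ?mulr_ge0 ?sqrtr_ge0 ?exprn_ge0//.
rewrite real_normK ?num_real// exprMn sqr_sqrtr ?fine_ge0//.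
apply: le_trans (pcsq _) _; rewrite -exprM mulnC exprM.
rewrite (_ : 2^-1 ^+ 2 = 4^-1 :> R); last by field.
rewrite exprVn ler_pdivlMr ?exprn_gt0// mulrC -lee_fin -Dfin.
by rewrite /D (nneseriesD1 (n := n))// leeDl// nneseries_ge0.
Qed.

(** The limit is pointwise where [D] is finite and 0 elsewhere, which keeps it measurable and
    periodic everywhere. The rate comes from Fatou's lemma applied to the sequence [v], which is [u]
    cut off to the same set. *)
Lemma riesz_fischer : exists g, L2GH g /\ forall n, NGH (fun z => g z - u n z) <= 16^-1 ^+ n.
Proof.
pose g z : C := if (D z < +oo)%E then Complex (limn (fun n => cre (u n z))) (limn (fun n => cim (u n z))) else 0.
pose v n z : C := if (D z < +oo)%E then u n z else 0.
have pr (x : C) : cre x ^+ 2 <= csq x by rewrite lerDl sqr_ge0.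
have pim (x : C) : cim x ^+ 2 <= csq x by rewrite lerDr sqr_ge0.
have cre_v z : (fun n => cre (v n z)) @ \oo --> cre (g z).
  rewrite /v /g; case: ifPn => h /=; last exact: cvg_cst.
  exact: (cvgu (@creB R) pr h).
have cim_v z : (fun n => cim (v n z)) @ \oo --> cim (g z).
  rewrite /v /g; case: ifPn => h /=; last exact: cvg_cst.
  exact: (cvgu (@cimB R) pim h).
have mlt : measurable_fun setT (fun z => (D z < +oo)%E) by exact: measurable_fun_lte.
have mv n : cmeas (v n).
  have [m1 m2] := mu_ n.
  split; rewrite /v.
    rewrite (_ : (fun _ => _) = fun z => if (D z < +oo)%E then cre (u n z) else 0); last by apply/funext => z; case: ifP.
    exact: measurable_fun_ifT.
  rewrite (_ : (fun _ => _) = fun z => if (D z < +oo)%E then cim (u n z) else 0); last by apply/funext => z; case: ifP.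
  exact: measurable_fun_ifT.
have mg : cmeas g.
  split; [apply: (measurable_fun_cvg (h := fun n z => cre (v n z)))|apply: (measurable_fun_cvg (h := fun n z => cim (v n z)))] => //.
  - by move=> n; case: (mv n).
  - by move=> n; case: (mv n).
have pg : beta_periodic g.
  move=> b a; have up n : u n (b + 2 * pi, a) = u n (b, a) by case: (lu n).
  have Dp : D (b + 2 * pi, a) = D (b, a) by apply: eq_eseriesr => n _; rewrite /d !up.
  rewrite /g Dp (_ : (fun n => cre (u n (b + 2 * pi, a))) = fun n => cre (u n (b, a))); last first.
    by apply/funext => n; rewrite up.
  by rewrite (_ : (fun n => cim (u n (b + 2 * pi, a))) = fun n => cim (u n (b, a)))//; apply/funext => n; rewrite up.
have bound n : (nrm2GH (fun z => g z - u n z)%R <= (16^-1 ^+ n)%:E)%E.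
  have mgu : cmeas (fun z => g z - u n z) by exact: cmeasB.
  have mgv : cmeas (fun z => g z - v n z) by exact: cmeasB.
  have mvv m : cmeas (fun z => v (n + m)%N z - v n z) by exact: cmeasB.
  have mGH := @measurable_GH R.
  have -> : nrm2GH (fun z => g z - u n z) = nrm2GH (fun z => g z - v n z).
    rewrite /nrm2GH /leb2 /leb1; apply: ge0_ae_eq_integral => //.
    - by apply: measurable_funTS; exact: measurable_csqE.
    - by apply: measurable_funTS; exact: measurable_csqE.
    - by move=> z _; rewrite lee_fin csq_ge0.
    - by move=> z _; rewrite lee_fin csq_ge0.
    - by apply: ae2_imp aeD => z /[apply] h; rewrite /v h.
  rewrite /nrm2GH /leb2 /leb1.
  have lim z : (csq (g z - v n z))%:E = limn_einf (fun m => (csq (v (n + m)%N z - v n z))%:E).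
    suff c : (fun m => (csq (v (n + m)%N z - v n z))%:E) @ \oo --> (csq (g z - v n z))%:E.
      by have [-> _] := cvg_limn_einf_sup c.
    apply/cvg_EFin; first exact: nearW.
    have shift (p : C -> R) (pB : forall x y, p (x - y) = p x - p y) :
        (fun m => p (v m z)) @ \oo --> p (g z) ->
        (fun m => p (v (n + m)%N z - v n z) ^+ 2) @ \oo --> p (g z - v n z) ^+ 2.
      move=> cp; apply: (cvg_comp (fun m => p (v (n + m)%N z - v n z)) (fun y : R => y ^+ 2)); last exact: exprn_continuous.
      rewrite pB (_ : (fun m => _) = (fun m => p (v (n + m)%N z) - p (v n z))); last by apply/funext => m; exact: pB.
      apply: cvgB; last exact: cvg_cst.
      rewrite (_ : (fun m => _) = (fun m => p (v (m + n)%N z))); last by apply/funext => m; rewrite addnC.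
      by rewrite (cvg_shiftn n (fun m => p (v m z))).
    by apply: cvgD; apply: shift => //; [exact: creB|exact: cimB].
  under eq_integral do rewrite lim.
  have mF m : measurable_fun GH (fun z => (csq (v (n + m)%N z - v n z))%:E).
    by apply: measurable_funTS; exact: measurable_csqE.
  have F0 m z : GH z -> (0 <= (csq (v (n + m)%N z - v n z))%:E)%E by rewrite lee_fin csq_ge0.
  apply: (@le_trans _ _ (limn_einf (fun m => \int[mu2]_(z in GH) (csq (v (n + m)%N z - v n z))%:E)%E)).
    by apply: fatou.
  apply: limn_einf_le => m.
  apply: (@le_trans _ _ (nrm2GH (fun z => u (n + m)%N z - u n z))); last first.
    by rewrite nrm2GHE ?lee_fin ?cu ?leq_addr//; exact: L2GHB.
  apply: ge0_le_integral => //.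
  - by move=> z _; rewrite lee_fin csq_ge0.
  - by apply: measurable_funTS; exact: measurable_csqE.
  - by apply: measurable_funTS; apply: measurable_csqE; exact: cmeasB.
  - by move=> z _; rewrite lee_fin /v; case: ifP => // _; rewrite subrr csq0 csq_ge0.
have lg : L2GH g.
  have lgu : L2GH (fun z => g z - u 0%N z).
    split; [exact: cmeasB| |exact: le_lt_trans (bound 0%N) (ltry _)].
    by move=> b a; rewrite pg; case: (lu 0%N) => _ ->.
  by have := L2GHD lgu (lu 0%N); congr L2GH; apply/funext => z; rewrite subrK.
exists g; split => // n; rewrite -lee_fin -nrm2GHE//; exact: L2GHB.
Qed.

End RieszFischer.

(** * Orthogonal projection on the closure of a subspace *)

Section Projection.
Variable R : realType.
Local Notation C := (R[i]).
Implicit Types (f g h s : R * R -> C).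

Record lsubspace (S : set (R * R -> C)) : Prop := LSubspace {
  lsub_L2 : forall s, S s -> L2GH s;
  lsub0 : S (fun _ => 0);
  lsubD : forall s t, S s -> S t -> S (fun z => s z + t z);
  lsubZ : forall c s, S s -> S (fun z => c * s z) }.

Lemma eq0_of_le_pow (x M : R) : 0 <= x -> (forall n, x <= M * 16^-1 ^+ n) -> x = 0.
Proof.
move=> x0 xM; apply: le_anti; rewrite x0 andbT.
have c : (fun n => M * 16^-1 ^+ n) @ \oo --> (0 : R).
  rewrite -(mulr0 M); apply: cvgM; first exact: cvg_cst.
  by apply: cvg_expr; rewrite ger0_norm ?invr_ge0// invf_lt1// ltr1n.
have <- := cvg_lim _ c => //; apply: limr_ge; first by apply/cvg_ex; exists 0.
exact: nearW.
Qed.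

(** A minimizing sequence of the distance from [h] to [S] converges by the parallelogram identity;
    each of its terms is almost orthogonal, and this passes to the limit. *)
Lemma projection (S : set (R * R -> C)) h : lsubspace S -> L2GH h ->
  exists g, L2closure S g /\ forall s, S s -> ipGH (fun z => h z - g z) s = 0.
Proof.
move=> [SL S0 SD SZ] lh.
pose A := [set NGH (fun z => h z - s z) | s in S].
have A0 : A !=set0 by exists (NGH (fun z => h z - 0)); exists (fun _ => 0).
have Alb : has_lbound A by exists 0 => _ [s _ <-]; exact: NGH_ge0.
pose d := inf A.
have dle s : S s -> d <= NGH (fun z => h z - s z) by move=> Ss; apply: ge_inf => //; exists s.
(* The parallelogram identity gives [2 (e n + e m)] as a bound on the squared distance of [u n] and
   [u m]; the divisor 4 makes this at most [16^-1 ^+ n]. *)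
pose e n : R := 16^-1 ^+ n / 4.
have e0 n : 0 < e n by rewrite divr_gt0// exprn_gt0// invr_gt0.
have /choice[u uP] : forall n, exists s, S s /\ NGH (fun z => h z - s z) < d + e n.
  by move=> n; have [_ [s Ss <-] lt] := inf_adherent (e0 n) (conj A0 Alb); exists s.
have Su n : S (u n) by case: (uP n).
have lu n : L2GH (u n) by exact: SL.
have lhu n : L2GH (fun z => h z - u n z) by exact: L2GHB.
have cu n m : (n <= m)%N -> NGH (fun z => u m z - u n z) <= 16^-1 ^+ n.
  move=> nm; have Sm : S (fun z => Complex 2^-1 0 * (u n z + u m z)) by apply: SZ; exact: SD.
  have := dle _ Sm.
  have E1 := NGHB (lhu n) (lhu m); have E2 := NGHD (lhu n) (lhu m).
  have -> : NGH (fun z => h z - Complex 2^-1 0 * (u n z + u m z)) =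
     4^-1 * NGH (fun z => (h z - u n z) + (h z - u m z)).
    rewrite (_ : (fun z => h z - _) = fun z => Complex 2^-1 0 * ((h z - u n z) + (h z - u m z))).
      rewrite NGHZ; last exact: L2GHD.
      by congr (_ * _); rewrite /csq /= expr0n addr0; field.
    by apply/funext => z; apply: cplx_eq; rewrite !cE /=; field.
  have -> : (fun z => u m z - u n z) = fun z => (h z - u n z) - (h z - u m z).
    by apply/funext => z; ring.
  rewrite E1 E2; have [_ h1] := uP n; have [_ h2] := uP m.
  have : e m <= e n.
    by rewrite ler_pM2r ?invr_gt0// ler_wiXn2l// ?invr_ge0// invf_le1// ler1n.
  rewrite /e in h1 h2 *; lra.
have [g [lg gu]] := riesz_fischer lu cu.
have close n : nrm2GH (fun z => g z - u n z) = (NGH (fun z => g z - u n z))%:E.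
  by apply: nrm2GHE; exact: L2GHB.
exists g; split.
  split => // eps eps0.
  have c : (fun n => 16^-1 ^+ n) @ \oo --> (0 : R).
    by apply: cvg_expr; rewrite ger0_norm ?invr_ge0// invf_lt1// ltr1n.
  have /cvgr_lt/(_ _ eps0) [n _ nP] := c.
  by exists (u n); split => //; rewrite close lte_fin (le_lt_trans (gu n))// nP/=.
move=> s Ss; have ls := SL _ Ss.
(* Moving [u n] in the direction of [s] cannot gain more than [e n]. The step [t] is the inverse of
   [NGH s + 1] so as to stay defined when [NGH s = 0]. *)
have q n : csq (ipGH (fun z => h z - u n z) s) <= e n * (NGH s + 1).
  set p := ipGH _ s; pose t := (NGH s + 1)^-1.
  have N1 : 0 < NGH s + 1 by rewrite ltr_wpDl// NGH_ge0.
  have Sus : S (fun z => u n z + (Complex t 0 * p) * s z) by apply: SD => //; exact: SZ.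
  have := dle _ Sus.
  rewrite (_ : (fun z => h z - _) = fun z => (h z - u n z) - (Complex t 0 * p) * s z); last first.
    by apply/funext => z; ring.
  rewrite NGHB//; last exact: L2GHZ.
  rewrite NGHZ// ipGHZr// -/p csqM.
  rewrite (_ : csq (Complex t 0) = t ^+ 2); last by rewrite /csq /= expr0n addr0.
  rewrite (_ : cre _ = t * csq p); last by rewrite /csq !cE /=; ring.
  have [_ h1] := uP n => h2.
  have h3 : csq p * (2 * t - t ^+ 2 * NGH s) <= e n by lra.
  have h4 : t <= 2 * t - t ^+ 2 * NGH s.
    rewrite -subr_ge0 (_ : _ - _ = t ^+ 2); first exact: sqr_ge0.
    by rewrite /t; field; rewrite lt0r_neq0.
  have : csq p * t <= e n by apply: le_trans h3; rewrite ler_wpM2l// csq_ge0.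
  by rewrite ler_pdivrMr.
(* The first term of the constant is the bound [q] for [h - u n], the second the Cauchy-Schwarz
   bound for [u n - g]; the factors 2 come from [csqD_le]. *)
apply: csq_eq0; apply: (@eq0_of_le_pow _ (2 * (NGH s + 1) / 4 + 2 * NGH s)); first exact: csq_ge0.
move=> n.
rewrite (_ : ipGH _ s = ipGH (fun z => h z - u n z) s + ipGH (fun z => u n z - g z) s); last first.
  rewrite -ipGHDl//; last exact: L2GHB.
  by congr ipGH; apply/funext => z; ring.
apply: le_trans (csqD_le _ _) _.
have := cauchy_schwarz (L2GHB (lu n) lg) ls.
have -> : NGH (fun z => u n z - g z) = NGH (fun z => g z - u n z).
  by rewrite !NGHB// [ipGH g _]ipGHC// cE; ring.
have := gu n; have := q n; rewrite /e; have := NGH_ge0 s.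
set a := csq _; set b := csq _; set c := NGH (fun z => g z - u n z).
move: (NGH s) (16^-1 ^+ n) => N E N0 h1 h2 h3.
have : c * N <= E * N by rewrite ler_wpM2r.
lra.
Qed.

End Projection.

(** * The X-ray transform of functions *)

Section Geodesics.
Variable R : realType.
Local Notation C := (R[i]).
Local Notation mu := (@lebesgue_measure R).
Implicit Types (a b t g : R) (z : R * R).

Definition gam b a : R := b + atan a + pi / 2.
(** The geodesic with parameter [a] is closest to the origin at time [- tshift a], which is time 0
    of the symmetric parametrization [kpoint]. *)
Definition tshift a : R := ln (1 + a ^+ 2) / 2.

Lemma expR_tshift a : expR (tshift a) = (cosca a)^-1.
Proof.
have a1 : 0 < 1 + a ^+ 2 by rewrite ltr_pwDl// sqr_ge0.
apply: (@pexpIrn R 2) => //; rewrite ?nnegrE ?expR_ge0 ?invr_ge0 ?(ltW (cosca_gt0 a))//.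
rewrite exprVn sqr_cosca invrK -expRM_natl /tshift.
by rewrite (_ : _ * _ = ln (1 + a ^+ 2)) ?lnK ?posrE//; field.
Qed.

Lemma sqrt_klein a t : Num.sqrt (1 - r2 (klein a t)) = cosca a * sech t.
Proof.
rewrite r2_klein subKr sqrtr_sqr ger0_norm// mulr_ge0// ltW ?cosca_gt0//; exact: sech_gt0.
Qed.

Lemma kpointE g a t : kpoint g a t =
  ((- sinca a * cos g - cosca a * tanhR t * sin g) / (1 + cosca a * sech t),
   (- sinca a * sin g + cosca a * tanhR t * cos g) / (1 + cosca a * sech t)).
Proof. by rewrite /kpoint /klein2disk r2_rot sqrt_klein. Qed.

Lemma cos_gam b a : cos (gam b a) = - (sin b * cosca a + cos b * sinca a).
Proof. by rewrite /gam cosDpihalf sinD. Qed.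

Lemma sin_gam b a : sin (gam b a) = cos b * cosca a - sin b * sinca a.
Proof. by rewrite /gam sinDpihalf cosD. Qed.

(** After the shift the exponential of time is [X / cosca a] with [X = expR t], so both sides become
    rational in [X] and [a] once [cosca a ^+ 2] is replaced by [(1 + a ^+ 2)^-1]. *)
Lemma zgeo_kpoint b a t : toR2 (zgeo b a t) = kpoint (gam b a) a (t + tshift a).
Proof.
have X0 := expR_gt0 t.
have c0 := cosca_gt0 a.
pose X := expR t; pose D := X ^+ 2 * (1 + a ^+ 2) + 1.
have D0 : 0 < D by rewrite /D ltr_wpDl// mulr_ge0 ?sqr_ge0// addr_ge0// sqr_ge0.
have a0 : 0 < 1 + a ^+ 2 by rewrite ltr_pwDl// sqr_ge0.
have a0' : 1 + a ^+ 2 != 0 by rewrite lt0r_neq0.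
have D0' : D != 0 by rewrite lt0r_neq0.
have c0' : cosca a != 0 by rewrite lt0r_neq0.
have cc := sqr_cosca a.
have Et : expR (t + tshift a) = X / cosca a by rewrite expRD expR_tshift.
have X0' : X != 0 by rewrite lt0r_neq0.
have XX0 : X ^+ 2 + cosca a ^+ 2 != 0.
  by rewrite lt0r_neq0// addr_gt0// exprn_gt0.
have S : sech (t + tshift a) = 2 * X * cosca a / (X ^+ 2 + cosca a ^+ 2).
  by rewrite /sech expRN Et; field; rewrite X0' c0' XX0.
have T : tanhR (t + tshift a) = (X ^+ 2 - cosca a ^+ 2) / (X ^+ 2 + cosca a ^+ 2).
  by rewrite /tanhR expRN Et; field; rewrite X0' c0' XX0.
have Th : tanhR (t / 2) = (X - 1) / (X + 1).
  rewrite /tanhR expRN /X (_ : expR t = expR (t / 2) ^+ 2); last first.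
    by rewrite -expRM_natl; congr expR; field.
  have := expR_gt0 (t / 2); set x := expR (t / 2) => x0.
  by field; rewrite !lt0r_neq0//; nra.
have X1 : X + 1 != 0 by rewrite lt0r_neq0// addr_gt0.
(* [4 D' / (X + 1)^2] is the squared modulus of the denominator in [zgeo]; [u + i v] below is the
   quotient before the rotation by [b]. *)
pose D' := (X + 1) ^+ 2 + a ^+ 2 * X ^+ 2.
have D1 : D' != 0 by rewrite lt0r_neq0// ltr_pwDl// ?exprn_gt0 ?addr_gt0// mulr_ge0// sqr_ge0.
have D1e y : y = D' -> y != 0 by move=> ->.
have D0e y : y = D -> y != 0 by move=> ->.
have a0e y : y = 1 + a ^+ 2 -> y != 0 by move=> ->.
pose u := (1 - X ^+ 2 + a ^+ 2 * X ^+ 2) / D'.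
pose v := - (2 * a * X ^+ 2) / D'.
have E : (Complex 2 a * Complex ((X - 1) / (X + 1)) 0 + Complex 0 a) /
  (Complex 0 a * Complex ((X - 1) / (X + 1)) 0 - Complex 2 0 + Complex 0 a) = Complex u v.
  have d0 : Complex 0 a * Complex ((X - 1) / (X + 1)) 0 - Complex 2 0 + Complex 0 a != 0.
    apply/eqP => /(congr1 (@cre R)); rewrite !cE /=; lra.
  apply: (mulIf d0); rewrite divfK//.
  by apply: cplx_eq; rewrite !cE /= /u /v /D'; field; repeat (apply/andP; split) => //; first [by apply: a0e; ring|by apply: D0e; rewrite /D; ring|by apply: D1e; rewrite /D'; ring].
have hT : tanhR (t + tshift a) = (X ^+ 2 * (1 + a ^+ 2) - 1) / D.
  by rewrite T cc /D; field; repeat (apply/andP; split) => //; first [by apply: a0e; ring|by apply: D0e; rewrite /D; ring|by apply: D1e; rewrite /D'; ring].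
have hS : 1 + cosca a * sech (t + tshift a) = D' / D.
  rewrite S (_ : cosca a * _ = cosca a ^+ 2 * (2 * X / (X ^+ 2 + cosca a ^+ 2))); last by ring.
  by rewrite cc /D' /D; field; repeat (apply/andP; split) => //; first [by apply: a0e; ring|by apply: D0e; rewrite /D; ring|by apply: D1e; rewrite /D'; ring].
rewrite kpointE /zgeo Th E cos_gam sin_gam /toR2 /expi !cE /= hS hT sincaE.
congr (_, _).
  (* [cosca a] is collected into its square, since only even powers of it are rational in [a]. *)
  rewrite (_ : _ - _ * (cos b * cosca a - _) = cosca a ^+ 2 * (a * (sin b + cos b * a)
     - (X ^+ 2 * (1 + a ^+ 2) - 1) / D * (cos b - sin b * a))); last by ring.
  by rewrite cc /u /v /D /D'; field; repeat (apply/andP; split) => //; first [by apply: a0e; ring|by apply: D0e; rewrite /D; ring|by apply: D1e; rewrite /D'; ring].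
rewrite (_ : _ + _ * - _ = cosca a ^+ 2 * (- a * (cos b - sin b * a)
     - (X ^+ 2 * (1 + a ^+ 2) - 1) / D * (sin b + cos b * a))); last by ring.
by rewrite cc /u /v /D /D'; field; repeat (apply/andP; split) => //; first [by apply: a0e; ring|by apply: D0e; rewrite /D; ring|by apply: D1e; rewrite /D'; ring].
Qed.

Lemma r2_klein2disk (k : R * R) : r2 k < 1 ->
  r2 (klein2disk k) = (1 - Num.sqrt (1 - r2 k)) / (1 + Num.sqrt (1 - r2 k)).
Proof.
move=> k1; have := sqr_sqrtr (ltW (_ : 0 < 1 - r2 k)); rewrite subr_gt0 => /(_ k1).
have := sqrtr_ge0 (1 - r2 k).
rewrite [r2 (klein2disk k)]/r2 /klein2disk /=; set x := Num.sqrt _ => x0 xx.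
have x1 : 1 + x != 0 by rewrite lt0r_neq0// ltr_pwDl.
rewrite !exprMn -mulrDl -[_ + k.2 ^+ 2]/(r2 k) (_ : r2 k = 1 - x ^+ 2); last by rewrite xx; ring.
by field.
Qed.

Lemma bdf_kpoint g a t : bdf (kpoint g a t) = cosca a * sech t.
Proof.
rewrite /bdf /kpoint r2_klein2disk; last by rewrite r2_rot r2_klein_lt1.
rewrite r2_rot sqrt_klein.
have x0 : 0 < cosca a * sech t by rewrite mulr_gt0 ?cosca_gt0// sech_gt0.
move: (cosca a * sech t) x0 => x x0.
have x1 : 1 + x != 0 by rewrite lt0r_neq0// addr_gt0.
have x2 : 1 + x + (1 - x) != 0 by rewrite lt0r_neq0//; lra.
by field; rewrite ?x1 ?x2.
Qed.

Lemma Disk_kpoint g a t : Disk (kpoint g a t).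
Proof.
rewrite /Disk/= /kpoint r2_klein2disk; last by rewrite r2_rot r2_klein_lt1.
rewrite r2_rot sqrt_klein.
have x0 : 0 < cosca a * sech t by rewrite mulr_gt0 ?cosca_gt0// sech_gt0.
rewrite ltr_pdivrMr ?addr_gt0//; lra.
Qed.

(** The isometry from the Poincare disk to the Klein disk, which undoes [klein2disk]. *)
Definition kap (z : R * R) : R * R := (2 * z.1 / (1 + r2 z), 2 * z.2 / (1 + r2 z)).

Lemma kap_kpoint g a t : kap (kpoint g a t) = rot g (klein a t).
Proof.
have := r2_klein2disk (k := rot g (klein a t)); rewrite r2_rot r2_klein_lt1 => /(_ isT).
rewrite /kap /kpoint => ->; rewrite /klein2disk r2_rot sqrt_klein /=.
have x0 : 0 < cosca a * sech t by rewrite mulr_gt0 ?cosca_gt0// sech_gt0.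
move: (cosca a * sech t) x0 => x x0.
have x1 : 1 + x != 0 by rewrite lt0r_neq0// addr_gt0.
have x2 : 1 + x + (1 - x) != 0 by rewrite lt0r_neq0//; lra.
have h (y : R) : 2 * (y / (1 + x)) / (1 + (1 - x) / (1 + x)) = y by field; rewrite ?x1 ?x2.
by rewrite !h.
Qed.

Lemma kpoint2pi g a t : kpoint (g + 2 * pi) a t = kpoint g a t.
Proof. by rewrite !kpointE [2 * pi]mulr_natl cosD2pi sinD2pi. Qed.

Lemma kpointpi g a t : kpoint (g + pi) (- a) t = kpoint g a (- t).
Proof.
rewrite !kpointE cosDpi sinDpi sincaN coscaN tanhRN sechN.
by congr (_ / _, _ / _); ring.
Qed.

(** The identity must also cover the geodesics along which the integral diverges, so it is proved on
    positive and negative parts separately. *)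
Lemma integral_shift (c : R) (f : R -> \bar R) : measurable_fun setT f ->
  (\int[mu]_x f (x + c)%R = \int[mu]_x f x)%E.
Proof.
move=> mf; rewrite integralE [RHS]integralE; congr (_ - _)%E.
  rewrite -[RHS](ge0_integral_shift c (measurable_funepos mf) (funepos_ge0 f)).
  by apply: eq_integral => x _; rewrite !funeposE.
rewrite -[RHS](ge0_integral_shift c (measurable_funeneg mf) (funeneg_ge0 f)).
  by apply: eq_integral => x _; rewrite !funenegE.
Qed.

Lemma integral_opp (f : R -> \bar R) : measurable_fun setT f ->
  (\int[mu]_x f (- x)%R = \int[mu]_x f x)%E.
Proof.
move=> mf; rewrite integralE [RHS]integralE; congr (_ - _)%E.
  rewrite -[RHS](ge0_integral_opp (measurable_funepos mf) (funepos_ge0 f)).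
  by apply: eq_integral => x _; rewrite !funeposE.
rewrite -[RHS](ge0_integral_opp (measurable_funeneg mf) (funeneg_ge0 f)).
  by apply: eq_integral => x _; rewrite !funenegE.
Qed.

Definition rcmeas (f : R -> C) :=
  measurable_fun setT (fun t => cre (f t)) /\ measurable_fun setT (fun t => cim (f t)).

Lemma cint_shift (c : R) (f : R -> C) : rcmeas f -> cint (fun t => f (t + c)) = cint f.
Proof.
move=> [m1 m2]; apply: cplx_eq; rewrite /= /Rintegral /leb1; congr fine.
  by rewrite (integral_shift c (f := fun t => (cre (f t))%:E))//; exact/measurable_EFinP.
by rewrite (integral_shift c (f := fun t => (cim (f t))%:E))//; exact/measurable_EFinP.
Qed.

Lemma cint_opp (f : R -> C) : rcmeas f -> cint (fun t => f (- t)) = cint f.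
Proof.
move=> [m1 m2]; apply: cplx_eq; rewrite /= /Rintegral /leb1; congr fine.
  by rewrite (integral_opp (f := fun t => (cre (f t))%:E))//; exact/measurable_EFinP.
by rewrite (integral_opp (f := fun t => (cim (f t))%:E))//; exact/measurable_EFinP.
Qed.

Lemma measurable_kpoint : measurable_fun setT (fun x : (R * R) * R => kpoint x.1.1 x.1.2 x.2).
Proof. by rewrite /kpoint /klein2disk /rot /klein /r2 /=; mfun. Qed.

(* [I0] in the coordinates [(gam, a)]: the ray transform along [kpoint]. *)
Definition J0 (f : R * R -> C) g a : C := cint (fun t => f (kpoint g a t)).

(** A function of [xhalfL2D] is prescribed on the disk only. Since geodesics stay in the disk, it
    can be replaced by a function [u] that is measurable on the plane. *)
Lemma I0_J0 (f u : R * R -> C) b a : cmeas u -> (forall z, Disk z -> f z = u z) ->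
  I0 f (b, a) = J0 u (gam b a) a.
Proof.
move=> [m1 m2] fu; rewrite /I0 /J0 /=.
have mk : measurable_fun setT (fun t => kpoint (gam b a) a t).
  exact: (measurable_fun_pair2 (gam b a, a) measurable_kpoint).
rewrite -[RHS](cint_shift (tshift a)); last first.
  by split; [exact: measurableT_comp m1 mk|exact: measurableT_comp m2 mk].
congr cint; apply/funext => t; rewrite zgeo_kpoint fu//; exact: Disk_kpoint.
Qed.

Lemma J0_pi u g a : cmeas u -> J0 u (g + pi) (- a) = J0 u g a.
Proof.
move=> [m1 m2]; rewrite /J0 -[RHS]cint_opp.
  by congr cint; apply/funext => t; rewrite kpointpi.
have mk : measurable_fun setT (fun t => kpoint g a t).
  exact: (measurable_fun_pair2 (g, a) measurable_kpoint).
by split; [exact: measurableT_comp m1 mk|exact: measurableT_comp m2 mk].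
Qed.

Lemma gam_SA b a : gam (SA (b, a)).1 (SA (b, a)).2 = gam b a + pi.
Proof. by rewrite /gam /SA /= atanN; ring. Qed.

End Geodesics.

(** * The Santalo formula and angular averages of ridge functions *)

Section Santalo.
Variable R : realType.
Local Notation C := (R[i]).
Local Notation mu := (@lebesgue_measure R).
Local Notation mu2 := (mu \x mu)%E.
Local Notation GH := (@GHdom R).
Implicit Types (a b t g : R) (z : R * R).

Lemma GH_arc b a : ((b, a) \in GH) = (b \in @arc R).
Proof. by apply/idP/idP; rewrite !inE. Qed.

Lemma ge0_integral_GH1 (F : R * R -> \bar R) : measurable_fun setT F -> (forall x, (0 <= F x)%E) ->
  (\int[mu2]_(x in GH) F x = \int[mu]_(b in @arc R) \int[mu]_a F (b, a))%E.
Proof.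
move=> mF F0; rewrite integral_mkcond fubini_tonelli1; last 2 first.
- apply/(measurable_restrictT _ (@measurable_GH R)); exact: measurable_funTS.
- exact: erestrict_ge0.
rewrite [RHS]integral_mkcond; apply: eq_integral => b _; rewrite /fubini_F patchE.
by under eq_integral do rewrite patchE GH_arc; case: ifPn => // _; rewrite integral0.
Qed.

Lemma ge0_integral_GH2 (F : R * R -> \bar R) : measurable_fun setT F -> (forall x, (0 <= F x)%E) ->
  (\int[mu2]_(x in GH) F x = \int[mu]_a \int[mu]_(b in @arc R) F (b, a))%E.
Proof.
move=> mF F0; rewrite integral_mkcond fubini_tonelli2; last 2 first.
- apply/(measurable_restrictT _ (@measurable_GH R)); exact: measurable_funTS.
- exact: erestrict_ge0.
apply: eq_integral => a _; rewrite /fubini_G [RHS]integral_mkcond.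
by apply: eq_integral => b _; rewrite !patchE GH_arc.
Qed.

Lemma ge0_integral_GH_shift (K : R * R -> \bar R) (phi : R -> R) :
  measurable_fun setT phi -> measurable_fun setT K -> (forall x, (0 <= K x)%E) ->
  (forall b a, K (b + 2 * pi, a) = K (b, a)) ->
  (\int[mu2]_(x in GH) K (x.1 + phi x.2, x.2)%R = \int[mu2]_(x in GH) K x)%E.
Proof.
move=> mphi mK K0 KP.
rewrite !ge0_integral_GH2; [|by []|by []| |by []]; last first.
  apply: (measurableT_comp mK).
  have := measurableT_comp mphi (@measurable_snd _ _ _ _ : measurable_fun setT (fun x : R * R => x.2)).
  by move=> h; mfun.
apply: eq_integral => a _ /=.
rewrite (ge0_integral_arc_shift (k := fun b => K (b, a)))//.
exact: measurable_fun_pair1.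
Qed.

Section Weighted.
Variable H : R * (R * R) -> \bar R.
Hypotheses (mH : measurable_fun setT H) (H0 : forall x, (0 <= H x)%E)
  (HP : forall g z, H (g + 2 * pi, z) = H (g, z)).

Let mHk : measurable_fun setT (fun x : (R * R) * R => H (x.1.1, kpoint x.1.1 x.1.2 x.2)).
Proof.
apply: (measurableT_comp mH); have := @measurable_kpoint R => h; mfun.
Qed.

Let K (x : R * R) : \bar R := ((\int[mu]_t H (x.1, kpoint x.1 x.2 t)) * (cosca x.2 ^+ 2)%:E)%E.

Let mK : measurable_fun setT K.
Proof.
apply: emeasurable_funM; last by mfun.
exact: (@measurable_fun_fubini_tonelli_F _ _ _ _ _ mu
  (fun x : (R * R) * R => H (x.1.1, kpoint x.1.1 x.1.2 x.2))).
Qed.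

Let K0 x : (0 <= K x)%E.
Proof. by rewrite mule_ge0// ?lee_fin ?exprn_ge0 ?(ltW (cosca_gt0 _))//; apply: integral_ge0. Qed.

(* A Santalo-type formula. *)
Lemma ge0_integral_santalo :
  (\int[mu2]_(x in GH) ((\int[mu]_t H (gam x.1 x.2, kpoint (gam x.1 x.2) x.2 t)) * (cosca x.2 ^+ 2)%:E) =
   \int[mu]_(g in @arc R) \int[mu2]_(z in @Disk R) (H (g, z) * (bdf z * hypdens z)%:E))%E.
Proof.
have KP b a : K (b + 2 * pi, a) = K (b, a).
  by rewrite /K /=; under eq_integral do rewrite kpoint2pi HP.
transitivity (\int[mu2]_(x in GH) K (x.1 + (atan x.2 + pi / 2), x.2)%R)%E.
  by apply: eq_integral => x _; rewrite /K /gam /= addrA.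
rewrite (ge0_integral_GH_shift (phi := fun a => atan a + pi / 2))//; last by mfun.
rewrite ge0_integral_GH1//; apply: eq_integral => g _.
by rewrite -(ge0_integral_kpoint (F := fun z => H (g, z)) g)//; exact: measurable_fun_pair2.
Qed.

End Weighted.

(** On the points of a geodesic of angle [g] the linear form equals [sinca a] ([ridge_kpoint]). So
    this is the kernel [cos (m g + th) s^j] on geodesics, read as a function of the point. *)
Definition ridge (m j : nat) (th : R) g z : R :=
  cos (m%:R * g + th) * (- ((kap z).1 * cos g + (kap z).2 * sin g)) ^+ j.

Lemma integrable_arc (f : R -> R) : continuous f -> mu.-integrable (@arc R) (EFin \o f).
Proof.
move=> cf; rewrite arcE; have h : mu.-integrable `[0, 2 * pi] (EFin \o f).
  by apply: continuous_compact_integrable; [exact: segment_compact|exact: continuous_subspaceT].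
by apply: integrableS h => //; move=> x /=; rewrite !in_itv/= => /andP[-> /ltW].
Qed.

Lemma continuous_cos_affine (m : nat) (th : R) : continuous (fun g : R => cos (m%:R * g + th)).
Proof.
move=> g; apply: (cvg_comp (fun g : R => m%:R * g + th) (@cos R)); last exact: continuous_cos.
by apply: cvgD; [apply: cvgM; [exact: cvg_cst|exact: cvg_id]|exact: cvg_cst].
Qed.

Lemma Rintegral_arc_cos (m : nat) (th : R) : (0 < m)%N ->
  Rintegral mu (@arc R) (fun g => cos (m%:R * g + th)) = 0.
Proof.
move=> m0; have P0 := @pi2_gt0 R.
have mm : m%:R != 0 :> R by rewrite pnatr_eq0 -lt0n.
have dF (x : R) : is_derive x (1:R) (fun g => m%:R^-1 * sin (m%:R * g + th)) (cos (m%:R * x + th)).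
  have d1 : is_derive x (1:R) (fun g : R => m%:R * g + th) m%:R.
    have := is_deriveZ m%:R (is_derive_id x 1) => e1.
    by have := is_deriveD e1 (is_derive_cst th x 1) => e2; apply: is_derive_eq e2 _; rewrite addr0 /GRing.scale/= mulr1.
  have := @is_derive1_comp _ (@sin R) (fun g => m%:R * g + th) x _ _ (is_derive_sin (m%:R * x + th)) d1 => d2.
  have := is_deriveZ m%:R^-1 d2 => d3; apply: is_derive_eq d3 _.
  by rewrite /GRing.scale/= mulrCA mulVf// mulr1.
rewrite /Rintegral arcE (integral_itv_bndo_bndc); last first.
  by apply: measurable_funTS; apply/measurable_EFinP; apply: continuous_measurable_fun; exact: continuous_cos_affine.
rewrite (@continuous_FTC2 R _ (fun g => m%:R^-1 * sin (m%:R * g + th)))//.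
- rewrite -EFinB /= mulr0 add0r.
  rewrite (_ : m%:R * (2 * pi) + th = th + (pi *+ 2) *+ m); last by rewrite [2 * pi]mulr_natl mulr_natl addrC.
  suff -> : sin (th + pi *+ 2 *+ m) = sin th by rewrite subrr.
  by elim: m {m0 mm dF} => [|m IH]; rewrite ?mulr0n ?addr0// mulrS addrCA addrC sinD2pi.
- by apply: continuous_subspaceT; exact: continuous_cos_affine.
- have cF : continuous (fun g : R => m%:R^-1 * sin (m%:R * g + th)).
    by move=> x; apply: differentiable_continuous; apply/derivable1_diffP.
  split; [move=> x _; by have [] := dF x|apply: cvg_at_right_filter|apply: cvg_at_left_filter]; exact: cF.
- by move=> x _; rewrite derive1E; apply: derive_val.
Qed.

Lemma continuous_ridge_fun (m j : nat) (th x y : R) :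
  continuous (fun g => cos (m%:R * g + th) * (x * cos g + y * sin g) ^+ j).
Proof.
move=> g; apply: cvgM; first exact: continuous_cos_affine.
apply: (cvg_comp (fun g : R => x * cos g + y * sin g) (fun v => v ^+ j)); last exact: exprn_continuous.
by apply: cvgD; apply: cvgM; try exact: cvg_cst; [exact: continuous_cos|exact: continuous_sin].
Qed.

(** Each factor [x cos g + y sin g] moves the frequency up or down by one. Starting above [j], the
    frequency is still positive when the power is used up. *)
Lemma Rintegral_arc_ridge (j : nat) : forall (m : nat) (th x y : R), (j < m)%N ->
  Rintegral mu (@arc R) (fun g => cos (m%:R * g + th) * (x * cos g + y * sin g) ^+ j) = 0.
Proof.
elim: j => [|j IH] m th x y jm.
  under eq_Rintegral do rewrite expr0 mulr1.
  exact: Rintegral_arc_cos.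
case: m jm => // m jm.
have E g : cos (m.+1%:R * g + th) * (x * cos g + y * sin g) ^+ j.+1 =
   ((x / 2) * (cos (m.+2%:R * g + th) * (x * cos g + y * sin g) ^+ j) +
    (x / 2) * (cos (m%:R * g + th) * (x * cos g + y * sin g) ^+ j)) +
   ((y / 2) * (cos (m.+2%:R * g + (th - pi / 2)) * (x * cos g + y * sin g) ^+ j) +
    (- y / 2) * (cos (m%:R * g + (th - pi / 2)) * (x * cos g + y * sin g) ^+ j)).
  have c2 : cos (m.+2%:R * g + th) = cos (m.+1%:R * g + th) * cos g - sin (m.+1%:R * g + th) * sin g.
    by rewrite -cosD; congr cos; rewrite -[m.+2%:R]natr1; ring.
  have c0 : cos (m%:R * g + th) = cos (m.+1%:R * g + th) * cos g + sin (m.+1%:R * g + th) * sin g.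
    by rewrite -cosB; congr cos; rewrite -[m.+1%:R]natr1; ring.
  have s2 : cos (m.+2%:R * g + (th - pi / 2)) = sin (m.+1%:R * g + th) * cos g + cos (m.+1%:R * g + th) * sin g.
    by rewrite addrA cosBpihalf -sinD; congr sin; rewrite -[m.+2%:R]natr1; ring.
  have s0 : cos (m%:R * g + (th - pi / 2)) = sin (m.+1%:R * g + th) * cos g - cos (m.+1%:R * g + th) * sin g.
    by rewrite addrA cosBpihalf -sinB; congr sin; rewrite -[m.+1%:R]natr1; ring.
  by rewrite c2 c0 s2 s0 exprS; field.
have mA := @measurable_arc R.
have iZ (k : R) (n : nat) (th' : R) :
    mu.-integrable (@arc R) (EFin \o (fun g => k * (cos (n%:R * g + th') * (x * cos g + y * sin g) ^+ j))).
  apply: integrable_arc => g; apply: cvgM; first exact: cvg_cst.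
  exact: continuous_ridge_fun.
have i1 (n : nat) (th' : R) :
    mu.-integrable (@arc R) (EFin \o (fun g => cos (n%:R * g + th') * (x * cos g + y * sin g) ^+ j)).
  by apply: integrable_arc; exact: continuous_ridge_fun.
have iD (f1 f2 : R -> R) : mu.-integrable (@arc R) (EFin \o f1) -> mu.-integrable (@arc R) (EFin \o f2) ->
    mu.-integrable (@arc R) (EFin \o (fun g => f1 g + f2 g)).
  move=> h1 h2; rewrite (_ : EFin \o _ = (fun g => (f1 g)%:E + (f2 g)%:E)%E)//.
  exact: integrableD.
under eq_Rintegral do rewrite E.
rewrite RintegralD//; [|exact: iD|exact: iD].
rewrite !RintegralD// !RintegralZl// !IH ?mulr0 ?addr0//.
all: by rewrite ltnS (leq_trans _ (leqnSn _))// ltnW.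
Qed.

End Santalo.

(** * Orthogonality of the range to the ridge functions *)

Section RidgeOrthogonality.
Variable R : realType.
Local Notation C := (R[i]).
Local Notation mu := (@lebesgue_measure R).
Local Notation mu2 := (mu \x mu)%E.
Local Notation GH := (@GHdom R).
Implicit Types (a b t g : R) (z : R * R).

Lemma kap_le1 z : (kap z).1 ^+ 2 + (kap z).2 ^+ 2 <= 1.
Proof.
rewrite /kap /= !exprMn -mulrDl exprVn ler_pdivrMr ?exprn_gt0 ?ltr_pwDl ?addr_ge0 ?sqr_ge0//.
rewrite mul1r /r2 -subr_ge0.
rewrite (_ : _ - _ = (1 - (z.1 ^+ 2 + z.2 ^+ 2)) ^+ 2) ?sqr_ge0//; ring.
Qed.

Lemma ridge_le1 m j th g z : `|ridge m j th g z| <= 1.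
Proof.
rewrite /ridge normrM; apply: mulr_ile1 => //; first by rewrite ler_norml cos_geN1 cos_le1.
rewrite normrX; apply: exprn_ile1 => //.
rewrite normrN -(ler_pXn2r (n := 2)) ?nnegrE// expr1n real_normK ?num_real//.
apply: le_trans (kap_le1 z).
have := cos2Dsin2 g; move: (cos g) (sin g) (kap z).1 (kap z).2 => c s x y cs.
rewrite -subr_ge0 (_ : _ - _ = (x * s - y * c) ^+ 2) ?sqr_ge0//.
have -> : x ^+ 2 + y ^+ 2 = (x ^+ 2 + y ^+ 2) * (c ^+ 2 + s ^+ 2) by rewrite cs mulr1.
ring.
Qed.

Lemma ridge_kpoint m j th g a t :
  ridge m j th g (kpoint g a t) = cos (m%:R * g + th) * sinca a ^+ j.
Proof.
rewrite /ridge kap_kpoint /rot /klein /=; congr (_ * _ ^+ _).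
have := cos2Dsin2 g; move: (cos g) (sin g) => c s cs.
rewrite (_ : - _ = sinca a * (c ^+ 2 + s ^+ 2)); first by rewrite cs mulr1.
ring.
Qed.

Lemma cos_natD2pi (m : nat) (x : R) : cos (x + m%:R * (2 * pi)) = cos x.
Proof.
elim: m => [|m IH]; first by rewrite mul0r addr0.
by rewrite -natr1 mulrDl mul1r addrA [2 * pi]mulr_natl cosD2pi -[pi *+ 2]mulr_natl IH.
Qed.

Lemma ridge2pi m j th g z : ridge m j th (g + 2 * pi) z = ridge m j th g z.
Proof.
rewrite /ridge [2 * pi]mulr_natl cosD2pi sinD2pi -[pi *+ 2]mulr_natl; congr (_ * _).
by rewrite mulrDr addrAC cos_natD2pi.
Qed.

Lemma measurable_kap : measurable_fun setT (@kap R).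
Proof. by rewrite /kap /r2; mfun. Qed.

Lemma measurable_ridge m j th : measurable_fun setT (fun x : R * (R * R) => ridge m j th x.1 x.2).
Proof.
have mk : measurable_fun setT (fun x : R * (R * R) => kap x.2) by apply: measurableT_comp measurable_kap _.
have mk1 : measurable_fun setT (fun x : R * (R * R) => (kap x.2).1) by exact: measurableT_comp mk.
have mk2 : measurable_fun setT (fun x : R * (R * R) => (kap x.2).2) by exact: measurableT_comp mk.
by rewrite /ridge; mfun.
Qed.

Lemma integral_arc_ridge m j th z : (j < m)%N ->
  (\int[mu]_(g in @arc R) (1 + ridge m j th g z)%:E = (2 * pi)%:E)%E.
Proof.
move=> jm.
have E g : ridge m j th g z = cos (m%:R * g + th) * ((- (kap z).1) * cos g + (- (kap z).2) * sin g) ^+ j.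
  by rewrite /ridge; congr (_ * _ ^+ _); ring.
have i1 : mu.-integrable (@arc R) (EFin \o (fun g => ridge m j th g z)).
  by apply: integrable_arc => g; under eq_fun do rewrite E; exact: continuous_ridge_fun.
have i0 : mu.-integrable (@arc R) (EFin \o (fun=> 1)).
  by apply: integrable_arc => g; exact: cvg_cst.
have mA := @measurable_arc R.
under eq_integral do rewrite EFinD.
rewrite integralD//.
have := Rintegral_arc_ridge th (- (kap z).1) (- (kap z).2) jm.
under eq_Rintegral do rewrite -E.
rewrite /Rintegral => h.
have -> : (\int[mu]_(g in @arc R) (ridge m j th g z)%:E = 0)%E.
  by rewrite -(fineK (integrable_fin_num _ i1))//= h.
have muA : mu (@arc R) = (2 * pi)%:E.
  by rewrite arcE lebesgue_measure_itv/= lte_fin pi2_gt0 -EFinD subr0.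
by rewrite adde0 integral_cst// mul1e; exact: muA.
Qed.

(** The planar Tonelli theorem is applied twice, exchanging [g] with one coordinate of [z] at a
    time. *)
Lemma ge0_integral_swap (A : set R) (B : set (R * R)) (f : R * (R * R) -> \bar R) :
  measurable A -> measurable B -> measurable_fun setT f -> (forall x, (0 <= f x)%E) ->
  (\int[mu]_(g in A) \int[mu2]_(z in B) f (g, z) = \int[mu2]_(z in B) \int[mu]_(g in A) f (g, z))%E.
Proof.
move=> mA mB mf f0; pose f' := f \_ (A `*` B).
have mf' : measurable_fun setT f'.
  apply/(measurable_restrictT _ (measurableX mA mB)); exact: measurable_funTS.
have f'0 x : (0 <= f' x)%E by apply: erestrict_ge0.
have mzg : measurable_fun setT (fun z => \int[mu]_x f' (x, z))%E.
  exact: (@measurable_fun_fubini_tonelli_G _ _ _ _ _ mu f').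
have mgz : measurable_fun setT (fun x : R * R => \int[mu]_w f' (x.1, (x.2, w)))%E.
  apply: (@measurable_fun_fubini_tonelli_F _ _ _ _ _ mu (fun x : (R * R) * R => f' (x.1.1, (x.1.2, x.2)))) => //.
  by apply: (measurableT_comp mf'); mfun.
have E : (\int[mu]_x \int[mu2]_y f' (x, y) = \int[mu2]_y \int[mu]_x f' (x, y))%E.
  rewrite [RHS]fubini_tonelli1//; last by move=> z; apply: integral_ge0 => g _; exact: f'0.
  transitivity (\int[mu]_g \int[mu]_v \int[mu]_w f' (g, (v, w)))%E.
    apply: eq_integral => g _; rewrite fubini_tonelli1//.
    exact: (measurable_fun_pair2 g mf').
  have := @fubini_tonelli _ _ _ _ R mu mu _ mgz; rewrite /= => ->; last first.
    by move=> x; apply: integral_ge0 => w _; exact: f'0.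
  apply: eq_integral => v _; rewrite /fubini_F.
  have mvw : measurable_fun setT (fun x : R * R => f' (x.1, (v, x.2))).
    by apply: (measurableT_comp mf'); mfun.
  by have := @fubini_tonelli _ _ _ _ R mu mu _ mvw; rewrite /= => ->.
transitivity (\int[mu]_x \int[mu2]_y f' (x, y))%E.
  rewrite integral_mkcond; apply: eq_integral => g _; rewrite patchE.
  case: ifPn => gA; last first.
    rewrite integral0_eq// => z _; rewrite /f' patchE ifF//; apply/negP => /set_mem[/= ga _].
    by move/negP: gA; apply; exact/mem_set.
  rewrite integral_mkcond; apply: eq_integral => z _; rewrite /f' !patchE in_setX gA /=.
  by [].
rewrite E [RHS]integral_mkcond; apply: eq_integral => z _; rewrite [RHS]patchE.
case: ifPn => zB; last first.
  rewrite integral0_eq// => g _; rewrite /f' patchE ifF//; apply/negP => /set_mem[/= _ zb].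
  by move/negP: zB; apply; exact/mem_set.
by rewrite [RHS]integral_mkcond; apply: eq_integral => g _; rewrite /f' !patchE in_setX zB andbT.
Qed.

Definition ridgewt m j th (x : R * R) : R :=
  cosca x.2 ^+ 2 * (cos (m%:R * gam x.1 x.2 + th) * sinca x.2 ^+ j).
Local Notation W := ridgewt.

Lemma measurable_ridgewt m j th : measurable_fun setT (W m j th).
Proof. by rewrite /ridgewt /gam; mfun. Qed.

Lemma ridgewt_le m j th x : `|W m j th x| <= cosca x.2 ^+ 2.
Proof.
rewrite /ridgewt normrM ger0_norm ?exprn_ge0 ?(ltW (cosca_gt0 _))//.
rewrite ler_piMr ?exprn_ge0 ?(ltW (cosca_gt0 _))// normrM; apply: mulr_ile1 => //.
  by rewrite ler_norml cos_geN1 cos_le1.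
by rewrite normrX exprn_ile1// sinca_norm_le1.
Qed.

Section Nonneg.
Variables (F : R * R -> R).
Hypotheses (mF : measurable_fun setT F) (F0 : forall z, 0 <= F z)
  (iF : (\int[mu2]_(z in @Disk R) (F z * (bdf z * hypdens z))%:E < +oo)%E).

Definition rayint (x : R * R) : \bar R := (\int[mu]_t (F (kpoint (gam x.1 x.2) x.2 t))%:E)%E.

Local Notation J := rayint.

Let J_ge0 x : (0 <= J x)%E. Proof. by apply: integral_ge0 => t _; rewrite lee_fin. Qed.

Let mFk : measurable_fun setT (fun x : (R * R) * R => (F (kpoint (gam x.1.1 x.1.2) x.1.2 x.2))%:E).
Proof.
apply/measurable_EFinP; apply: (measurableT_comp mF).
by rewrite /kpoint /klein2disk /rot /klein /gam /r2 /=; mfun.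
Qed.

Lemma measurable_rayint : measurable_fun setT J.
Proof.
apply: (@measurable_fun_fubini_tonelli_F _ _ _ _ _ mu
  (fun x : (R * R) * R => (F (kpoint (gam x.1.1 x.1.2) x.1.2 x.2))%:E)).
  exact: mFk.
by move=> x; rewrite lee_fin.
Qed.

(** The Santalo formula brings the average over directions inside, where [1 + ridge] has total mass
    [2 * pi] whatever the point. The value is thus independent of [m], [j] and [th]. *)
Let santalo_ridge m j th : (j < m)%N ->
  (\int[mu2]_(x in GH) (J x * (cosca x.2 ^+ 2 + W m j th x)%:E) =
   (2 * pi)%:E * \int[mu2]_(z in @Disk R) (F z * (bdf z * hypdens z))%:E)%E.
Proof.
move=> jm.
pose H (x : R * (R * R)) := (F x.2 * (1 + ridge m j th x.1 x.2))%:E.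
have T0 g z : 0 <= 1 + ridge m j th g z.
  by have := ridge_le1 m j th g z; rewrite ler_norml => /andP[h _]; rewrite -lerBlDl sub0r.
have H0 x : (0 <= H x)%E by rewrite lee_fin mulr_ge0.
have mR := @measurable_ridge m j th.
have mF2 : measurable_fun setT (fun x : R * (R * R) => F x.2) by exact: measurableT_comp mF _.
have mH : measurable_fun setT H.
  by apply/measurable_EFinP; apply: measurable_funM => //; exact: measurable_funD.
have wt_ge0 (z : R * R) : Disk z -> 0 <= bdf z * hypdens z.
  rewrite /Disk/= => dz; have z0 : 0 <= r2 z by rewrite addr_ge0 ?sqr_ge0.
  rewrite mulr_ge0// ?divr_ge0 ?sqr_ge0 ?subr_ge0 ?(ltW dz)//; exact: addr_ge0.
transitivity (\int[mu2]_(x in GH) ((\int[mu]_t H (gam x.1 x.2, kpoint (gam x.1 x.2) x.2 t)) * (cosca x.2 ^+ 2)%:E))%E.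
  apply: eq_integral => x _.
  under [in RHS]eq_integral do rewrite /H /= ridge_kpoint mulrC EFinM.
  rewrite ge0_integralZl//; last 3 first.
  - exact: (measurable_fun_pair2 x mFk).
  - by move=> t _; rewrite lee_fin.
  - by have := T0 (gam x.1 x.2) (kpoint (gam x.1 x.2) x.2 0); rewrite ridge_kpoint lee_fin.
  rewrite -/(rayint x) [in RHS](muleC _ (J x)) -muleA -EFinM; congr (_ * _)%E; congr EFin.
  by rewrite /ridgewt; ring.
rewrite (ge0_integral_santalo (H := H))//; last by move=> g z; rewrite /H /= ridge2pi.
have mD := @measurable_disk R.
have mw : measurable_fun setT (fun z : R * R => bdf z * hypdens z).
  by rewrite /bdf /hypdens /r2; mfun.
pose K (x : R * (R * R)) := (H x * (bdf x.2 * hypdens x.2)%:E)%E.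
(* [bdf] is negative outside the disk; the positive part of the weight makes the integrand
   nonnegative on the whole space, as the exchange of integrals requires. *)
pose K1 (x : R * (R * R)) := (H x * (Num.max 0 (bdf x.2 * hypdens x.2))%:E)%E.
have KK1 g z : Disk z -> K (g, z) = K1 (g, z).
  by move=> dz; rewrite /K /K1 max_r//; exact: wt_ge0.
have mw2 : measurable_fun setT (fun x : R * (R * R) => bdf x.2 * hypdens x.2).
  exact: measurableT_comp mw _.
have mK1 : measurable_fun setT K1.
  by apply: emeasurable_funM => //; apply/measurable_EFinP; exact: measurable_maxr.
transitivity (\int[mu]_(g in @arc R) \int[mu2]_(z in @Disk R) K1 (g, z))%E.
  by apply: eq_integral => g _; apply: eq_integral => z /set_mem dz; rewrite -KK1.
rewrite ge0_integral_swap//; [|exact: measurable_arc|by move=> x; rewrite mule_ge0// lee_fin le_max lexx].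
rewrite -ge0_integralZl//; last 3 first.
- by apply/measurable_EFinP; apply: measurable_funTS; exact: measurable_funM.
- by move=> z dz; rewrite lee_fin mulr_ge0// wt_ge0.
- by rewrite lee_fin ltW// pi2_gt0.
apply: eq_integral => z /set_mem dz.
transitivity (\int[mu]_(g in @arc R) ((F z * (bdf z * hypdens z))%:E * (1 + ridge m j th g z)%:E))%E.
  by apply: eq_integral => g _; rewrite -KK1// /K /H /= -!EFinM; congr EFin; ring.
rewrite ge0_integralZl//; last 3 first.
- apply/measurable_EFinP; apply: measurable_funTS; apply: measurable_funD => //.
  exact: (measurable_fun_pair1 z mR).
- by move=> g _; rewrite lee_fin.
- by rewrite lee_fin mulr_ge0// wt_ge0.
by rewrite integral_arc_ridge// muleC.
exact: measurable_arc.
Qed.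

Let mJ := measurable_rayint.
Let mW := measurable_ridgewt.

Let KF : (((2 * pi)%:E * \int[mu2]_(z in @Disk R) (F z * (bdf z * hypdens z))%:E) < +oo)%E.
Proof. by rewrite lte_mul_pinfty// lee_fin ltW// pi2_gt0. Qed.

Let WN m j th x : W m j (th + pi) x = - W m j th x.
Proof. by rewrite /ridgewt addrA cosDpi; ring. Qed.

Let cW0 m j th x : 0 <= cosca x.2 ^+ 2 + W m j th x.
Proof. by have := ridgewt_le m j th x; rewrite ler_norml => /andP[h _]; rewrite addrC -lerBlDr sub0r. Qed.

Let mG : measurable (GH : set (measurableTypeR R * measurableTypeR R)).
Proof. exact: measurable_GH. Qed.

Let iP m j th : (j < m)%N ->
  mu2.-integrable GH (fun x => J x * (cosca x.2 ^+ 2 + W m j th x)%:E)%E.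
Proof.
move=> jm; apply/integrableP; split.
  apply: measurable_funTS; apply: emeasurable_funM => //.
  by apply/measurable_EFinP; apply: measurable_funD; [mfun|exact: mW].
under eq_integral do rewrite gee0_abs ?mule_ge0 ?lee_fin//.
by rewrite santalo_ridge.
Qed.

(** Adding the phases [0] and [pi] cancels the ridge term and leaves [J] times [2 c^2], whose factor
    is positive; integrability then forces [J] to be finite almost everywhere. *)
Lemma rayint_fin : {ae mu2, forall x, GH x -> J x \is a fin_num}.
Proof.
have i1 := @iP 1 0 0 isT; have i2 := @iP 1 0 (0 + pi) isT.
have := integrable_ae mG (integrableD mG i1 i2); apply: ae2_imp => x h /h.
rewrite WN -ge0_muleDr ?lee_fin -?WN// WN -EFinD addrACA subrr addr0 => {}h.
have c0 : 0 < cosca x.2 ^+ 2 + cosca x.2 ^+ 2 by rewrite addr_gt0 ?exprn_gt0 ?cosca_gt0.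
rewrite ge0_fin_numE// ltey; apply/eqP => Jy; move: h.
by rewrite Jy gt0_mulye ?lte_fin.
Qed.

Lemma integrable_rayint_cosca : mu2.-integrable GH (EFin \o (fun x => fine (J x) * cosca x.2 ^+ 2)).
Proof.
have i1 := @iP 1 0 0 isT; have i2 := @iP 1 0 (0 + pi) isT.
have mfJ : measurable_fun setT (fun x => fine (J x)) by exact: measurableT_comp mJ.
apply: (le_integrable mG _ _ (integrableD mG i1 i2)).
  by apply: measurable_funTS; apply/measurable_EFinP; apply: measurable_funM => //; mfun.
move=> x _ /=; rewrite WN -ge0_muleDr ?lee_fin -?WN// WN -EFinD addrACA subrr addr0.
have c0 : 0 <= cosca x.2 ^+ 2 by rewrite exprn_ge0 ?ltW ?cosca_gt0.
rewrite gee0_abs; last by rewrite mule_ge0// lee_fin addr_ge0.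
rewrite ger0_norm ?mulr_ge0 ?fine_ge0//.
case: (J x) (J_ge0 x) => [r| |]//=; rewrite ?mul0r ?mule_ge0 ?lee_fin ?addr_ge0// => r0.
by rewrite ler_wpM2l// lerDl.
all: by rewrite ltW ?cosca_gt0.
Qed.

Lemma integrable_rayint_ridgewt m j th :
  mu2.-integrable GH (EFin \o (fun x => fine (J x) * W m j th x)).
Proof.
have mfJ : measurable_fun setT (fun x => fine (J x)) by exact: measurableT_comp mJ.
apply: (le_integrable mG _ _ integrable_rayint_cosca).
  by apply: measurable_funTS; apply/measurable_EFinP; apply: measurable_funM; [exact: mfJ|exact: mW].
move=> x _; rewrite /= lee_fin normrM [leRHS]normrM ler_wpM2l//.
by rewrite (le_trans (ridgewt_le _ _ _ _))// ler_norm.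
Qed.

Let Rint_cW m j th : (j < m)%N ->
  Rintegral mu2 GH (fun x => fine (J x) * (cosca x.2 ^+ 2 + W m j th x)) =
  fine ((2 * pi)%:E * \int[mu2]_(z in @Disk R) (F z * (bdf z * hypdens z))%:E).
Proof.
move=> jm; rewrite -(@santalo_ridge m j th jm) /Rintegral; congr fine.
have mfJ : measurable_fun setT (fun x => fine (J x)) by exact: measurableT_comp mJ.
have mcW : measurable_fun setT (fun x => cosca x.2 ^+ 2 + W m j th x).
  by apply: measurable_funD; [mfun|exact: mW].
apply: (ae_eq_integral _ _ mG).
- by apply: measurable_funTS; apply/measurable_EFinP; exact: measurable_funM.
- by apply: measurable_funTS; apply: emeasurable_funM => //; exact/measurable_EFinP.
apply: ae2_imp rayint_fin => x h xG; rewrite EFinM fineK//; exact: h.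
Qed.

(** The phases [th] and [th + pi] give the same value in [Rint_cW] while their ridge terms are
    opposite. *)
Lemma Rintegral_rayint_ridgewt m j th : (j < m)%N ->
  Rintegral mu2 GH (fun x => fine (J x) * W m j th x) = 0.
Proof.
move=> jm; have h1 := Rint_cW th jm; have h2 := Rint_cW (th + pi) jm.
have iG := integrable_rayint_ridgewt m j th.
move: h1 h2; under eq_Rintegral do rewrite mulrDr.
rewrite (RintegralD mG integrable_rayint_cosca iG) => h1.
under eq_Rintegral do rewrite WN mulrDr mulrN.
rewrite (RintegralB mG integrable_rayint_cosca iG) => h2.
by move: h1 h2; lra.
Qed.

End Nonneg.

Section Signed.
Variable u : R * R -> R.
Hypotheses (mu_ : measurable_fun setT u)
  (iu : (\int[mu2]_(z in @Disk R) (`|u z| * (bdf z * hypdens z))%:E < +oo)%E).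

Definition rrayint (x : R * R) : R := Rintegral mu setT (fun t => u (kpoint (gam x.1 x.2) x.2 t)).

Let p z := Num.max (u z) 0.
Let n z := Num.max (- u z) 0.

Let mp : measurable_fun setT p. Proof. exact: measurable_maxr. Qed.
Let mn : measurable_fun setT n. Proof. by apply: measurable_maxr => //; rewrite /n; mfun. Qed.

Let p0 z : 0 <= p z. Proof. by rewrite le_max lexx orbT. Qed.
Let n0 z : 0 <= n z. Proof. by rewrite le_max lexx orbT. Qed.

Let wt_ge0 z : Disk z -> 0 <= bdf z * hypdens z.
Proof.
rewrite /Disk/= => dz; have z0 : 0 <= r2 z by rewrite addr_ge0 ?sqr_ge0.
rewrite mulr_ge0// ?divr_ge0 ?sqr_ge0 ?subr_ge0 ?(ltW dz)//; exact: addr_ge0.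
Qed.

Let le_iu (v : R * R -> R) : measurable_fun setT v -> (forall z, 0 <= v z <= `|u z|) ->
  (\int[mu2]_(z in @Disk R) (v z * (bdf z * hypdens z))%:E < +oo)%E.
Proof.
move=> mv vu; apply: le_lt_trans iu; have mD := @measurable_disk R.
have mw : measurable_fun setT (fun z : R * R => bdf z * hypdens z).
  by rewrite /bdf /hypdens /r2; mfun.
apply: ge0_le_integral => //.
- by move=> z dz; have /andP[v0 _] := vu z; rewrite lee_fin mulr_ge0// wt_ge0.
- by apply: measurable_funTS; apply/measurable_EFinP; exact: measurable_funM.
- by apply: measurable_funTS; apply/measurable_EFinP; apply: measurable_funM => //; exact: measurableT_comp mu_.
by move=> z dz; have /andP[_ v1] := vu z; rewrite lee_fin ler_wpM2r// wt_ge0.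
Qed.

Let ip : (\int[mu2]_(z in @Disk R) (p z * (bdf z * hypdens z))%:E < +oo)%E.
Proof. by apply: le_iu => // z; rewrite p0 ge_max ler_norm normr_ge0. Qed.

Let i_n : (\int[mu2]_(z in @Disk R) (n z * (bdf z * hypdens z))%:E < +oo)%E.
Proof. by apply: le_iu => // z; rewrite n0 /n ge_max -normrN ler_norm normr_ge0. Qed.

Let rrayintE x : rrayint x = fine (rayint p x - rayint n x)%E.
Proof.
rewrite /rrayint /Rintegral integralE; congr (fine (_ - _)%E); apply: eq_integral => t _.
  by rewrite funeposE /p /= EFin_max.
by rewrite funenegE /n /= EFin_max.
Qed.

Lemma measurable_rrayint : measurable_fun setT rrayint.
Proof.
rewrite (_ : rrayint = fine \o (fun x => rayint p x - rayint n x)%E); last exact/funext.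
have h1 := measurable_rayint mp p0; have h2 := measurable_rayint mn n0.
by apply: measurableT_comp => //; apply: emeasurable_funB; [exact: h1|exact: h2].
Qed.

Let rrayint_ae m j th : ae_eq mu2 GH (EFin \o (fun x => rrayint x * ridgewt m j th x))
  (fun x => (fine (rayint p x) * ridgewt m j th x - fine (rayint n x) * ridgewt m j th x)%:E).
Proof.
apply: ae2_imp (ae2_and (rayint_fin mp p0 ip) (rayint_fin mn n0 i_n)) => x [h1 h2] xG.
by rewrite /= rrayintE fineB ?h1 ?h2// mulrBl.
Qed.

Let mG : measurable (GH : set (measurableTypeR R * measurableTypeR R)).
Proof. exact: measurable_GH. Qed.

Lemma integrable_rrayint m j th :
  mu2.-integrable GH (EFin \o (fun x => rrayint x * ridgewt m j th x)).
Proof.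
have h1 := integrable_rayint_cosca mp p0 ip; have h2 := integrable_rayint_cosca mn n0 i_n.
apply: (le_integrable mG _ _ (integrableD mG h1 h2)).
  apply: measurable_funTS; apply/measurable_EFinP; apply: measurable_funM; first exact: measurable_rrayint.
  exact: measurable_ridgewt.
move=> x _ /=; rewrite lee_fin -mulrDl normrM [leRHS]normrM.
apply: ler_pM => //; last by rewrite (le_trans (ridgewt_le _ _ _ _))// ler_norm.
rewrite rrayintE.
have : (0 <= rayint p x)%E by apply: integral_ge0 => t _; rewrite lee_fin.
have : (0 <= rayint n x)%E by apply: integral_ge0 => t _; rewrite lee_fin.
case: (rayint p x) => [r| |]; case: (rayint n x) => [s| |] //=; rewrite ?lee_fin ?add0r ?addr0 ?normr0//.
by move=> s0 r0; rewrite [leRHS]ger0_norm ?addr_ge0// (le_trans (ler_normB _ _))// !ger0_norm.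
Qed.

Lemma Rintegral_rrayint m j th : (j < m)%N ->
  Rintegral mu2 GH (fun x => rrayint x * ridgewt m j th x) = 0.
Proof.
move=> jm.
have h1 := integrable_rayint_ridgewt mp p0 ip m j th.
have h2 := integrable_rayint_ridgewt mn n0 i_n m j th.
transitivity (Rintegral mu2 GH (fun x => fine (rayint p x) * ridgewt m j th x - fine (rayint n x) * ridgewt m j th x)).
  rewrite /Rintegral; congr fine; apply: (ae_eq_integral _ _ mG).
  - exact: measurable_int (integrable_rrayint m j th).
  - exact: measurable_int (integrableB mG h1 h2).
  - exact: rrayint_ae.
rewrite (RintegralB mG h1 h2).
by rewrite (Rintegral_rayint_ridgewt mp p0 ip th jm) (Rintegral_rayint_ridgewt mn n0 i_n th jm) subrr.
Qed.

End Signed.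
Section XhalfL2D.
Variables u : R * R -> C.
Hypothesis L2u : L2D u.

Definition xhalf (p : R * R) : C := Complex (Num.sqrt (bdf p)) 0 * u p.

Let mre : measurable_fun setT (fun p => cre (u p)). Proof. by case: L2u => -[]. Qed.
Let mim : measurable_fun setT (fun p => cim (u p)). Proof. by case: L2u => -[]. Qed.

Lemma cmeas_xhalf : cmeas xhalf.
Proof.
have m1 := mre; have m2 := mim; split.
  rewrite (_ : (fun p => cre (xhalf p)) = (fun p => Num.sqrt (bdf p) * cre (u p))).
    by rewrite /bdf /r2; mfun.
  by apply/funext => p; rewrite creM /= mul0r subr0.
rewrite (_ : (fun p => cim (xhalf p)) = (fun p => Num.sqrt (bdf p) * cim (u p))).
  by rewrite /bdf /r2; mfun.
by apply/funext => p; rewrite cimM /= mul0r addr0.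
Qed.

Lemma lebesgue_Disk_lty : (mu2 (@Disk R) < +oo)%E.
Proof.
pose I : set (measurableTypeR R) := `[-1, 1]%classic.
have mI : measurable I by exact: measurable_itv.
have DI : @Disk R `<=` I `*` I.
  move=> [x y]; rewrite /Disk /r2 /= => h; split; rewrite /I /= in_itv/=.
    by rewrite -ler_norml -(ler_pXn2r (n := 2)) ?nnegrE// expr1n real_normK ?num_real//; have := sqr_ge0 y; lra.
  by rewrite -ler_norml -(ler_pXn2r (n := 2)) ?nnegrE// expr1n real_normK ?num_real//; have := sqr_ge0 x; lra.
apply: (@le_lt_trans _ _ (mu2 (I `*` I))).
  apply: le_measure => //; rewrite inE; first exact: measurable_disk.
  exact: measurableX.
have -> : mu2 (I `*` I) = (mu I * mu I)%E by exact: product_measure1E.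
have -> : mu I = 2%:E.
  have lt11 : -1 < 1 :> R by lra.
  by rewrite /I lebesgue_measure_itv/= lte_fin lt11 -EFinB opprK.
by rewrite -EFinM ltry.
Qed.

(** Here [s] is the square root of [bdf], [h] the hyperbolic density and [c] a component of the
    square integrable factor. The left side is [|c| s^3 h], bounded by [(|c|^2 + s^6) h], and
    [s^6 h] is at most 4. So [x^{1/2} L^2] is integrable against the Santalo weight. *)
Lemma xhalf_weight_bound (s h c r : R) : 0 <= s -> s ^+ 2 = (1 - r) / (1 + r) -> 0 <= r < 1 ->
  h = 4 / (1 - r) ^+ 2 -> `|s * c| * ((1 - r) / (1 + r) * h) <= c ^+ 2 * h + 4.
Proof.
move=> s0 s2 /andP[r0 r1] hE.
have h0 : 0 < h by rewrite hE divr_gt0// exprn_gt0// subr_gt0.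
have s6 : s ^+ 6 * h <= 4.
  rewrite (_ : s ^+ 6 = (s ^+ 2) ^+ 3); last by rewrite -exprM.
  rewrite s2 hE expr_div_n (_ : _ * _ = 4 * ((1 - r) / (1 + r) ^+ 3)); last first.
    by field; rewrite ?lt0r_neq0 ?subr_gt0//; lra.
  rewrite ler_piMr// ler_pdivrMr ?exprn_gt0 ?mul1r; try lra.
  by apply: (@le_trans _ _ 1); [lra|rewrite exprn_ege1//; lra].
rewrite -s2 normrM (ger0_norm s0); apply: (@le_trans _ _ (`|c| ^+ 2 * h + s ^+ 6 * h)); last first.
  by rewrite real_normK ?num_real// lerD2l.
rewrite -subr_ge0; have := sqr_ge0 (`|c| - s ^+ 3).
have := mulr_ge0 (normr_ge0 c) (exprn_ge0 3 s0).
move: (`|c|) => d; rewrite (_ : s ^+ 6 = (s ^+ 3) ^+ 2); last by rewrite -exprM.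
move=> h1 h2; rewrite (_ : _ - _ = ((d - s ^+ 3) ^+ 2 + d * s ^+ 3) * h); last by ring.
by rewrite mulr_ge0// ?addr_ge0// ltW.
Qed.

Let bound (v : R * R -> R) : measurable_fun setT v -> (forall p, v p ^+ 2 <= csq (u p)) ->
  (\int[mu2]_(z in @Disk R) (`|Num.sqrt (bdf z) * v z| * (bdf z * hypdens z))%:E < +oo)%E.
Proof.
move=> mv vu; have [[_ _] Lu] := L2u; have mD := @measurable_disk R.
have mh : measurable_fun setT (@hypdens R) by rewrite /hypdens /r2; mfun.
have mb : measurable_fun setT (@bdf R) by rewrite /bdf /r2; mfun.
have msq : measurable_fun setT (fun z => csq (u z)) by have := mre; have := mim => m1 m2; rewrite /csq; mfun.
have r20 (z : R * R) : 0 <= r2 z by rewrite addr_ge0 ?sqr_ge0.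
have h0 (z : R * R) : 0 <= hypdens z by rewrite /hypdens divr_ge0 ?sqr_ge0.
have q0 (z : R * R) : 0 <= csq (u z) by rewrite /csq addr_ge0 ?sqr_ge0.
have b0 (z : R * R) : Disk z -> 0 <= bdf z.
  by rewrite /Disk/= => dz; rewrite /bdf divr_ge0 ?subr_ge0 ?(ltW dz)// addr_ge0.
apply: (@le_lt_trans _ _ (\int[mu2]_(z in @Disk R) ((csq (u z) * hypdens z)%:E + 4%:E))%E).
  apply: ge0_le_integral => //.
  - by move=> z dz; rewrite lee_fin; apply: mulr_ge0 => //; apply: mulr_ge0 => //; exact: b0.
  - apply: measurable_funTS; apply/measurable_EFinP; apply: measurable_funM; last by mfun.
    by apply: measurableT_comp => //; mfun.
  - by apply: measurable_funTS; rewrite /=; under eq_fun do rewrite -EFinD; apply/measurable_EFinP; mfun.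
  move=> z dz; rewrite -EFinD lee_fin.
  apply: (@le_trans _ _ (v z ^+ 2 * hypdens z + 4)); last by rewrite lerD2r ler_wpM2r.
  apply: (@xhalf_weight_bound _ _ _ (r2 z)) => //; rewrite ?r20 ?sqrtr_ge0//.
  by rewrite sqr_sqrtr ?b0.
rewrite ge0_integralD//; last 2 first.
- by move=> z _; rewrite lee_fin mulr_ge0.
- by apply: measurable_funTS; apply/measurable_EFinP; mfun.
rewrite lte_add_pinfty// integral_cst//; apply: lte_mul_pinfty => //; exact: lebesgue_Disk_lty.
Qed.

Lemma xhalf_re_lty : (\int[mu2]_(z in @Disk R) (`|cre (xhalf z)| * (bdf z * hypdens z))%:E < +oo)%E.
Proof.
under eq_integral do rewrite creM /= mul0r subr0.
by apply: bound => // p; rewrite /csq lerDl sqr_ge0.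
Qed.

Lemma xhalf_im_lty : (\int[mu2]_(z in @Disk R) (`|cim (xhalf z)| * (bdf z * hypdens z))%:E < +oo)%E.
Proof.
under eq_integral do rewrite cimM /= mul0r addr0.
by apply: bound => // p; rewrite /csq lerDr sqr_ge0.
Qed.

End XhalfL2D.

Definition fbasis (m j : nat) (x : R * R) : C :=
  expi (m%:R * gam x.1 x.2) * Complex (cosca x.2 ^+ 2 * sinca x.2 ^+ j) 0.

Lemma I0_xhalf (f : R * R -> C) : xhalfL2D f -> exists2 v, cmeas v & forall x, I0 f x = J0 v (gam x.1 x.2) x.2.
Proof.
move=> [u [L2u fu]]; exists (xhalf u); first exact: cmeas_xhalf.
by move=> [b a]; apply: I0_J0 => //; exact: cmeas_xhalf.
Qed.

Lemma cmeas_J0 (v : R * R -> C) : cmeas v -> cmeas (fun x => J0 v (gam x.1 x.2) x.2).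
Proof. by move=> [m1 m2]; split; [exact: (measurable_rrayint m1)|exact: (measurable_rrayint m2)]. Qed.

Lemma cmeas_I0 (f : R * R -> C) : xhalfL2D f -> cmeas (I0 f).
Proof. by move=> /I0_xhalf[v /cmeas_J0 mv E]; rewrite (_ : I0 f = (fun x => J0 v (gam x.1 x.2) x.2))//; exact/funext. Qed.

Lemma J0_2pi (v : R * R -> C) g a : J0 v (g + 2 * pi) a = J0 v g a.
Proof. by rewrite /J0; congr cint; apply/funext => t; rewrite kpoint2pi. Qed.

Lemma I0_periodic (f : R * R -> C) : xhalfL2D f -> beta_periodic (I0 f).
Proof.
move=> /I0_xhalf[v _ E] b a; rewrite !E.
have -> : gam (b + 2 * pi) a = gam b a + 2 * pi by rewrite /gam; ring.
exact: J0_2pi.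
Qed.

(** The real and imaginary parts of both pairings are combinations of real ridge pairings with the
    phases [0] and [- (pi / 2)], that is, cosine and sine. *)
Lemma I0_fbasis (f : R * R -> C) m j : xhalfL2D f -> (j < m)%N ->
  ipGH (I0 f) (fbasis m j) = 0 /\ ipGH (I0 f) (fun x => (fbasis m j x)^*%C) = 0.
Proof.
move=> [u [L2u fu]] jm; have [m1 m2] := cmeas_xhalf L2u.
have E : I0 f = (fun x => Complex (rrayint (fun z => cre (xhalf u z)) x) (rrayint (fun z => cim (xhalf u z)) x)).
  by apply/funext => -[b a]; rewrite (@I0_J0 _ _ (xhalf u))//; exact: cmeas_xhalf.
have mG : measurable (GH : set (measurableTypeR R * measurableTypeR R)) by exact: measurable_GH.
have i1 := integrable_rrayint m1 (xhalf_re_lty L2u) m j 0.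
have i2 := integrable_rrayint m1 (xhalf_re_lty L2u) m j (- (pi / 2)).
have i3 := integrable_rrayint m2 (xhalf_im_lty L2u) m j 0.
have i4 := integrable_rrayint m2 (xhalf_im_lty L2u) m j (- (pi / 2)).
have z1 := Rintegral_rrayint m1 (xhalf_re_lty L2u) 0 jm.
have z2 := Rintegral_rrayint m1 (xhalf_re_lty L2u) (- (pi / 2)) jm.
have z3 := Rintegral_rrayint m2 (xhalf_im_lty L2u) 0 jm.
have z4 := Rintegral_rrayint m2 (xhalf_im_lty L2u) (- (pi / 2)) jm.
move: i1 i2 i3 i4 z1 z2 z3 z4.
set r := rrayint _; set s := rrayint _ => i1 i2 i3 i4 z1 z2 z3 z4.
have w0 x : ridgewt m j 0 x = cosca x.2 ^+ 2 * (cos (m%:R * gam x.1 x.2) * sinca x.2 ^+ j).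
  by rewrite /ridgewt addr0.
have w1 x : ridgewt m j (- (pi / 2)) x = cosca x.2 ^+ 2 * (sin (m%:R * gam x.1 x.2) * sinca x.2 ^+ j).
  by rewrite /ridgewt cosBpihalf.
rewrite E; split; apply: cplx_eq; rewrite /= /leb2 /leb1.
- transitivity (Rintegral mu2 GH (fun x => r x * ridgewt m j 0 x + s x * ridgewt m j (- (pi / 2)) x)).
    by apply: eq_Rintegral => x _; rewrite w0 w1 /fbasis /expi /=; rewrite -/r -/s; ring.
  by rewrite (RintegralD mG i1 i4) z1 z4 addr0.
- transitivity (Rintegral mu2 GH (fun x => s x * ridgewt m j 0 x - r x * ridgewt m j (- (pi / 2)) x)).
    by apply: eq_Rintegral => x _; rewrite w0 w1 /fbasis /expi /=; rewrite -/r -/s; ring.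
  by rewrite (RintegralB mG i3 i2) z2 z3 subr0.
- transitivity (Rintegral mu2 GH (fun x => r x * ridgewt m j 0 x - s x * ridgewt m j (- (pi / 2)) x)).
    by apply: eq_Rintegral => x _; rewrite w0 w1 /fbasis /expi /=; rewrite -/r -/s; ring.
  by rewrite (RintegralB mG i1 i4) z1 z4 subr0.
transitivity (Rintegral mu2 GH (fun x => s x * ridgewt m j 0 x + r x * ridgewt m j (- (pi / 2)) x)).
  by apply: eq_Rintegral => x _; rewrite w0 w1 /fbasis /expi /=; rewrite -/r -/s; ring.
by rewrite (RintegralD mG i3 i2) z2 z3 addr0.
Qed.

End RidgeOrthogonality.

(** * Explicit transforms *)

Section ComplexFTC.
Variable R : realType.
Local Notation C := (R[i]).
Local Notation mu := (@lebesgue_measure R).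
Implicit Types (t a : R).

Lemma cvgy_expR : @expR R t @[t --> +oo] --> +oo.
Proof.
apply/cvgryPge => A; near=> t; apply: (@le_trans _ _ (1 + t)); last exact: expR_ge1Dx.
rewrite (@le_trans _ _ t) ?lerDr//; near: t; by apply: nbhs_pinfty_ge; rewrite num_real.
Unshelve. all: by end_near. Qed.

(** The function [2 * atan (expR t)] has derivative [sech t] and maps the line onto []0, pi[]. *)
Lemma integrable_sech : mu.-integrable setT (EFin \o @sech R).
Proof.
have cs := @continuous_sech R.
apply/integrableP; split; first by apply/measurable_EFinP; exact: continuous_measurable_fun.
under eq_integral do rewrite /= ger0_norm ?(ltW (sech_gt0 _))//.
have dphi (t : R) : is_derive t (1:R) (fun t => 2 * atan (expR t)) (sech t).
  have d := @is_derive1_comp _ (@atan R) (@expR R) t _ _ (is_derive1_atan (expR t)) (is_derive_expR t).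
  apply: is_derive_eq (is_deriveZ 2 d) _; rewrite /GRing.scale/= /sech expRN.
  have := expR_gt0 t; set e := expR t => e0.
  have e1 : e != 0 by rewrite lt0r_neq0.
  have e2 : e * e + 1 != 0 by rewrite lt0r_neq0//; nra.
  have e3 : 1 + e * e != 0 by rewrite addrC.
  by field; rewrite ?e1 ?e2 ?e3.
have phir : 2 * atan (expR t) @[t --> +oo] --> (pi : R).
  rewrite [X in _ --> X](_ : _ = 2 * (pi / 2)); last by field.
  apply: cvgM; first exact: cvg_cst.
  by apply: (cvg_comp (@expR R) (@atan R)); [exact: cvgy_expR|exact: cvgy_atan].
have phil : 2 * atan (expR t) @[t --> -oo] --> (0 : R).
  rewrite [X in _ --> X](_ : _ = 2 * atan 0); last by rewrite atan0 mulr0.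
  apply: cvgM; first exact: cvg_cst.
  apply: (cvg_comp (@expR R) (@atan R)); last exact: continuous_atan.
  by apply/cvgNy_compNP; exact: cvgr_expR.
have -> : (\int[mu]_x (sech x)%:E = \int[mu]_(x in `]0%R, pi[) 1)%E.
  rewrite (ge0_integral_substitution dphi (@sech_gt0 R) cs phir phil (g := fun=> 1%E))//.
  by apply: eq_integral => x _; rewrite mul1e.
have m0 : mu `]0%R, pi[ = pi%:E by rewrite lebesgue_measure_itv/= lte_fin pi_gt0 -EFinB subr0.
by rewrite integral_cst// mul1e; apply: (@le_lt_trans _ _ pi%:E); [rewrite -m0|exact: ltry].
Qed.

Section RealFTC.
Variables (F f : R -> R) (K l0 l1 : R).
Hypotheses (dF : forall t, is_derive t (1:R) F (f t)) (cf : continuous f)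
  (fK : forall t, `|f t| <= K * sech t)
  (F1 : F t @[t --> +oo] --> l1) (F0 : F t @[t --> -oo] --> l0).

Let mf : measurable_fun setT f. Proof. exact: continuous_measurable_fun. Qed.

Let iKs : mu.-integrable setT (EFin \o (fun t => K * sech t)).
Proof.
rewrite (_ : _ \o _ = (fun t => K%:E * (EFin \o @sech R) t)%E)//.
by apply: integrableZl => //; exact: integrable_sech.
Qed.

Lemma integrable_dom_sech : mu.-integrable setT (EFin \o f).
Proof.
apply: le_integrable iKs => //; first exact/measurable_EFinP.
by move=> t _; rewrite /= lee_fin (le_trans (fK t))// ler_norm.
Qed.

(** The fundamental theorem on [[-n, n]], followed by dominated convergence with the bound
    [K * sech]. *)
Lemma Rintegral_FTC : Rintegral mu setT f = l1 - l0.
Proof.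
pose g n t := (f \_ `[- n%:R, n%:R]%classic) t.
have mg n : measurable_fun setT (EFin \o g n).
  apply/measurable_EFinP; rewrite /g.
  by apply/(measurable_restrictT f (measurable_itv _)); exact: measurable_funTS.
have gf t : setT t -> (EFin \o g n) t @[n --> \oo] --> (f t)%:E.
  move=> _; apply: cvg_near_cst; near=> n.
  rewrite /= /g patchE mem_set//= in_itv/= -ler_norml; near: n; exact: nbhs_infty_ger.
have gK n t : setT t -> (`|(EFin \o g n) t| <= (K * sech t)%:E)%E.
  move=> _; rewrite /= lee_fin /g patchE; case: ifP => _ //.
  by rewrite normr0 (le_trans _ (fK t)).
have L : (\int[mu]_x (EFin \o g n) x)%E @[n --> \oo] --> (\int[mu]_t (f t)%:E)%E.
  by apply: (@dominated_cvg _ (measurableTypeR R) R mu setT measurableT (fun n => EFin \o g n) (EFin \o f) (EFin \o (fun t => K * sech t))).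
(* The index is [n.+1] because the interval must be nondegenerate. *)
have E n : (\int[mu]_x (EFin \o g n.+1) x = (F n.+1%:R - F (- n.+1%:R))%:E)%E.
  have n0 : - n.+1%:R < n.+1%:R :> R by rewrite -subr_gt0 opprK addr_gt0.
  have cF : continuous F.
    by move=> x; apply: differentiable_continuous; apply/derivable1_diffP; have [] := dF x.
  rewrite EFinB -(@continuous_FTC2 R f F)//.
  - by rewrite [RHS]integral_mkcond; apply: eq_integral => x _; rewrite /g/= !patchE; case: ifP.
  - exact: continuous_subspaceT.
  - split; [move=> x _; by have [] := dF x|apply: cvg_at_right_filter|apply: cvg_at_left_filter]; exact: cF.
  - by move=> x _; rewrite derive1E; apply: derive_val.
have L1 : F n%:R - F (- n%:R) @[n --> \oo] --> l1 - l0.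
  apply: cvgB; first exact: (cvg_comp _ _ (@cvgr_idn R) F1).
  apply: (cvg_comp (fun n => - n%:R) F); last exact: F0.
  apply/cvgrNyPle => A; near=> n; rewrite lerNl; near: n; exact: nbhs_infty_ger.
have L2 : (\int[mu]_x (EFin \o g n) x)%E @[n --> \oo] --> (l1 - l0)%:E.
  have EL : (F n%:R - F (- n%:R))%:E @[n --> \oo] --> (l1 - l0)%:E.
    by apply: cvg_EFin; [exact: nearW|exact: L1].
  apply: cvg_trans EL; apply: near_eq_cvg; near=> n.
  have n0 : (0 < n)%N by near: n; exists 1%N.
  by rewrite -(prednK n0) E.
by rewrite /Rintegral (cvg_unique _ L L2).
Unshelve. all: by end_near. Qed.

End RealFTC.
(** Limits and derivatives of complex functions are taken on components, so that the real theory
    applies to each of them. *)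
Definition ccvg {T : Type} (F : set_system T) (w : T -> C) (l : C) :=
  cre (w x) @[x --> F] --> cre l /\ cim (w x) @[x --> F] --> cim l.

Section Ccvg.
Variables (T : Type) (F : set_system T).
Context {FF : Filter F}.
Implicit Types (v w : T -> C) (k l : C).

Lemma ccvg_cst l : ccvg F (fun=> l) l.
Proof. by split; exact: cvg_cst. Qed.

Lemma ccvgD v w k l : ccvg F v k -> ccvg F w l -> ccvg F (fun x => v x + w x) (k + l).
Proof.
move=> [v1 v2] [w1 w2]; split.
  by under eq_fun do rewrite creD; rewrite creD; exact: cvgD.
by under eq_fun do rewrite cimD; rewrite cimD; exact: cvgD.
Qed.

Lemma ccvgM v w k l : ccvg F v k -> ccvg F w l -> ccvg F (fun x => v x * w x) (k * l).
Proof.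
move=> [v1 v2] [w1 w2]; split.
  by under eq_fun do rewrite creM; rewrite creM; apply: cvgB; exact: cvgM.
by under eq_fun do rewrite cimM; rewrite cimM; apply: cvgD; exact: cvgM.
Qed.

Lemma ccvg_horner (Q : {poly C}) w l : ccvg F w l -> ccvg F (fun x => Q.[w x]) Q.[l].
Proof.
move=> wl; elim/poly_ind: Q => [|Q c IH].
  by under eq_fun do rewrite horner0; rewrite horner0; exact: ccvg_cst.
under eq_fun do rewrite hornerMXaddC; rewrite hornerMXaddC.
by apply: ccvgD; [exact: ccvgM|exact: ccvg_cst].
Qed.

End Ccvg.

Definition is_cderive (w : R -> C) t (d : C) :=
  is_derive t (1:R) (fun s => cre (w s)) (cre d) /\ is_derive t (1:R) (fun s => cim (w s)) (cim d).

Lemma is_cderiveM v w t dv dw : is_cderive v t dv -> is_cderive w t dw ->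
  is_cderive (fun s => v s * w s) t (v t * dw + dv * w t).
Proof.
move=> [v1 v2] [w1 w2]; split.
  under eq_fun do rewrite creM.
  apply: is_derive_eq (is_deriveB (is_deriveM v1 w1) (is_deriveM v2 w2)) _.
  by rewrite !cE /GRing.scale/=; ring.
under eq_fun do rewrite cimM.
apply: is_derive_eq (is_deriveD (is_deriveM v1 w2) (is_deriveM v2 w1)) _.
by rewrite !cE /GRing.scale/=; ring.
Qed.

Lemma is_cderiveDc w t d c : is_cderive w t d -> is_cderive (fun s => w s + c) t d.
Proof.
move=> [w1 w2]; split.
  under eq_fun do rewrite creD.
  by apply: is_derive_eq (is_deriveD w1 (is_derive_cst (cre c) t 1)) _; rewrite addr0.
under eq_fun do rewrite cimD.
by apply: is_derive_eq (is_deriveD w2 (is_derive_cst (cim c) t 1)) _; rewrite addr0.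
Qed.

Lemma is_cderive_cst c t : is_cderive (fun=> c) t 0.
Proof. by split; exact: is_derive_cst. Qed.

Lemma is_cderive_horner (Q : {poly C}) w t d : is_cderive w t d ->
  is_cderive (fun s => Q.[w s]) t (Q^`().[w t] * d).
Proof.
move=> wd; elim/poly_ind: Q => [|Q c IH].
  under eq_fun do rewrite horner0; rewrite deriv0 horner0 mul0r; exact: is_cderive_cst.
under eq_fun do rewrite hornerMXaddC.
rewrite derivMXaddC hornerD hornerMX mulrDl; apply: is_cderiveDc.
rewrite -mulrA [w t * d]mulrC mulrA; exact: is_cderiveM.
Qed.

Definition cintegrable (f : R -> C) :=
  mu.-integrable setT (EFin \o (fun t => cre (f t))) /\
  mu.-integrable setT (EFin \o (fun t => cim (f t))).

Lemma csq_bound (z : C) (K : R) : 0 <= K -> csq z <= K ^+ 2 -> `|cre z| <= K /\ `|cim z| <= K.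
Proof.
move=> K0 zK; split; rewrite -(ler_pXn2r (n := 2)) ?nnegrE// real_normK ?num_real//.
  by rewrite (le_trans _ zK)// lerDl sqr_ge0.
by rewrite (le_trans _ zK)// lerDr sqr_ge0.
Qed.

Lemma cintegrable_sech (f : R -> C) (K : R) : 0 <= K -> (forall t, ccvg (nbhs t) f (f t)) ->
  (forall t, csq (f t) <= (K * sech t) ^+ 2) -> cintegrable f.
Proof.
move=> K0 cf fK.
have h t : `|cre (f t)| <= K * sech t /\ `|cim (f t)| <= K * sech t.
  by apply: csq_bound (fK t); rewrite mulr_ge0// ltW// sech_gt0.
split; apply: (@integrable_dom_sech _ K).
- by move=> t; have [] := cf t.
- by move=> t; have [] := h t.
- by move=> t; have [] := cf t.
- by move=> t; have [] := h t.
Qed.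

Let iZ (k : R) (f : R -> R) : mu.-integrable setT (EFin \o f) -> mu.-integrable setT (EFin \o (fun t => k * f t)).
Proof.
move=> fi; rewrite (_ : _ \o _ = (fun t => k%:E * (EFin \o f) t)%E)//.
exact: integrableZl.
Qed.

Let iD (f g : R -> R) : mu.-integrable setT (EFin \o f) -> mu.-integrable setT (EFin \o g) ->
  mu.-integrable setT (EFin \o (fun t => f t + g t)).
Proof.
move=> fi gi; rewrite (_ : _ \o _ = (fun t => (EFin \o f) t + (EFin \o g) t)%E)//.
exact: integrableD.
Qed.

Let iB (f g : R -> R) : mu.-integrable setT (EFin \o f) -> mu.-integrable setT (EFin \o g) ->
  mu.-integrable setT (EFin \o (fun t => f t - g t)).
Proof.
move=> fi gi; rewrite (_ : _ \o _ = (fun t => (EFin \o f) t - (EFin \o g) t)%E)//.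
exact: integrableB.
Qed.

Lemma cintZ (c : C) (f : R -> C) : cintegrable f -> cint (fun t => c * f t) = c * cint f.
Proof.
move=> [f1 f2]; apply: cplx_eq; rewrite /= ?cE /=.
  transitivity (Rintegral mu setT (fun t => cre c * cre (f t) - cim c * cim (f t))).
    by apply: eq_Rintegral => t _; rewrite creM.
  by rewrite RintegralB// ?RintegralZl//; exact: iZ.
transitivity (Rintegral mu setT (fun t => cre c * cim (f t) + cim c * cre (f t))).
  by apply: eq_Rintegral => t _; rewrite cimM.
by rewrite RintegralD// ?RintegralZl//; exact: iZ.
Qed.

Lemma cintegrableZ (c : C) (f : R -> C) : cintegrable f -> cintegrable (fun t => c * f t).
Proof.
move=> [f1 f2]; split.
  by under eq_fun do rewrite creM; apply: iB; exact: iZ.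
by under eq_fun do rewrite cimM; apply: iD; exact: iZ.
Qed.

Lemma cint_sum (I : Type) (r : seq I) (f : I -> R -> C) : (forall i, cintegrable (f i)) ->
  cintegrable (fun t => \sum_(i <- r) f i t) /\
  cint (fun t => \sum_(i <- r) f i t) = \sum_(i <- r) cint (f i).
Proof.
move=> fi; elim: r => [|i r [[i1 i2] IH]].
  under eq_fun do rewrite big_nil; rewrite big_nil; split.
    by split; exact: integrable0.
  by apply: cplx_eq; rewrite /= /Rintegral integral0_eq.
have [f1 f2] := fi i.
under eq_fun do rewrite big_cons; rewrite big_cons -IH; split.
  by split; [under eq_fun do rewrite creD|under eq_fun do rewrite cimD]; exact: iD.
apply: cplx_eq; rewrite cE /=.
  by under eq_Rintegral do rewrite creD; rewrite RintegralD.
by under eq_Rintegral do rewrite cimD; rewrite RintegralD.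
Qed.

Lemma cint_FTC (Q : {poly C}) (w dw : R -> C) (l0 l1 : C) (K : R) : 0 <= K ->
  (forall t, is_cderive w t (dw t)) -> (forall t, ccvg (nbhs t) dw (dw t)) ->
  (forall t, csq (Q^`().[w t] * dw t) <= (K * sech t) ^+ 2) ->
  ccvg (pinfty_nbhs R) w l1 -> ccvg (ninfty_nbhs R) w l0 ->
  cint (fun t => Q^`().[w t] * dw t) = Q.[l1] - Q.[l0].
Proof.
move=> K0 dwd cdw bd w1 w0.
have h t : `|cre (Q^`().[w t] * dw t)| <= K * sech t /\ `|cim (Q^`().[w t] * dw t)| <= K * sech t.
  by apply: csq_bound (bd t); rewrite mulr_ge0// ltW// sech_gt0.
have cw t : ccvg (nbhs t) w (w t).
  by have [d1 d2] := dwd t; split; apply: differentiable_continuous; apply/derivable1_diffP; [case: d1|case: d2].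
have cd t : ccvg (nbhs t) (fun t => Q^`().[w t] * dw t) (Q^`().[w t] * dw t).
  by apply: ccvgM => //; exact: ccvg_horner.
have [e1 f1] := ccvg_horner Q w1; have [e0 f0] := ccvg_horner Q w0.
apply: cplx_eq; rewrite cE.
  apply: (Rintegral_FTC (F := fun t => cre Q.[w t]) (K := K)) => // t.
  - by have [] := is_cderive_horner Q (dwd t).
  - by have [] := cd t.
  - by have [] := h t.
apply: (Rintegral_FTC (F := fun t => cim Q.[w t]) (K := K)) => // t.
- by have [] := is_cderive_horner Q (dwd t).
- by have [] := cd t.
- by have [] := h t.
Qed.

Lemma exists_antideriv (F : numFieldType) (p : {poly F}) : exists q : {poly F}, q^`() = p.
Proof.
exists (\poly_(i < (size p).+1) (p`_i.-1 / i%:R)); apply/polyP => i.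
rewrite coef_deriv coef_poly ltnS /= -[RHS]mul1r.
case: ltnP => [_|/(nth_default 0) ->]; last by rewrite mul0rn mulr0.
by rewrite mul1r -(mulr_natr (p`_i / i.+1%:R)) divfK// pnatr_eq0.
Qed.

End ComplexFTC.

(** * Closed forms of the tensor and function transforms *)

Section ExplicitTransforms.
Variable R : realType.
Local Notation C := (R[i]).
Local Notation mu := (@lebesgue_measure R).
Implicit Types (t a b g : R).

Lemma cvgy_sech : @sech R t @[t --> +oo] --> (0:R).
Proof.
have h : 2 * expR (- t) @[t --> +oo] --> (0 : R).
  by rewrite -[X in _ --> X](mulr0 2); apply: cvgM; [exact: cvg_cst|exact: cvgr_expR].
apply: (squeeze_cvgr _ (cvg_cst 0) h); near=> t; rewrite (ltW (sech_gt0 t))/= /sech.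
have e0 := expR_gt0 t; rewrite ler_wpM2l// expRN lef_pV2 ?posrE ?addr_gt0 ?invr_gt0//.
by rewrite lerDl invr_ge0 ltW.
Unshelve. all: by end_near. Qed.

Lemma cvgNy_sech : @sech R t @[t --> -oo] --> (0:R).
Proof.
apply/cvgNy_compNP; rewrite (_ : _ \o _ = @sech R); first exact: cvgy_sech.
by apply/funext => t /=; rewrite sechN.
Qed.

(** [kcrd] and [vcrd] follow the same unrotated geodesic in the Klein and in the Poincare model;
    [dkcrd] and [dvcrd] are their time derivatives. *)
Definition kcrd a t : C := Complex (- sinca a) (cosca a * tanhR t).
Definition vcrd a t : C :=
  Complex (- sinca a / (1 + cosca a * sech t)) (cosca a * tanhR t / (1 + cosca a * sech t)).
Definition dkcrd a t : C := Complex 0 (cosca a * sech t ^+ 2).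
Definition dvcrd a t : C :=
  Complex (- (sinca a * cosca a * sech t * tanhR t) / (1 + cosca a * sech t) ^+ 2)
          (cosca a * sech t * (sech t + cosca a) / (1 + cosca a * sech t) ^+ 2).

Lemma cosca_sech_gt0 a t : 0 < cosca a * sech t.
Proof. by rewrite mulr_gt0 ?cosca_gt0 ?sech_gt0. Qed.

Let D0 a t : 1 + cosca a * sech t != 0.
Proof. by rewrite lt0r_neq0// addr_gt0 ?cosca_sech_gt0. Qed.

Lemma is_cderive_kcrd a t : is_cderive (kcrd a) t (dkcrd a t).
Proof.
split; first by apply: is_derive_cst.
by apply: is_derive_eq (is_deriveZ (cosca a) (is_derive_tanhR t)) _.
Qed.

Lemma is_cderive_vcrd a t : is_cderive (vcrd a) t (dvcrd a t).
Proof.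
have d1 : is_derive t (1:R) (fun t => 1 + cosca a * sech t) (cosca a * (- sech t * tanhR t)).
  by apply: is_derive_eq (is_deriveD (is_derive_cst (1:R) t 1) (is_deriveZ (cosca a) (is_derive_sech t))) _; rewrite add0r.
have dV := is_deriveV (f := fun t => 1 + cosca a * sech t) (D0 a t) d1.
split.
  by apply: is_derive_eq (is_deriveZ (- sinca a) dV) _; rewrite /= /GRing.scale/=; field.
apply: is_derive_eq (is_deriveM (is_deriveZ (cosca a) (is_derive_tanhR t)) dV) _.
rewrite /= /GRing.scale/=.
rewrite (_ : sech t + cosca a = sech t + cosca a * (sech t ^+ 2 + tanhR t ^+ 2)); first by field.
by rewrite sqr_sech subrK mulr1.
Qed.

(* The geodesic equation is the Riccati equation [v' = odepoly.[v]], with the endpoints as zeros. *)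
Definition odepoly a : {poly C} :=
  Complex 0 (- (2 * cosca a)^-1) *:
    (('X + (Complex (sinca a) (cosca a))%:P) * ((Complex (- sinca a) (cosca a))%:P - 'X)).

Let c0 a : cosca a != 0. Proof. by rewrite lt0r_neq0// cosca_gt0. Qed.

(** The straight chord follows the same Riccati field along its own direction, at twice the speed;
    this is the origin of the powers of 1/2 in the transforms. *)
Lemma odepoly_kcrd a t : (odepoly a).[kcrd a t] = Complex 2^-1 0 * dkcrd a t.
Proof.
rewrite /odepoly !hornerE; apply: cplx_eq; rewrite !cE /=; last rewrite sqr_sech.
  by field; rewrite c0.
by field; rewrite c0.
Qed.

Lemma odepoly_vcrd a t : (odepoly a).[vcrd a t] = dvcrd a t.
Proof.
rewrite /odepoly !hornerE; apply: cplx_eq; rewrite !cE /=; first by field; rewrite c0 D0.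
set s := sinca a; set c := cosca a; set S := sech t; set T := tanhR t.
have D1 : 1 + c * S != 0 by exact: D0.
have h : s ^+ 2 * S ^+ 2 + (1 + c * S) ^+ 2 - T ^+ 2 = 2 * S * (S + c).
  have -> : T ^+ 2 = 1 - S ^+ 2 by rewrite /S sqr_sech subKr.
  by rewrite /s sqr_sinca -/c; ring.
transitivity (c * (s ^+ 2 * S ^+ 2 + (1 + c * S) ^+ 2 - T ^+ 2) / 2 / (1 + c * S) ^+ 2).
  by field; rewrite D1 c0.
by rewrite h; field.
Qed.

Lemma csqX (z : C) n : csq (z ^+ n) = csq z ^+ n.
Proof.
elim: n => [|n IH]; first by rewrite !expr0 /csq /= expr1n expr0n addr0.
by rewrite !exprS csqM IH.
Qed.

Let s2 a : sinca a ^+ 2 <= 1.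
Proof. by rewrite sqr_sinca lerBlDr lerDl sqr_ge0. Qed.

Let c2 a : cosca a ^+ 2 <= 1.
Proof. by rewrite exprn_ile1 ?cosca_le1// ltW ?cosca_gt0. Qed.

Let sc2 a : sinca a ^+ 2 + cosca a ^+ 2 = 1.
Proof. by rewrite sqr_sinca subrK. Qed.

Lemma csq_kcrd a t : csq (kcrd a t) <= 1.
Proof.
rewrite /csq /= sqrrN exprMn -[leRHS](sc2 a) lerD2l ler_piMr ?sqr_ge0//.
exact/ltW/sqr_tanhR_lt1.
Qed.

Lemma csq_vcrd a t : csq (vcrd a t) <= 1.
Proof.
apply: le_trans (csq_kcrd a t); rewrite /csq /= !expr_div_n -mulrDl ler_piMr ?addr_ge0 ?sqr_ge0//.
by rewrite invf_le1 ?exprn_gt0 ?addr_gt0 ?cosca_sech_gt0// exprn_ege1// lerDl ltW ?cosca_sech_gt0.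
Qed.

Lemma csq_dkcrd a t : csq (dkcrd a t) <= sech t ^+ 2.
Proof.
rewrite /csq /= expr0n add0r exprMn (le_trans (ler_wpM2r _ (c2 a))) ?sqr_ge0// mul1r.
by rewrite -exprM ler_wiXn2l// ?sech_le1// ltW ?sech_gt0.
Qed.

(** The numerator is [sech t ^+ 2] times at most [1 + 4], which the round constant [3 ^+ 2]
    exceeds. *)
Lemma csq_dvcrd a t : csq (dvcrd a t) <= (3 * sech t) ^+ 2.
Proof.
have S0 := sech_gt0 t; have S1 := sech_le1 t; have C0 := cosca_gt0 a; have C1 := cosca_le1 a.
have T1 := sqr_tanhR_lt1 t; have D1 : 1 <= (1 + cosca a * sech t) ^+ 4.
  by rewrite exprn_ege1// lerDl ltW ?cosca_sech_gt0.
rewrite /csq /= !expr_div_n -mulrDl -exprM ler_pdivrMr; last exact: lt_le_trans D1.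
apply: (@le_trans _ _ ((3 * sech t) ^+ 2 * 1)); last by rewrite ler_wpM2l ?sqr_ge0.
rewrite mulr1 sqrrN.
rewrite (_ : _ + _ = sech t ^+ 2 * (cosca a ^+ 2 * (sinca a ^+ 2 * tanhR t ^+ 2 + (sech t + cosca a) ^+ 2))); last by ring.
rewrite [leRHS]exprMn [leRHS]mulrC ler_wpM2l ?sqr_ge0//.
have e0 : 0 <= sinca a ^+ 2 * tanhR t ^+ 2 + (sech t + cosca a) ^+ 2.
  by rewrite -exprMn addr_ge0 ?sqr_ge0.
rewrite (le_trans (ler_wpM2r e0 (c2 a)))// mul1r.
have h1 : sinca a ^+ 2 * tanhR t ^+ 2 <= 1.
  by rewrite (le_trans (ler_wpM2r _ (s2 a))) ?sqr_ge0// mul1r ltW.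
nra.
Qed.

Let ccreal (T : Type) (F : set_system T) {FF : Filter F} (f g : T -> R) k l :
  f x @[x --> F] --> k -> g x @[x --> F] --> l -> ccvg F (fun x => Complex (f x) (g x)) (Complex k l).
Proof. by []. Qed.

Lemma ccvg_kcrd a : ccvg (pinfty_nbhs R) (kcrd a) (Complex (- sinca a) (cosca a)).
Proof.
apply: ccreal; first exact: cvg_cst.
rewrite -[X in _ --> X]mulr1; apply: cvgM; [exact: cvg_cst|exact: cvgy_tanhR].
Qed.

Lemma ccvgN_kcrd a : ccvg (ninfty_nbhs R) (kcrd a) (Complex (- sinca a) (- cosca a)).
Proof.
apply: ccreal; first exact: cvg_cst.
rewrite -[- cosca a]mulrN1; apply: cvgM; [exact: cvg_cst|exact: cvgNy_tanhR].
Qed.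

Let cvg_D (F : set_system R) {FF : Filter F} a : @sech R t @[t --> F] --> (0:R) ->
  (1 + cosca a * sech t)^-1 @[t --> F] --> (1:R).
Proof.
move=> h; rewrite -[X in _ --> X]invr1; apply: cvgV => //.
rewrite -[X in _ --> X]addr0; apply: cvgD; first exact: cvg_cst.
by rewrite -[X in _ --> X](mulr0 (cosca a)); apply: cvgM => //; exact: cvg_cst.
Qed.

Lemma ccvg_vcrd a : ccvg (pinfty_nbhs R) (vcrd a) (Complex (- sinca a) (cosca a)).
Proof.
have [h1 h2] := ccvg_kcrd a; have h : (1 + cosca a * sech t)^-1 @[t --> +oo] --> (1:R) by apply: cvg_D; exact: cvgy_sech.
by apply: ccreal; rewrite -[X in _ --> X]mulr1; apply: cvgM.
Qed.

Lemma ccvgN_vcrd a : ccvg (ninfty_nbhs R) (vcrd a) (Complex (- sinca a) (- cosca a)).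
Proof.
have [h1 h2] := ccvgN_kcrd a; have h : (1 + cosca a * sech t)^-1 @[t --> -oo] --> (1:R) by apply: cvg_D; exact: cvgNy_sech.
by apply: ccreal; rewrite -[X in _ --> X]mulr1; apply: cvgM.
Qed.

Lemma continuous_dkcrd a t : ccvg (nbhs t) (dkcrd a) (dkcrd a t).
Proof.
apply: ccreal; first exact: cvg_cst.
apply: cvgM; first exact: cvg_cst.
by apply: (cvg_comp (@sech R) (fun y => y ^+ 2)); [exact: continuous_sech|exact: exprn_continuous].
Qed.

Lemma continuous_dvcrd a t : ccvg (nbhs t) (dvcrd a) (dvcrd a t).
Proof.
have cS := @continuous_sech R t; have cT := @continuous_tanhR R t.
have cD : 1 + cosca a * sech t0 @[t0 --> t] --> 1 + cosca a * sech t.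
  by apply: cvgD; [exact: cvg_cst|apply: cvgM => //; exact: cvg_cst].
have cV : ((1 + cosca a * sech t0) ^+ 2)^-1 @[t0 --> t] --> ((1 + cosca a * sech t) ^+ 2)^-1.
  apply: cvgV; first by rewrite expf_neq0.
  by apply: (cvg_comp _ (fun y => y ^+ 2) cD); exact: exprn_continuous.
apply: ccreal; apply: cvgM => //.
  by apply: cvgN; apply: cvgM => //; apply: cvgM => //; exact: cvg_cst.
apply: cvgM; first by apply: cvgM => //; exact: cvg_cst.
by apply: cvgD => //; exact: cvg_cst.
Qed.

Lemma ccvg_exp (v : R -> C) n t : ccvg (nbhs t) v (v t) -> ccvg (nbhs t) (fun t => v t ^+ n) (v t ^+ n).
Proof.
move=> vt; elim: n => [|n IH].
  by under eq_fun do rewrite expr0; rewrite expr0; exact: ccvg_cst.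
by under eq_fun do rewrite exprS; rewrite exprS; exact: ccvgM.
Qed.

Lemma cderive_ccvg (w : R -> C) t d : is_cderive w t d -> ccvg (nbhs t) w (w t).
Proof.
by move=> [d1 d2]; split; apply: differentiable_continuous; apply/derivable1_diffP; [case: d1|case: d2].
Qed.

Let sechX t n : (0 < n)%N -> (sech t ^+ 2) ^+ n <= sech t ^+ 2.
Proof.
move=> n0; rewrite -[leRHS]expr1 ler_wiXn2l ?sqr_ge0//.
by rewrite exprn_ile1 ?sech_le1// ltW ?sech_gt0.
Qed.

Let bound_v a p n t : (0 < n)%N ->
  csq (vcrd a t ^+ p * dvcrd a t ^+ n) <= (3 ^+ n * sech t) ^+ 2.
Proof.
move=> n0; have S0 := ltW (sech_gt0 t).
have h1 : csq (vcrd a t) ^+ p <= 1 by rewrite exprn_ile1 ?csq_ge0 ?csq_vcrd.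
have h2 : csq (dvcrd a t) ^+ n <= ((3 * sech t) ^+ 2) ^+ n.
  by rewrite lerXn2r ?csq_dvcrd// nnegrE ?csq_ge0 ?sqr_ge0.
rewrite csqM !csqX (le_trans (ler_wpM2r _ h1)) ?exprn_ge0 ?csq_ge0// mul1r (le_trans h2)//.
have -> : ((3 * sech t) ^+ 2) ^+ n = (3 ^+ n) ^+ 2 * (sech t ^+ 2) ^+ n.
  by rewrite -!exprM exprMn [(n * 2)%N]mulnC.
by rewrite [leRHS]exprMn ler_wpM2l ?sechX// sqr_ge0.
Qed.

Let bound_k a p n t : (0 < n)%N ->
  csq (kcrd a t ^+ p * dkcrd a t ^+ n) <= (1 * sech t) ^+ 2.
Proof.
move=> n0; have S0 := ltW (sech_gt0 t).
have h1 : csq (kcrd a t) ^+ p <= 1 by rewrite exprn_ile1 ?csq_ge0 ?csq_kcrd.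
have h2 : csq (dkcrd a t) ^+ n <= (sech t ^+ 2) ^+ n.
  by rewrite lerXn2r ?csq_dkcrd// nnegrE ?csq_ge0 ?sqr_ge0.
rewrite csqM !csqX (le_trans (ler_wpM2r _ h1)) ?exprn_ge0 ?csq_ge0// !mul1r (le_trans h2)//.
exact: sechX.
Qed.

Lemma cintegrable_vcrd a p n : (0 < n)%N -> cintegrable (fun t => vcrd a t ^+ p * dvcrd a t ^+ n).
Proof.
move=> n0; apply: (@cintegrable_sech _ _ (3 ^+ n)) => [|t|t]; first exact: exprn_ge0.
  by apply: ccvgM; apply: ccvg_exp; [exact: cderive_ccvg (is_cderive_vcrd a t)|exact: continuous_dvcrd].
exact: bound_v.
Qed.

Lemma cintegrable_kcrd a p n : (0 < n)%N -> cintegrable (fun t => kcrd a t ^+ p * dkcrd a t ^+ n).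
Proof.
move=> n0; apply: (@cintegrable_sech _ _ 1) => // t.
  by apply: ccvgM; apply: ccvg_exp; [exact: cderive_ccvg (is_cderive_kcrd a t)|exact: continuous_dkcrd].
exact: bound_k.
Qed.

(* Both integrals are the increment, between the common endpoints, of an antiderivative of [X^p * odepoly^n]. *)
Lemma cint_vcrd a p n :
  cint (fun t => vcrd a t ^+ p * dvcrd a t ^+ n.+1) =
  Complex 2^-1 0 ^+ n * cint (fun t => kcrd a t ^+ p * dkcrd a t ^+ n.+1).
Proof.
have [Q dQ] := exists_antideriv ('X^p * odepoly a ^+ n).
have Ev t : (Q^`()).[vcrd a t] * dvcrd a t = vcrd a t ^+ p * dvcrd a t ^+ n.+1.
  by rewrite dQ hornerM hornerXn horner_exp odepoly_vcrd -mulrA -exprSr.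
have Ek t : (Q^`()).[kcrd a t] * dkcrd a t = Complex 2^-1 0 ^+ n * (kcrd a t ^+ p * dkcrd a t ^+ n.+1).
  by rewrite dQ hornerM hornerXn horner_exp odepoly_kcrd exprMn exprSr; ring.
have h20 : csq (Complex 2^-1 0 ^+ n : C) <= 1.
  rewrite csqX exprn_ile1 ?csq_ge0// /csq /= expr0n addr0 exprn_ile1//; lra.
rewrite -cintZ; last exact: cintegrable_kcrd.
under eq_fun do rewrite -Ev; under [in RHS]eq_fun do rewrite -Ek.
rewrite (cint_FTC (K := 3 ^+ n.+1) _ (is_cderive_vcrd a) (continuous_dvcrd a) _ (ccvg_vcrd a) (ccvgN_vcrd a)).
- rewrite (cint_FTC (K := 1) _ (is_cderive_kcrd a) (continuous_dkcrd a) _ (ccvg_kcrd a) (ccvgN_kcrd a))// => t.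
  by rewrite Ek csqM (le_trans (ler_wpM2r _ h20)) ?csq_ge0// [leLHS]mul1r bound_k.
- exact: exprn_ge0.
- by move=> t; rewrite Ev bound_v.
Qed.

Lemma zgeoE b a t : zgeo b a t = expi (gam b a) * vcrd a (t + tshift a).
Proof.
have h1 : cre (zgeo b a t) = (kpoint (gam b a) a (t + tshift a)).1 by rewrite -zgeo_kpoint.
have h2 : cim (zgeo b a t) = (kpoint (gam b a) a (t + tshift a)).2 by rewrite -zgeo_kpoint.
apply: cplx_eq; rewrite ?h1 ?h2 kpointE !cE /=; ring.
Qed.

Lemma zdotE b a t : zdot b a t = expi (gam b a) * dvcrd a (t + tshift a).
Proof.
have d1 : is_derive t (1:R) (fun s => s + tshift a) 1.
  by apply: is_derive_eq (is_deriveD (is_derive_id t 1) (is_derive_cst (tshift a) t 1)) _; rewrite addr0.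
have [v1 v2] := is_cderive_vcrd a (t + tshift a).
have w1 := @is_derive1_comp _ _ (fun s => s + tshift a) t _ _ v1 d1.
have w2 := @is_derive1_comp _ _ (fun s => s + tshift a) t _ _ v2 d1.
rewrite mulr1 in w1; rewrite mulr1 in w2.
have w : is_cderive (fun s => vcrd a (s + tshift a)) t (dvcrd a (t + tshift a)) by [].
have := is_cderiveM (is_cderive_cst (expi (gam b a)) t) w.
rewrite mul0r addr0; under eq_fun do rewrite -zgeoE; move=> [e1 e2].
by apply: cplx_eq; rewrite /zdot /= derive1E; apply: derive_val.
Qed.

Lemma expiD x y : expi (x + y) = expi x * expi y :> C.
Proof. by apply: cplx_eq; rewrite !cE /= ?cosD ?sinD; ring. Qed.

Lemma expiX x n : expi x ^+ n = expi (n%:R * x) :> C.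
Proof.
elim: n => [|n IH]; first by rewrite expr0 mul0r /expi cos0 sin0.
by rewrite exprS IH -expiD -natr1 mulrDl mul1r addrC.
Qed.

Definition Mth i k : R := Rintegral mu setT (fun t => tanhR t ^+ i * sech t ^+ k).

Lemma continuous_Mth i k : continuous (fun t => tanhR t ^+ i * sech t ^+ k).
Proof.
move=> t; apply: cvgM.
  by apply: (cvg_comp (@tanhR R) (fun y => y ^+ i)); [exact: continuous_tanhR|exact: exprn_continuous].
by apply: (cvg_comp (@sech R) (fun y => y ^+ k)); [exact: continuous_sech|exact: exprn_continuous].
Qed.

Lemma integrable_Mth i k : (0 < k)%N -> mu.-integrable setT (EFin \o (fun t => tanhR t ^+ i * sech t ^+ k)).
Proof.
move=> k0; apply: (integrable_dom_sech (K := 1)); first exact: continuous_Mth.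
move=> t; have S0 := ltW (sech_gt0 t); rewrite normrM !normrX ler_pM ?exprn_ge0//.
  by rewrite exprn_ile1// ler_norml; have /andP[h1 h2] := tanhR_bound t; rewrite !ltW.
by rewrite ger0_norm// -[leRHS]expr1 ler_wiXn2l ?sech_le1.
Qed.

Lemma Mth_odd i k : (0 < k)%N -> odd i -> Mth i k = 0.
Proof.
move=> k0 oi; suff : Mth i k = - Mth i k by lra.
rewrite {1}/Mth /Rintegral -(integral_opp (f := fun t => (tanhR t ^+ i * sech t ^+ k)%:E)); last first.
  by apply/measurable_EFinP; apply: continuous_measurable_fun; exact: continuous_Mth.
transitivity (Rintegral mu setT (fun t => - 1 * (tanhR t ^+ i * sech t ^+ k))); last first.
  by rewrite RintegralZl ?mulN1r//; exact: integrable_Mth.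
rewrite /Rintegral; congr fine; apply: eq_integral => t _.
by rewrite tanhRN sechN exprNn -signr_odd oi expr1 -mulrA.
Qed.

Lemma Mth_ge0 i k : 0 <= Mth (2 * i) k.
Proof.
apply: Rintegral_ge0 => t _; have S0 := ltW (sech_gt0 t).
have T0 : 0 <= (tanhR t ^+ 2) ^+ i by rewrite exprn_ge0 ?sqr_ge0.
by rewrite exprM mulr_ge0// exprn_ge0.
Qed.

Lemma expRN1_le_sech t : 0 <= t <= 1 -> expR (-1) <= sech t.
Proof.
move=> /andP[t0 t1]; rewrite expRN /sech ler_pdivlMr ?addr_gt0 ?expR_gt0// mulrC ler_pdivrMr ?expR_gt0//.
rewrite (_ : 2 * expR 1 = expR 1 + expR 1); last by ring.
by apply: lerD; rewrite ler_expR//; lra.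
Qed.

(** Binomial expansion of the integral of [kcrd a t ^+ p * sech t ^+ k], with ['X] for
    [cosca a ^+ 2]: terms odd in [tanhR] integrate to 0, even powers of [sinca a] become powers of
    [1 - 'X], and a sign and [sinca a ^+ odd p] are factored out. *)
Definition momentpoly p k : {poly R} :=
  \sum_(i < (p./2).+1) ('C(p, 2 * i)%:R * Mth (2 * i) k) *: ((1 - 'X) ^+ (p./2 - i) * (- 'X) ^+ i).

Lemma sum_even (V : nmodType) (F : nat -> V) n : (forall j, odd j -> F j = 0) ->
  \sum_(j < n.+1) F j = \sum_(i < (n./2).+1) F (2 * i)%N.
Proof.
move=> F0; elim: n => [|n IH]; first by rewrite !big_ord_recr !big_ord0.
rewrite big_ord_recr IH /= uphalf_half; case: (boolP (odd n)) => on /=.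
  rewrite add1n [RHS]big_ord_recr/=; congr (_ + F _).
  by rewrite mul2n doubleS -[in LHS](odd_double_half n) on.
by rewrite add0n F0 ?addr0//=.
Qed.

Lemma Mth0_gt0 k : (0 < k)%N -> 0 < Mth 0 k.
Proof.
move=> k0; have i0 := integrable_Mth 0 k0.
apply: (@lt_le_trans _ _ (expR (-1) ^+ k)); first by rewrite exprn_gt0// expR_gt0.
rewrite -lee_fin /Mth /Rintegral fineK; last exact: integrable_fin_num i0.
pose I : set (measurableTypeR R) := `[0, 1]%classic.
have mI : measurable I by exact: measurable_itv.
have muI : mu I = 1%E by rewrite /I lebesgue_measure_itv/= lte_fin ltr01 -EFinB subr0.
have mf : measurable_fun setT (fun t => (tanhR t ^+ 0 * sech t ^+ k)%:E).
  by apply/measurable_EFinP; apply: continuous_measurable_fun; exact: continuous_Mth.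
have f0 t : (0 <= (tanhR t ^+ 0 * sech t ^+ k)%:E)%E.
  by rewrite lee_fin expr0 mul1r exprn_ge0// ltW// sech_gt0.
apply: (@le_trans _ _ (\int[mu]_(t in I) (tanhR t ^+ 0 * sech t ^+ k)%:E)%E); last first.
  exact: ge0_subset_integral.
have -> : ((expR (-1) ^+ k)%:E = \int[mu]_(t in I) (expR (-1) ^+ k)%:E)%E.
  by rewrite integral_cst// -[LHS]mule1 -muI.
apply: ge0_le_integral => //.
  exact: measurable_funTS.
move=> t; rewrite /I /= in_itv/= => t01; rewrite lee_fin expr0 mul1r lerXn2r ?nnegrE ?expR_ge0//.
  by rewrite ltW ?sech_gt0.
exact: expRN1_le_sech.
Qed.

Lemma complexR_mul (x y : R) : Complex (x * y) 0 = Complex x 0 * Complex y 0 :> C.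
Proof. by apply: cplx_eq; rewrite /= ?cE /=; ring. Qed.

Lemma complexR_exp (x : R) n : Complex (x ^+ n) 0 = Complex x 0 ^+ n :> C.
Proof. by elim: n => [//|n IH]; rewrite !exprS complexR_mul IH. Qed.

Lemma cint_real (f : R -> R) : cint (fun t => Complex (f t) 0) = Complex (Rintegral mu setT f) 0.
Proof. by apply: cplx_eq; rewrite //= /Rintegral integral0_eq. Qed.

Lemma horner_momentpoly p k (x : R) : (momentpoly p k).[x] =
  \sum_(i < (p./2).+1) ('C(p, 2 * i)%:R * Mth (2 * i) k) * ((1 - x) ^+ (p./2 - i) * (- x) ^+ i).
Proof. by rewrite horner_sum; apply: eq_bigr => i _; rewrite !hornerE. Qed.

Lemma cint_moment a p k : (0 < k)%N ->
  cintegrable (fun t => kcrd a t ^+ p * Complex (sech t ^+ k) 0) /\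
  cint (fun t => kcrd a t ^+ p * Complex (sech t ^+ k) 0) =
  Complex ((-1) ^+ p * (sinca a ^+ odd p * (momentpoly p k).[cosca a ^+ 2])) 0.
Proof.
move=> k0; pose co j : C := (Complex (- sinca a) 0 ^+ (p - j) * Complex 0 (cosca a) ^+ j) *+ 'C(p, j).
have E t : kcrd a t ^+ p * Complex (sech t ^+ k) 0 =
    \sum_(j < p.+1) co j * Complex (tanhR t ^+ j * sech t ^+ k) 0.
  have -> : kcrd a t = Complex (- sinca a) 0 + Complex 0 (cosca a) * Complex (tanhR t) 0.
    by apply: cplx_eq; rewrite !cE /=; ring.
  rewrite exprDn mulr_suml; apply: eq_bigr => j _.
  rewrite (complexR_mul (tanhR t ^+ j) (sech t ^+ k)) (complexR_exp (tanhR t) j) /co.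
  have alg (K : comPzRingType) (A c T S : K) (i n : nat) :
      A * (c * T) ^+ i *+ n * S = A * c ^+ i *+ n * (T ^+ i * S).
    by rewrite exprMn mulrA !mulrnAl !mulrA.
  exact: alg.
have ij j : cintegrable (fun t => Complex (tanhR t ^+ j * sech t ^+ k) 0 : C).
  by split; [exact: integrable_Mth|exact: integrable0].
under eq_fun do rewrite E.
have [h1 h2] := cint_sum (index_enum 'I_p.+1) (f := fun (j : 'I_p.+1) t => co j * Complex (tanhR t ^+ j * sech t ^+ k) 0)
  (fun j => cintegrableZ (co j) (ij j)).
split; first exact: h1.
rewrite h2; transitivity (\sum_(j < p.+1) co j * (Mth j k)%:C%C).
  by apply: eq_bigr => j _; rewrite cintZ// cint_real.
rewrite (sum_even (F := fun j => co j * (Mth j k)%:C%C)); last by move=> j oj; rewrite Mth_odd// mulr0.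
rewrite complexr0 horner_momentpoly !mulr_sumr rmorph_sum; apply: eq_bigr => i _.
have ip : (i <= p./2)%N by rewrite -ltnS.
have -> : co (2 * i)%N = ((- sinca a) ^+ (p - 2 * i) * (- cosca a ^+ 2) ^+ i * 'C(p, 2 * i)%:R)%:C%C.
  rewrite /co -mulr_natr; rewrite !rmorphM !rmorphXn rmorph_nat; congr (_ * _ * _).
  rewrite exprM; congr (_ ^+ _); apply: cplx_eq; rewrite /= ?expr2 /=; ring.
rewrite -rmorphM; congr (_%:C%C).
have -> : (p - 2 * i = odd p + 2 * (p./2 - i))%N.
  by rewrite -{1}(odd_double_half p) -mul2n mulnBr addnBA// leq_mul2l ip orbT.
have -> : (- sinca a) ^+ (odd p + 2 * (p./2 - i)) =
    (-1) ^+ p * (sinca a ^+ odd p * (1 - cosca a ^+ 2) ^+ (p./2 - i)).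
  rewrite exprD exprM sqrrN sqr_sinca -[in RHS]signr_odd mulrA; congr (_ * _).
  by case: (odd p); rewrite ?expr1 ?expr0 ?mulN1r ?mulr1.
ring.
Qed.

(** At 0 only the moment [Mth 0 k], which is positive, survives. This makes the transforms nonzero
    and gives each of them an exact lowest term. *)
Lemma momentpoly0 p k : (0 < k)%N -> (momentpoly p k)`_0 != 0.
Proof.
move=> k0; rewrite -horner_coef0 horner_momentpoly big_ord_recl /= big1 ?addr0; last first.
  by move=> i _; rewrite oppr0 expr0n /= !mulr0.
by rewrite muln0 bin0 subr0 expr1n expr0 !mulr1 mul1r lt0r_neq0// Mth0_gt0.
Qed.

(** Every summand has degree [p./2] and the leading coefficients all carry the sign [(-1) ^+ p./2],
    even moments being nonnegative; so they add up without cancellation. *)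
Lemma size_momentpoly p k : (0 < k)%N -> size (momentpoly p k) = (p./2).+1.
Proof.
move=> k0; pose m := p./2.
have E : momentpoly p k = (-1) ^+ m *: \sum_(i < m.+1) ('C(p, 2 * i)%:R * Mth (2 * i) k) *: (('X - 1%:P) ^+ (m - i) * 'X ^+ i).
  rewrite /momentpoly scaler_sumr; apply: eq_bigr => i _; rewrite scalerA [(-1) ^+ m * _]mulrC -[RHS]scalerA; congr (_ *: _).
  have im : (i <= m)%N by rewrite -ltnS.
  rewrite -[in RHS]signr_odd scaler_sign -mulr_sign signr_odd polyC1.
  have -> : (-1) ^+ m = (-1) ^+ (m - i) * (-1) ^+ i :> {poly R} by rewrite -exprD subnK.
  by rewrite -(opprB 'X 1) [X in X * _]exprNn [X in _ * X = _]exprNn -/m; ring.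
pose N (i : nat) : {poly R} := ('X - 1%:P) ^+ (m - i) * 'X ^+ i.
have mon (i : 'I_m.+1) : (N i)`_m = 1 /\ (size (N i) <= m.+1)%N.
  have im : (i <= m)%N by rewrite -ltnS.
  have mo : N i \is monic.
    by rewrite /N monicMl ?monic_exp ?monicX ?monicXsubC.
  have sz : size (N i) = m.+1.
    rewrite /N size_monicM ?monic_exp ?monicXsubC ?monic_neq0 ?monicX ?monic_exp ?monicX//.
    by rewrite size_exp_XsubC size_polyXn addnS /= addSn subnK.
  by split; [move: mo; rewrite monicE lead_coefE sz => /eqP|rewrite sz].
rewrite E size_scale ?signr_eq0//; apply/eqP; rewrite eqn_leq; apply/andP; split.
  apply: (leq_trans (size_sum _ _ _)); apply/bigmax_leqP => i _.
  by rewrite (leq_trans (size_scale_leq _ _))//; have [] := mon i.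
rewrite ltnNge; apply/negP => /leq_sizeP/(_ m (leqnn m)); rewrite coef_sum => /eqP; apply/negP.
rewrite big_ord_recl lt0r_neq0// ltr_pwDl//.
  by rewrite coefZ (mon ord0).1 mulr1 muln0 bin0 mul1r Mth0_gt0.
by apply: sumr_ge0 => i _; rewrite coefZ (mon _).1 mulr1 mulr_ge0// Mth_ge0.
Qed.

(** The factor [sinca x.2 ^+ odd m] compensates the sign that [gam + pi] gives to the exponential,
    so that every [Fb] is invariant under [SA]. *)
Definition Fb (m : nat) (P : {poly R}) (x : R * R) : C :=
  expi (m%:R * gam x.1 x.2) *
  Complex (cosca x.2 ^+ 2 * (sinca x.2 ^+ odd m * P.[cosca x.2 ^+ 2])) 0.

(** The powers of 1/2 come from passing to the chord ([cint_vcrd]), [(-1) ^+ n.+1] from the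
    imaginary unit in [dkcrd], and [(-1) ^+ p] from the moment integral. Of the factor
    [(c^2)^(n+1)], one [c^2] is absorbed by [Fb], leaving ['X^n]. *)
Lemma Ipq_Fb p n x :
  Ipq p (2 * n.+1) x =
  Complex (2^-1 ^+ (2 * n).+1 * (-1) ^+ n.+1 * (-1) ^+ p) 0 *
  Fb (p + 2 * n.+1) ('X^n * momentpoly p (4 * n.+1)) x.
Proof.
case: x => b a; rewrite /Ipq /=; set e := expi (gam b a).
have Ek t : kcrd a t ^+ p * dkcrd a t ^+ (2 * n.+1) =
    Complex ((-1) ^+ n.+1 * (cosca a ^+ 2) ^+ n.+1) 0 * (kcrd a t ^+ p * Complex (sech t ^+ (4 * n.+1)) 0).
  rewrite mulrCA; congr (_ * _); rewrite exprM.
  have -> : dkcrd a t ^+ 2 = Complex (- (cosca a ^+ 2 * sech t ^+ 4)) 0.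
    by rewrite expr2; apply: cplx_eq; rewrite /dkcrd !cE /=; ring.
  rewrite -complexR_exp -complexR_mul; congr Complex.
  have alg (x y : R) : (- (x * y)) ^+ n.+1 = (-1) ^+ n.+1 * x ^+ n.+1 * y ^+ n.+1.
    by rewrite [LHS]exprNn exprMn mulrA.
  by rewrite alg (exprM _ 4).
have [i1 M] := @cint_moment a p (4 * n.+1) isT.
transitivity (cint (fun t => e ^+ (p + 2 * n.+1) *
    (vcrd a (t + tshift a) ^+ p * dvcrd a (t + tshift a) ^+ (2 * n.+1)))).
  congr cint; apply/funext => t; rewrite zgeoE zdotE !exprMn exprD -/e.
  by rewrite [LHS]mulrACA.
have n0 : (0 < 2 * n.+1)%N by [].
have iv := @cintegrable_vcrd a p _ n0.
rewrite (cint_shift (tshift a) (f := fun t => e ^+ (p + 2 * n.+1) * (vcrd a t ^+ p * dvcrd a t ^+ (2 * n.+1)))); last first.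
  have [/measurable_int/measurable_EFinP j1 /measurable_int/measurable_EFinP j2] := cintegrableZ (e ^+ (p + 2 * n.+1)) iv.
  by split.
rewrite cintZ//.
have -> : (2 * n.+1 = (2 * n).+1.+1)%N by rewrite mulnS.
rewrite cint_vcrd; have -> : ((2 * n).+2 = 2 * n.+1)%N by rewrite mulnS.
under eq_fun do rewrite Ek.
rewrite cintZ// M /Fb /= /e expiX; have -> : odd (p + 2 * n.+1) = odd p by rewrite oddD mul2n odd_double addbF.
rewrite hornerM hornerXn -complexR_exp -!complexR_mul.
rewrite [RHS]mulrCA -complexR_mul; congr (_ * Complex _ _).
rewrite [(cosca a ^+ 2) ^+ n.+1]exprS; ring.
Qed.

Definition kapbdf (p l : nat) (z : R * R) : C :=
  Complex (kap z).1 (kap z).2 ^+ p * Complex (bdf z ^+ l) 0.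

Lemma kapbdf_kpoint p l g a t :
  kapbdf p l (kpoint g a t) =
  expi (p%:R * g) * Complex (cosca a ^+ l) 0 * (kcrd a t ^+ p * Complex (sech t ^+ l) 0).
Proof.
rewrite /kapbdf kap_kpoint bdf_kpoint.
have -> : Complex (rot g (klein a t)).1 (rot g (klein a t)).2 = expi g * kcrd a t :> C.
  by rewrite /rot /klein; apply: cplx_eq; rewrite !cE /=; ring.
rewrite (exprMn _ (cosca a)) complexR_mul -expiX.
have alg (K : comPzRingType) (A c T S : K) (i : nat) :
    (A * c) ^+ i * (T * S) = A ^+ i * T * (c ^+ i * S).
  by rewrite exprMn mulrACA.
exact: alg.
Qed.

Lemma cmeasX (h : R * R -> C) n : cmeas h -> cmeas (fun z => h z ^+ n).
Proof.
move=> mh; elim: n => [|n IH].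
  by under eq_fun do rewrite expr0; exact: cmeas_cst.
by under eq_fun do rewrite exprS; exact: cmeasM.
Qed.

Let cmeas_kap : cmeas (fun z : R * R => Complex (kap z).1 (kap z).2 : C).
Proof. by split; rewrite /kap /r2 /=; mfun. Qed.

Let measurable_bdf : measurable_fun setT (@bdf R).
Proof. by rewrite /bdf /r2; mfun. Qed.

Let cmeas_real (f : R * R -> R) : measurable_fun setT f -> cmeas (fun z => Complex (f z) 0 : C).
Proof. by move=> mf; split. Qed.

Lemma cmeas_kapbdf p l : cmeas (kapbdf p l).
Proof.
apply: cmeasM; first exact: (cmeasX p cmeas_kap).
by apply: cmeas_real; have := measurable_bdf => h; mfun.
Qed.

(** Dividing by the square root of [bdf] and squaring leaves [bdf ^+ (2 * l).+3], which is at most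
    [bdf ^+ 2] on the disk; this cancels the pole of the hyperbolic density and leaves a bounded
    integrand. *)
Lemma xhalfL2D_kapbdf p l : xhalfL2D (kapbdf p l.+2).
Proof.
pose s z : R := Num.sqrt (bdf z).
exists (fun z => Complex (kap z).1 (kap z).2 ^+ p * Complex (s z ^+ (2 * l).+3) 0); split; last first.
  move=> z dz; have z0 : 0 <= r2 z by rewrite addr_ge0 ?sqr_ge0.
  have b0 : 0 <= bdf z by rewrite /bdf divr_ge0 ?subr_ge0 ?(ltW dz)// addr_ge0.
  rewrite mulrCA -complexR_mul -exprS; congr (_ * Complex _ _).
  by rewrite -(_ : (2 * l.+2 = (2 * l).+4)%N) ?exprM ?sqr_sqrtr// 2!mulnS.
have ms : measurable_fun setT s by have := measurable_bdf => h; rewrite /s; mfun.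
split; first by apply: cmeasM; [exact: (cmeasX p cmeas_kap)|apply: cmeas_real; mfun].
apply: (@le_lt_trans _ _ (\int[(lebesgue_measure \x lebesgue_measure)%E]_(z in @Disk R) 4%:E)%E); last first.
  by rewrite integral_cst; [apply: lte_mul_pinfty => //; exact: lebesgue_Disk_lty|exact: measurable_disk].
have mD := @measurable_disk R.
have mh : measurable_fun setT (@hypdens R) by rewrite /hypdens /r2; mfun.
have mu0 : cmeas (fun z : R * R => Complex (kap z).1 (kap z).2 ^+ p * Complex (s z ^+ (2 * l).+3) 0 : C).
  by apply: cmeasM; [exact: (cmeasX p cmeas_kap)|apply: cmeas_real; mfun].
have mq := measurable_csq mu0.
have h0 (z : R * R) : 0 <= hypdens z by rewrite /hypdens divr_ge0 ?sqr_ge0.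
apply: ge0_le_integral => //.
- by move=> z _; rewrite lee_fin mulr_ge0 ?csq_ge0.
- by apply: measurable_funTS; apply/measurable_EFinP; exact: measurable_funM.
move=> z dz; rewrite lee_fin csqM csqX.
have z0 : 0 <= r2 z by rewrite addr_ge0 ?sqr_ge0.
have z1 : r2 z < 1 by [].
have b0 : 0 <= bdf z by rewrite /bdf divr_ge0 ?subr_ge0 ?(ltW z1)// addr_ge0.
have b1 : bdf z <= 1 by rewrite /bdf ler_pdivrMr ?mul1r; lra.
have -> : csq (Complex (s z ^+ (2 * l).+3) 0 : C) = bdf z ^+ (2 * l).+3.
  by rewrite /csq /= expr0n addr0 -exprM mulnC exprM sqr_sqrtr.
apply: (@le_trans _ _ (1 * (bdf z ^+ 2) * hypdens z)).
  rewrite ler_wpM2r// ler_pM ?exprn_ge0 ?csq_ge0//; last by rewrite ler_wiXn2l.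
  by rewrite exprn_ile1 ?csq_ge0// /csq /=; exact: kap_le1.
rewrite mul1r /bdf /hypdens expr_div_n.
rewrite (_ : _ * (4 / (1 - r2 z) ^+ 2) = 4 / (1 + r2 z) ^+ 2); last first.
  by field; rewrite ?lt0r_neq0 ?subr_gt0//; lra.
rewrite ler_piMr// invf_le1 ?exprn_gt0//; last lra.
by rewrite exprn_ege1// lerDl.
Qed.

Lemma I0_kapbdf p l x :
  I0 (kapbdf p (2 * l.+1)) x =
  Complex ((-1) ^+ p) 0 * Fb p ('X^l * momentpoly p (2 * l.+1)) x.
Proof.
case: x => b a; rewrite (@I0_J0 _ _ (kapbdf p (2 * l.+1)))//; last exact: cmeas_kapbdf.
rewrite /J0; under eq_fun do rewrite kapbdf_kpoint.
have [i1 M] := @cint_moment a p (2 * l.+1) isT.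
rewrite cintZ// M /Fb /= hornerM hornerXn -!mulrA -!complexR_mul [RHS]mulrCA -complexR_mul.
congr (_ * Complex _ _); rewrite exprM exprS; ring.
Qed.

End ExplicitTransforms.

(** * Completeness *)

Section Completeness.
Variable R : realType.
Local Notation C := (R[i]).
Local Notation mu := (@lebesgue_measure R).
Local Notation mu2 := (mu \x mu)%E.
Local Notation GH := (@GHdom R).
Implicit Types (a b t g : R) (phi y : R * R -> R).

Section Multipliers.
Variable W : R * R -> R.
Hypotheses (mW : measurable_fun setT W) (iW : mu2.-integrable GH (EFin \o W)).

Let mG : measurable (GH : set (measurableTypeR R * measurableTypeR R)).
Proof. exact: measurable_GH. Qed.

Definition bmeas phi := measurable_fun setT phi /\ exists B, forall x, `|phi x| <= B.

Definition wint phi : R := Rintegral mu2 GH (fun x => W x * phi x).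

Lemma integrable_wint phi : bmeas phi -> mu2.-integrable GH (EFin \o (fun x => W x * phi x)).
Proof.
move=> [mp [B pB]].
have iB : mu2.-integrable GH (fun x => B%:E * (EFin \o W) x)%E by exact: integrableZl.
apply: (le_integrable mG _ _ iB).
  by apply: measurable_funTS; apply/measurable_EFinP; exact: measurable_funM.
move=> x _; rewrite /= lee_fin !normrM mulrC ler_wpM2r//.
by rewrite (le_trans (pB x))// ler_norm.
Qed.

Lemma bmeas_cst (k : R) : bmeas (fun=> k).
Proof. by split => //; exists `|k|. Qed.

Lemma bmeasD phi y : bmeas phi -> bmeas y -> bmeas (fun x => phi x + y x).
Proof.
move=> [m1 [B1 b1]] [m2 [B2 b2]]; split; first exact: measurable_funD.
by exists (B1 + B2) => x; rewrite (le_trans (ler_normD _ _))// lerD.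
Qed.

Lemma bmeasM phi y : bmeas phi -> bmeas y -> bmeas (fun x => phi x * y x).
Proof.
move=> [m1 [B1 b1]] [m2 [B2 b2]]; split; first exact: measurable_funM.
by exists (B1 * B2) => x; rewrite normrM ler_pM.
Qed.

Lemma wintD phi y : bmeas phi -> bmeas y -> wint (fun x => phi x + y x) = wint phi + wint y.
Proof.
move=> bp by_; rewrite /wint -(RintegralD mG (integrable_wint bp) (integrable_wint by_)).
by apply: eq_Rintegral => x _; rewrite mulrDr.
Qed.

Lemma wintZ (k : R) phi : bmeas phi -> wint (fun x => k * phi x) = k * wint phi.
Proof.
move=> bp; rewrite /wint -(RintegralZl k mG (integrable_wint bp)).
by apply: eq_Rintegral => x _; rewrite mulrCA.
Qed.

(** Dominated convergence: bounded pointwise limits are enough below, in place of the uniform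
    approximation of a Stone-Weierstrass argument. *)
Lemma wint_lim (phi_ : nat -> R * R -> R) phi (B : R) :
  (forall n, measurable_fun setT (phi_ n)) -> (forall n x, `|phi_ n x| <= B) ->
  (forall x, phi_ n x @[n --> \oo] --> phi x) -> (forall n, wint (phi_ n) = 0) -> wint phi = 0.
Proof.
move=> mp pB pc p0.
have bn n : bmeas (phi_ n) by split => //; exists B.
have iB : mu2.-integrable GH (fun x => (B * `|W x|)%:E).
  have h := integrableZl mG B (integrable_abse iW).
  by apply: eq_integrable h => // x _; rewrite /= EFinM.
have mWp n : measurable_fun GH (EFin \o (fun x => W x * phi_ n x)).
  by apply: measurable_funTS; apply/measurable_EFinP; exact: measurable_funM.
have L : (\int[mu2]_(x in GH) (W x * phi_ n x)%:E)%E @[n --> \oo] --> (\int[mu2]_(x in GH) (W x * phi x)%:E)%E.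
  apply: (@dominated_cvg _ (measurableTypeR R * measurableTypeR R)%type R mu2 GH mG
    (fun n x => (W x * phi_ n x)%:E) (fun x => (W x * phi x)%:E) (fun x => (B * `|W x|)%:E)) => //.
  - by move=> x _; apply: cvg_EFin; [exact: nearW|apply: cvgM; [exact: cvg_cst|exact: pc]].
  - by move=> n x _; rewrite /= lee_fin normrM mulrC ler_wpM2r.
have E n : (\int[mu2]_(x in GH) (W x * phi_ n x)%:E = 0)%E.
  by rewrite -(fineK (integrable_fin_num mG (integrable_wint (bn n)))) /=; congr EFin; exact: p0.
rewrite /wint /Rintegral; have -> : (\int[mu2]_(x in GH) (W x * phi x)%:E = 0)%E; last by [].
rewrite (_ : (fun n => _) = (fun=> 0%E)) in L; last exact/funext.
by rewrite -(cvg_lim _ L)// lim_cst.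
Qed.

Definition trigs m j (th : R) (x : R * R) : R := cos (m%:R * gam x.1 x.2 + th) * sinca x.2 ^+ j.

Lemma bmeas_trigs m j th : bmeas (trigs m j th).
Proof.
split; first by rewrite /trigs /gam; mfun.
exists 1 => x; rewrite /trigs normrM; apply: mulr_ile1 => //.
  by rewrite ler_norml cos_geN1 cos_le1.
by rewrite normrX exprn_ile1// sinca_norm_le1.
Qed.

(* [phi] is annihilated when its product with every trigonometric polynomial in [gam] and [sinca]
   integrates to 0 against [W]; multipliers preserve annihilated functions. *)
Definition annih phi := forall m j th, wint (fun x => phi x * trigs m j th x) = 0.

Definition multiplier y :=
  bmeas y /\ forall phi, bmeas phi -> annih phi -> annih (fun x => y x * phi x).

Lemma multiplier_cst k : multiplier (fun=> k).
Proof.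
split; first exact: bmeas_cst.
move=> phi bp ap m j th; have bt := bmeas_trigs m j th.
under eq_fun do rewrite -mulrA.
by rewrite wintZ ?ap ?mulr0//; exact: bmeasM.
Qed.

Lemma multiplierD y z : multiplier y -> multiplier z -> multiplier (fun x => y x + z x).
Proof.
move=> [b1 m1] [b2 m2]; split; first exact: bmeasD.
move=> phi bp ap m j th; have bt := bmeas_trigs m j th.
under eq_fun do rewrite mulrDl mulrDl.
by rewrite wintD ?m1 ?m2 ?addr0//; apply: bmeasM => //; exact: bmeasM.
Qed.

Lemma multiplierM y z : multiplier y -> multiplier z -> multiplier (fun x => y x * z x).
Proof.
move=> [b1 m1] [b2 m2]; split; first exact: bmeasM.
move=> phi bp ap; under eq_fun do rewrite -mulrA.
by apply: m1; [exact: bmeasM|exact: m2].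
Qed.

Lemma multiplierZ k y : multiplier y -> multiplier (fun x => k * y x).
Proof. exact: multiplierM (multiplier_cst k). Qed.

Lemma multiplierX y n : multiplier y -> multiplier (fun x => y x ^+ n).
Proof.
move=> my; elim: n => [|n IH].
  by under eq_fun do rewrite expr0; exact: multiplier_cst.
by under eq_fun do rewrite exprS; exact: multiplierM.
Qed.

Lemma multiplier_lim (y_ : nat -> R * R -> R) y (B : R) :
  (forall n, multiplier (y_ n)) -> (forall n x, `|y_ n x| <= B) ->
  (forall x, y_ n x @[n --> \oo] --> y x) -> multiplier y.
Proof.
move=> my yB yc.
have yB' x : `|y x| <= B.
  have h : `|y_ n x| @[n --> \oo] --> `|y x| by apply: cvg_norm; exact: yc.
  rewrite -(cvg_lim _ h)//; apply: limr_le; first by apply/cvg_ex; eexists; exact: h.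
  by apply: nearW => n; exact: yB.
have mY : measurable_fun setT y.
  by apply: (measurable_fun_cvg (h := y_)) => // n; have [[]] := my n.
split; first by split => //; exists B.
move=> phi [mp [D pD]] ap m j th; have [mt [T tT]] := bmeas_trigs m j th.
apply: (@wint_lim (fun n x => y_ n x * phi x * trigs m j th x) _ (B * D * T)).
- by move=> n; have [[]] := my n => my_ _ _; apply: measurable_funM => //; exact: measurable_funM.
- by move=> n x; rewrite normrM; apply: ler_pM => //; rewrite normrM; exact: ler_pM.
- by move=> x; apply: cvgM; [apply: cvgM; [exact: yc|exact: cvg_cst]|exact: cvg_cst].
by move=> n; have [_] := my n; apply => //; split => //; exists D.
Qed.

Lemma multiplier_cos eta : multiplier (fun x => cos (gam x.1 x.2 + eta)).
Proof.
have bc : bmeas (fun x => cos (gam x.1 x.2 + eta)).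
  by split; [rewrite /gam; mfun|exists 1 => x; rewrite ler_norml cos_geN1 cos_le1].
split=> // phi bp ap m j th; case: m => [|m].
  (* For [m = 0] the product formula would produce the frequency [-1]; evenness of the cosine turns
     it into the frequency 1 with phase [eta - th]. *)
  have b1 := bmeasM bp (bmeas_trigs 1 j (eta + th)); have b2 := bmeasM bp (bmeas_trigs 1 j (eta - th)).
  transitivity (wint (fun x => 2^-1 * (phi x * trigs 1 j (eta + th) x + phi x * trigs 1 j (eta - th) x))).
    congr wint; apply/funext => x; rewrite /trigs mul0r add0r mul1r !addrA.
    by rewrite (cosD (gam x.1 x.2 + eta)) (cosB (gam x.1 x.2 + eta)); field.
  by rewrite wintZ ?wintD ?ap ?addr0 ?mulr0//; exact: bmeasD.
have b1 := bmeasM bp (bmeas_trigs m.+2 j (th + eta)); have b2 := bmeasM bp (bmeas_trigs m j (th - eta)).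
transitivity (wint (fun x => 2^-1 * (phi x * trigs m.+2 j (th + eta) x + phi x * trigs m j (th - eta) x))).
  congr wint; apply/funext => x; rewrite /trigs.
  have -> : m.+2%:R * gam x.1 x.2 + (th + eta) = m.+1%:R * gam x.1 x.2 + th + (gam x.1 x.2 + eta).
    by rewrite -[m.+2%:R]natr1; ring.
  have -> : m%:R * gam x.1 x.2 + (th - eta) = m.+1%:R * gam x.1 x.2 + th - (gam x.1 x.2 + eta).
    by rewrite -[m.+1%:R]natr1; ring.
  rewrite (cosD (m.+1%:R * gam x.1 x.2 + th)) (cosB (m.+1%:R * gam x.1 x.2 + th)).
  by field.
by rewrite wintZ ?wintD ?ap ?addr0 ?mulr0//; exact: bmeasD.
Qed.

Lemma multiplier_sinca : multiplier (fun x => sinca x.2).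
Proof.
split; first by split; [mfun|exists 1 => x; exact: sinca_norm_le1].
move=> phi bp ap m j th; rewrite -[RHS](ap m j.+1 th).
by congr wint; apply/funext => x; rewrite /trigs exprS; ring.
Qed.

(** The classical iteration [s + (y - s^2) / 2] from 0 produces polynomials in [y] that stay below
    the square root; the error shrinks at each step by the factor [1 - Num.sqrt y / 2], hence to 0
    pointwise. *)
Lemma multiplier_sqrt y : multiplier y -> (forall x, 0 <= y x <= 1) -> multiplier (fun x => Num.sqrt (y x)).
Proof.
move=> my y01.
pose s := fix s n : R * R -> R := if n is n'.+1 then fun x => s n' x + 2^-1 * (y x - s n' x ^+ 2) else fun=> 0.
have ms n : multiplier (s n).
  elim: n => [|n IH]; first exact: multiplier_cst.
  apply: multiplierD => //; apply: multiplierZ.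
  have -> : (fun x => y x - s n x ^+ 2) = (fun x => y x + -1 * s n x ^+ 2) by apply/funext => x; rewrite mulN1r.
  by apply: multiplierD => //; apply: multiplierZ; exact: multiplierX.
have r0 x : 0 <= Num.sqrt (y x) by exact: sqrtr_ge0.
have r1 x : Num.sqrt (y x) <= 1.
  by rewrite -[leRHS]sqrtr1 ler_wsqrtr//; have /andP[] := y01 x.
have ry x : Num.sqrt (y x) ^+ 2 = y x by rewrite sqr_sqrtr//; have /andP[] := y01 x.
have step (v r : R) : 0 <= v -> 0 <= r - v -> r <= 1 -> let v' := v + 2^-1 * (r ^+ 2 - v ^+ 2) in
    [/\ 0 <= v', 0 <= r - v' & r - v' <= (r - v) * (1 - r / 2)].
  move=> h0 h1 hr1 v'; have e : r - v' = (r - v) * (1 - (r + v) / 2) by rewrite /v'; field.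
  split; rewrite ?e; last by rewrite ler_wpM2l//; lra.
    by rewrite /v' addr_ge0// mulr_ge0// subr_sqr mulr_ge0//; lra.
  by rewrite mulr_ge0//; lra.
have bd n x : 0 <= s n x /\ 0 <= Num.sqrt (y x) - s n x <= (1 - Num.sqrt (y x) / 2) ^+ n.
  elim: n => [|n [h0 /andP[h1 h2]]]; first by rewrite /= expr0 subr0 r0 r1.
  have [k0 k1 k2] := step _ _ h0 h1 (r1 x); move: k0 k1 k2; rewrite ry => k0 k1 k2.
  split => //=; rewrite k1 (le_trans k2)// exprSr ler_wpM2r//.
  by have := r1 x; lra.
apply: (@multiplier_lim s _ 1) => //.
  by move=> n x; have [h0 /andP[h1 _]] := bd n x; rewrite ger0_norm//; have := r1 x; lra.
move=> x; have [y0|y0] := eqVneq (Num.sqrt (y x)) 0.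
  rewrite y0; have -> : (s ^~ x) = (fun=> 0); last exact: cvg_cst.
  by apply/funext => n; have [h0 /andP[h1 _]] := bd n x; apply/eqP; rewrite eq_le h0 andbT; move: h1; rewrite y0; lra.
have rp : 0 < Num.sqrt (y x) by rewrite lt_def y0 r0.
apply/cvgrPdist_le => e e0.
have : (fun n => (1 - Num.sqrt (y x) / 2) ^+ n) @ \oo --> (0:R).
  by apply: cvg_expr; rewrite ger0_norm; have := r1 x; lra.
move=> /cvgrPdist_le/(_ e e0); apply: filterS => n; rewrite sub0r normrN => h.
have [_ /andP[h1 h2]] := bd n x.
by rewrite ger0_norm// (le_trans h2)// (le_trans _ h)// ler_norm.
Qed.

Lemma multiplier_norm y : multiplier y -> (forall x, `|y x| <= 1) -> multiplier (fun x => `|y x|).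
Proof.
move=> my y1; under eq_fun do rewrite -sqrtr_sqr.
apply: multiplier_sqrt; first exact: multiplierX.
move=> x; rewrite sqr_ge0/= -(expr1n R 2) -[leLHS]real_normK ?num_real// lerXn2r ?nnegrE//.
Qed.

Definition good (E : set (R * R)) := multiplier (fun x => (x \in E)%:R).

(** [w] is half the positive part of [(y - r) / 2]: it lies in [[0, 1]] and vanishes exactly where
    [y <= r], so the powers of [1 - w] tend to the indicator. *)
Lemma good_le y r : multiplier y -> (forall x, `|y x| <= 1) -> `|r| <= 1 -> good [set x | y x <= r].
Proof.
move=> my y1 r1; pose v x := 2^-1 * (y x + - r).
have mv : multiplier v by apply: multiplierZ; apply: multiplierD => //; exact: multiplier_cst.
have v1 x : `|v x| <= 1.
  rewrite /v normrM ger0_norm// ler_pdivrMl// mulr1 (le_trans (ler_normD _ _))// normrN.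
  by have := y1 x; lra.
pose w x := 2^-1 * (v x + `|v x|).
have mw : multiplier w by apply: multiplierZ; apply: multiplierD => //; exact: multiplier_norm.
have w1 x : 0 <= w x <= 1.
  rewrite /w; have := v1 x; have := ler_norm (v x); have := ler_norm (- v x); rewrite normrN; lra.
have wE x : (w x == 0) = (y x <= r).
  rewrite /w mulf_eq0 invr_eq0 pnatr_eq0/= addr_eq0 eq_sym eqr_oppLR -[RHS]subr_le0.
  have -> : (y x - r <= 0) = (v x <= 0) by rewrite /v pmulr_rle0.
  by rewrite ler0_def.
apply: (@multiplier_lim (fun n x => (1 + -1 * w x) ^+ n) _ 1).
- move=> n; apply: multiplierX; apply: multiplierD; first exact: multiplier_cst.
  exact: multiplierZ.
- move=> n x; rewrite normrX exprn_ile1// ler_norml; have := w1 x; lra.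
move=> x; case: (boolP (y x <= r)) => yr.
  rewrite mem_set//; apply: cvg_near_cst; apply: nearW => n.
  by move: yr; rewrite -wE => /eqP ->; rewrite mulr0 addr0 expr1n.
rewrite memNset; last by apply/negP.
apply: cvg_expr; have w0 : w x != 0 by rewrite wE.
have := w1 x => /andP[h1 h2]; have wp : 0 < w x by rewrite lt_def w0.
by rewrite ger0_norm; lra.
Qed.

(** Integrals over [GH] do not see the rest of the plane. This lets the coordinate [x.1], which is
    not periodic, be reached from periodic functions. *)
Lemma multiplier_ext y z : bmeas z -> (forall x, GH x -> y x = z x) -> multiplier y -> multiplier z.
Proof.
move=> bz yz [_ my]; split => // phi bp ap m j th; rewrite -[RHS](my phi bp ap m j th).
by apply: eq_Rintegral => x /set_mem xG; rewrite yz.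
Qed.

Lemma goodC E : good E -> good (~` E).
Proof.
move=> gE; rewrite /good (_ : (fun x => _) = (fun x => 1 + -1 * (x \in E)%:R)).
  by apply: multiplierD; [exact: multiplier_cst|exact: multiplierZ].
by apply/funext => x; rewrite in_setC; case: (x \in E) => /=; rewrite ?mulr1 ?mulr0 ?addr0 ?subrr.
Qed.

Lemma goodI E F : good E -> good F -> good (E `&` F).
Proof.
move=> gE gF; rewrite /good (_ : (fun x => _) = (fun x => (x \in E)%:R * (x \in F)%:R)).
  exact: multiplierM.
by apply/funext => x; rewrite in_setI; case: (x \in E); rewrite ?mul1r ?mul0r.
Qed.

Lemma good_bigcap (E : nat -> set (R * R)) : (forall n, good (E n)) -> good (\bigcap_n E n).
Proof.
move=> gE; pose q n x : R := \prod_(i < n) (x \in E i)%:R.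
have mq n : multiplier (q n).
  elim: n => [|n IH].
    by rewrite (_ : q 0 = fun=> 1); [exact: multiplier_cst|apply/funext => x; rewrite /q big_ord0].
  rewrite (_ : q n.+1 = fun x => q n x * (x \in E n)%:R); first exact: (multiplierM IH (gE n)).
  by apply/funext => x; rewrite /q big_ord_recr.
apply: (@multiplier_lim q _ 1) => //.
  move=> n x; rewrite /q normr_prod; apply: prodr_ile1 => i _.
  by case: (x \in E i); rewrite ?normr1 ?normr0 ?lexx ?ler01.
move=> x; case: (boolP (x \in \bigcap_n E n)) => [/set_mem xE|/negP xE].
  apply: cvg_near_cst; apply: nearW => n; rewrite /q big1// => i _.
  by rewrite mem_set//; exact: xE.
have [i iE] : exists i, ~ E i x.
  by apply: contrapT => /forallNP h; apply: xE; apply/mem_set => i _; apply: contrapT; exact: h.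
apply: cvg_near_cst; exists i.+1 => // n /= ni.
by rewrite /q (bigD1 (Ordinal ni)) //= memNset// mul0r.
Qed.

Lemma goodT : good setT.
Proof.
by rewrite /good (_ : (fun x => _) = (fun=> 1)); [exact: multiplier_cst|apply/funext => x; rewrite in_setT].
Qed.

Lemma sigma_algebra_good : sigma_algebra setT good.
Proof.
split; first by rewrite -setCT; apply: goodC; exact: goodT.
  by move=> A gA; rewrite setTD; exact: goodC.
move=> A gA; rewrite -[X in good X]setCK; apply: goodC; rewrite setC_bigcup.
by apply: good_bigcap => n; exact: goodC.
Qed.

Lemma good_ext E F : measurable F -> (forall x, GH x -> E x <-> F x) -> good E -> good F.
Proof.
move=> mF EF; apply: multiplier_ext.
  split; last by exists 1 => x; case: (x \in F); rewrite ?normr1 ?normr0 ?ler01.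
  rewrite (_ : (fun x => _) = \1_F); first exact: measurable_indic.
  by apply/funext => x; rewrite indicE.
by move=> x /EF h; congr (_%:R); congr (nat_of_bool _); apply/idP/idP => /set_mem/h/mem_set.
Qed.

Lemma sinca_le a r : (sinca a <= sinca r) = (a <= r).
Proof.
have h (x : R) : - (pi / 2) < atan x < pi / 2 by rewrite atan_gtNpi2 atan_ltpi2.
have hh (u v : R) : (sinca u < sinca v) = (atan u < atan v).
  by rewrite /sinca ltr_sin// in_itv/=; [have /andP[h1 h2] := h u|have /andP[h1 h2] := h v]; rewrite !ltW.
rewrite !leNgt hh; congr (~~ _); apply/idP/idP; last exact: lt_atan.
by rewrite !ltNge; apply: contra => /le_atan.
Qed.

Lemma good_snd_le r : good [set x | x.2 <= r].
Proof.
rewrite (_ : [set x | _] = [set x | sinca x.2 <= sinca r]).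
  by apply: good_le; [exact: multiplier_sinca|move=> x; exact: sinca_norm_le1|exact: sinca_norm_le1].
by apply/seteqP; split => x /=; rewrite sinca_le.
Qed.

Lemma multiplier_cosca : multiplier (fun x => cosca x.2).
Proof.
have -> : (fun x : R * R => cosca x.2) = (fun x => Num.sqrt (1 + -1 * sinca x.2 ^+ 2)).
  apply/funext => x; rewrite mulN1r sqr_sinca subKr sqrtr_sqr ger0_norm//.
  by rewrite ltW ?cosca_gt0.
apply: multiplier_sqrt.
  apply: multiplierD; first exact: multiplier_cst.
  by apply: multiplierZ; apply: multiplierX; exact: multiplier_sinca.
move=> x; rewrite mulN1r sqr_sinca subKr sqr_ge0 exprn_ile1 ?cosca_le1// ltW ?cosca_gt0//.
Qed.

(** The coordinate [x.1] differs from [gam] by [atan x.2] and a constant, so the addition formula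
    expresses its cosine through multipliers already known. *)
Lemma multiplier_cos_fst eta : multiplier (fun x => cos (x.1 + eta)).
Proof.
have -> : (fun x : R * R => cos (x.1 + eta)) = (fun x =>
    cos (gam x.1 x.2 + (eta - pi / 2)) * cosca x.2 + cos (gam x.1 x.2 + (eta - pi)) * sinca x.2).
  apply/funext => x; have -> : x.1 + eta = (gam x.1 x.2 + (eta - pi / 2)) - atan x.2 by rewrite /gam; ring.
  rewrite cosB; congr (_ * _ + _ * _).
  have -> : gam x.1 x.2 + (eta - pi) = gam x.1 x.2 + (eta - pi / 2) - pi / 2 by field.
  by rewrite cosBpihalf.
apply: multiplierD; apply: multiplierM; try exact: multiplier_cos.
  exact: multiplier_cosca.
exact: multiplier_sinca.
Qed.

(** On [[0, 2 * pi[] the sign of the sine tells the two half circles apart, and the cosine is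
    monotone on each; a threshold for [x.1] becomes thresholds for sine and cosine. *)
Lemma good_fst_le r : good [set x | x.1 <= r].
Proof.
have mr : measurable [set x : R * R | x.1 <= r].
  rewrite (_ : [set x | _] = fst @^-1` `]-oo, r]%classic); last by apply/seteqP; split => x /=; rewrite in_itv.
  by rewrite -[X in measurable X]setTI; apply: measurable_fst => //; exact: measurable_itv.
have P0 := pi_gt0 R.
have cle (x : R) : `|cos x| <= 1 by rewrite ler_norml cos_geN1 cos_le1.
have m1 : multiplier (fun x => cos x.1) by have := multiplier_cos_fst 0; under eq_fun do rewrite addr0.
have mN1 : multiplier (fun x => - cos x.1).
  by have := multiplierZ (-1) m1; under eq_fun do rewrite mulN1r.
have ms : multiplier (fun x => - sin x.1).
  have := multiplier_cos_fst (pi / 2); by under eq_fun do rewrite cosDpihalf.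
have s0 : good [set x | 0 <= sin x.1].
  rewrite (_ : [set x | _] = [set x | - sin x.1 <= 0]); last by apply/seteqP; split => x /=; rewrite oppr_le0.
  by apply: good_le => //; rewrite ?normr0// => x; rewrite normrN ler_norml sin_geN1 sin_le1.
have sE x : GH x -> (0 <= sin x.1) = (x.1 <= pi).
  move=> /andP[x0 x1]; case: (leP x.1 pi) => h; first by rewrite sin_ge0_pi// x0.
  apply/negbTE; rewrite -ltNge -[x.1](subrK pi) sinDpi oppr_lt0 sin_gt0_pi//; lra.
have cosE (x z : R) : 0 <= x <= pi -> 0 <= z <= pi -> (cos x <= cos z) = (z <= x).
  by move=> hx hz; rewrite !leNgt ltr_cos.
have [r0|r0] := ltP r 0.
  apply: (@good_ext set0) => //; last by rewrite -setCT; apply: goodC; exact: goodT.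
  by move=> x /andP[x0 _]; split => //= xr; move: x0 xr r0; lra.
have [rp|rp] := leP r pi.
  apply: (@good_ext ([set x | 0 <= sin x.1] `&` [set x | - cos x.1 <= - cos r])) => //.
    move=> x xG; rewrite /= sE//; have /andP[x0 x1] := xG; split.
      by move=> [h1]; rewrite lerN2 cosE ?x0 ?h1 ?r0.
    move=> h; have h1 : x.1 <= pi by exact: le_trans h rp.
      by split; [exact: h1|rewrite lerN2 (cosE r x.1) ?r0 ?x0].
  by apply: goodI => //; apply: good_le => //; rewrite ?normrN// => x; rewrite normrN.
have [r2|r2] := leP (2 * pi) r.
  apply: (@good_ext setT) => //; last exact: goodT.
  by move=> x /andP[_ x1]; split => //= _; move: x1; lra.
apply: (@good_ext (~` (~` [set x | 0 <= sin x.1] `&` ~` [set x | cos x.1 <= cos r]))) => //.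
  have cr : cos r = - cos (r - pi) by rewrite -[in LHS](subrK pi r) cosDpi.
  move=> x xG; rewrite setCI !setCK /= sE//; have /andP[x0 x1] := xG.
  have cx : cos x.1 = - cos (x.1 - pi) by rewrite -[in LHS](subrK pi x.1) cosDpi.
  have [xp|xp] := leP x.1 pi; first by split => [_|_]; [lra|left].
  rewrite cx cr lerN2 cosE; [|lra|lra]; rewrite lerD2r.
  by split => [[]//|h]; right.
by apply: goodC; apply: goodI; apply: goodC => //; apply: good_le.
Qed.

(** The good sets form a sigma-algebra that contains the half-planes in both coordinates, hence all
    measurable rectangles. *)
Lemma good_measurable E : measurable E -> good E.
Proof.
have itv (f : R * R -> R) : (forall r, good [set x | f x <= r]) ->
    forall A : set (measurableTypeR R), measurable A -> good (f @^-1` A).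
  move=> gf A mA.
  suff : (@ocitv R).-sigma.-measurable `<=` [set A | good (f @^-1` A)] by apply.
  apply: smallest_sub.
    split => [|B gB|B gB].
    - by rewrite /= preimage_set0; have [] := sigma_algebra_good.
    - by rewrite /= setTD preimage_setC; exact: goodC.
    - by rewrite /= preimage_bigcup; have [_ _] := sigma_algebra_good; apply.
  move=> I [[x z] _ <-] /=.
  rewrite (_ : _ @^-1` _ = [set w | f w <= z] `&` ~` [set w | f w <= x]).
    by apply: goodI => //; exact: goodC.
  apply/seteqP; split => w /=; rewrite in_itv/=.
    by move=> /andP[h1 h2]; split => //; apply/negP; rewrite -ltNge.
  by move=> [h1 /negP]; rewrite -ltNge => h2; rewrite h2.
move=> mE; suff : (@measurable _ (measurableTypeR R * measurableTypeR R)%type) `<=` good by apply.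
rewrite measurable_prod_measurableType.
apply: smallest_sub; first exact: sigma_algebra_good.
move=> _ [A mA [B mB <-]].
rewrite (_ : A `*` B = fst @^-1` A `&` snd @^-1` B); last by [].
by apply: goodI; apply: itv => //; [exact: good_fst_le|exact: good_snd_le].
Qed.

(** If 1 is annihilated, so is every indicator, since indicators are multipliers. Thus [W] has
    integral 0 over every measurable part of [GH]; the sets where it is nonnegative and negative
    give integral 0 for [|W|]. *)
Lemma ae_eq0_of_annih : annih (fun=> 1) -> {ae mu2, forall x, GH x -> W x = 0}.
Proof.
move=> a1.
have i0 E : measurable E -> (\int[mu2]_(x in GH) (W x * (x \in E)%:R)%:E = 0)%E.
  move=> mE; have [bE gE] := good_measurable mE.
  have := gE _ (bmeas_cst 1) a1 0 0 0; rewrite /wint /Rintegral => h.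
  have E1 : (fun x : R * R => W x * (x \in E)%:R) =
      (fun x => W x * ((x \in E)%:R * 1 * trigs 0 0 0 x)).
    by apply/funext => x; rewrite /trigs mul0r addr0 cos0 expr0 !mulr1.
  rewrite -(fineK (integrable_fin_num mG (integrable_wint bE))).
  by congr EFin; rewrite -h E1.
pose P : set (R * R) := [set x | 0 <= W x].
have mP : measurable P.
  rewrite (_ : P = W @^-1` `[0, +oo[%classic); last by apply/seteqP; split => x /=; rewrite in_itv/= andbT.
  by rewrite -[X in measurable X]setTI; apply: mW => //; exact: measurable_itv.
have absE x : `|W x| = W x * (x \in P)%:R - W x * (x \in ~` P)%:R.
  rewrite in_setC; case: (boolP (x \in P)) => /=.
    by move=> /set_mem h; rewrite mulr1 mulr0 subr0 ger0_norm.
  by move=> /negP h; rewrite mulr0 mulr1 sub0r ltr0_norm// ltNge; apply/negP => k; apply: h; exact/mem_set.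
have iE E : measurable E -> mu2.-integrable GH (EFin \o (fun x => W x * (x \in E)%:R)).
  by move=> mE; apply: integrable_wint; have [] := good_measurable mE.
have : (\int[mu2]_(x in GH) (`|W x|)%:E = 0)%E.
  transitivity (\int[mu2]_(x in GH) ((W x * (x \in P)%:R)%R%:E - (W x * (x \in ~` P)%:R)%R%:E))%E.
    by apply: eq_integral => x _; rewrite absE.
  have mCP := measurableC mP.
  rewrite (integralB mG (iE _ mP) (iE _ mCP)) /=.
  by have -> := i0 _ mP; have -> := i0 _ mCP; rewrite sube0.
move=> h; have mWG : measurable_fun GH (EFin \o W).
  by apply: measurable_funTS; exact/measurable_EFinP.
have [k _] := ae_eq_integral_abs mu2 mG mWG.
by apply: ae2_imp (k h) => x j xG; have := j xG => -[].
Qed.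

End Multipliers.
End Completeness.

(** * Measure-preserving maps of the space of geodesics *)

Section Invariance.
Variable R : realType.
Local Notation C := (R[i]).
Local Notation mu := (@lebesgue_measure R).
Local Notation mu2 := (mu \x mu)%E.
Local Notation GH := (@GHdom R).
Implicit Types (a b : R) (u v h : R * R -> C).

(** Preservation of the measure, tested on periodic functions because [T] may move the fundamental
    domain. *)
Definition ginvariant (T : R * R -> R * R) := forall K : R * R -> \bar R,
  measurable_fun setT K -> (forall x, (0 <= K x)%E) ->
  (forall b a, K (b + 2 * pi, a) = K (b, a)) ->
  (\int[mu2]_(x in GH) K (T x) = \int[mu2]_(x in GH) K x)%E.

Lemma ginvariant_rot (c : R) : ginvariant (fun x => (x.1 + c, x.2)).
Proof. by move=> K mK K0 KP; rewrite (ge0_integral_GH_shift (phi := fun=> c)). Qed.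

(** At fixed [a] the scattering relation rotates the circle; what remains is the reflection
    [a -> - a]. *)
Lemma ginvariant_SA : ginvariant (@SA R).
Proof.
move=> K mK K0 KP; rewrite /SA; pose K' x := K (x.1, - x.2).
have K'0 x : (0 <= K' x)%E by exact: K0.
have mK' : measurable_fun setT K' by apply: (measurableT_comp mK); mfun.
transitivity (\int[mu2]_(x in GH) K' (x.1 + (pi + 2 * atan x.2), x.2)%R)%E.
  by apply: eq_integral => x _; rewrite /K' /=; congr (K (_, _)); ring.
rewrite (ge0_integral_GH_shift (phi := fun a => pi + 2 * atan a))//.
- rewrite !ge0_integral_GH2; [|by []|by []|by []|by []].
  rewrite -[RHS](ge0_integral_opp (g := fun a => (\int[mu]_(b in @arc R) K (b, a))%E))//.
    pose L := fun x : R * R => (K \_ (fst @^-1` @arc R)) x.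
    have mA : measurable (fst @^-1` @arc R : set (R * R)).
      by rewrite -[X in measurable X]setTI; apply: measurable_fst => //; exact: measurable_arc.
    have mL : measurable_fun setT L.
      by apply/(measurable_restrictT _ mA); exact: measurable_funTS.
    rewrite (_ : (fun a => _) = (fun a => \int[mu]_b L (b, a))%E); last first.
      apply/funext => a; rewrite integral_mkcond; apply: eq_integral => b _.
      by rewrite /L !patchE; congr (if _ then _ else _); apply/idP/idP; rewrite !inE.
    apply: (@measurable_fun_fubini_tonelli_G _ _ _ _ _ mu L) => // x.
    by rewrite /L; apply: erestrict_ge0.
  by move=> a; apply: integral_ge0.
- by mfun.
- by move=> b a; rewrite /K' /= KP.
Qed.

Section Ginvariant.
Variable T : R * R -> R * R.
Hypotheses (mT : measurable_fun setT T) (iT : ginvariant T)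
  (TP : forall b a, T (b + 2 * pi, a) = ((T (b, a)).1 + 2 * pi, (T (b, a)).2)).

Lemma Rintegral_ginvariant (K : R * R -> R) : measurable_fun setT K ->
  (forall b a, K (b + 2 * pi, a) = K (b, a)) ->
  Rintegral mu2 GH (fun x => K (T x)) = Rintegral mu2 GH K.
Proof.
move=> mK KP; rewrite /Rintegral; congr fine.
have mE : measurable_fun setT (EFin \o K) by exact/measurable_EFinP.
have PP b a : ((EFin \o K)^\+ (b + 2 * pi, a)%R = (EFin \o K)^\+ (b, a))%E by rewrite !funeposE /= KP.
have NP b a : ((EFin \o K)^\- (b + 2 * pi, a)%R = (EFin \o K)^\- (b, a))%E by rewrite !funenegE /= KP.
rewrite integralE [RHS]integralE; congr (_ - _)%E.
  rewrite -[RHS](iT (measurable_funepos mE) (funepos_ge0 _) PP).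
  by apply: eq_integral => x _; rewrite !funeposE.
rewrite -[RHS](iT (measurable_funeneg mE) (funeneg_ge0 _) NP).
by apply: eq_integral => x _; rewrite !funenegE.
Qed.

Lemma cmeas_comp u : cmeas u -> cmeas (u \o T).
Proof. by move=> [m1 m2]; split; [exact: (measurableT_comp m1 mT)|exact: (measurableT_comp m2 mT)]. Qed.

Lemma periodic_comp u : beta_periodic u -> beta_periodic (u \o T).
Proof. by move=> pu b a /=; rewrite TP pu -surjective_pairing. Qed.

Lemma ipGH_ginvariant u v : L2GH u -> L2GH v -> ipGH (u \o T) (v \o T) = ipGH u v.
Proof.
move=> [mu_ pu _] [mv pv _]; have [m1 m2] := cmeasM mu_ (cmeas_conj mv).
apply: cplx_eq; rewrite /= /leb2 /leb1.
  by apply: (Rintegral_ginvariant (K := fun x => cre (u x * (v x)^*%C))) => // b a; rewrite pu pv.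
by apply: (Rintegral_ginvariant (K := fun x => cim (u x * (v x)^*%C))) => // b a; rewrite pu pv.
Qed.

Lemma nrm2GH_ginvariant u : cmeas u -> beta_periodic u -> nrm2GH (u \o T) = nrm2GH u.
Proof.
move=> mu_ pu; rewrite /nrm2GH /leb2 /leb1.
rewrite -[RHS](iT (measurable_csqE mu_))//.
- by move=> x; rewrite lee_fin csq_ge0.
- by move=> b a; rewrite pu.
Qed.

Lemma L2GH_ginvariant u : L2GH u -> L2GH (u \o T).
Proof.
move=> [mu_ pu fu]; split; [exact: cmeas_comp|exact: periodic_comp|].
by rewrite nrm2GH_ginvariant.
Qed.

End Ginvariant.

Lemma measurable_SA : measurable_fun setT (@SA R).
Proof. by rewrite /SA; mfun. Qed.

Lemma SA2pi b a : SA (b + 2 * pi, a) = ((SA (b, a)).1 + 2 * pi, (SA (b, a)).2).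
Proof. by rewrite /SA /=; congr (_, _); ring. Qed.

Let strip (c : R) : set (R * R) := [set x | c <= x.1 < c + 2 * pi].

Let measurable_strip c : measurable (strip c : set (measurableTypeR R * measurableTypeR R)).
Proof.
rewrite (_ : strip c = fst @^-1` `[c, c + 2 * pi[%classic); last by apply/seteqP; split => x /=; rewrite in_itv.
by rewrite -[X in measurable X]setTI; apply: measurable_fst => //; exact: measurable_itv.
Qed.

Let integral_strip (K : R * R -> \bar R) c : measurable_fun setT K -> (forall x, (0 <= K x)%E) ->
  (forall b a, K (b + 2 * pi, a) = K (b, a)) ->
  (\int[mu2]_(x in strip c) K x = \int[mu2]_(x in GH) K x)%E.
Proof.
move=> mK K0 KP; rewrite ge0_integral_GH2; [|by []|by []].
rewrite integral_mkcond fubini_tonelli2; last 2 first.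
- by apply/(measurable_restrictT _ (measurable_strip c)); exact: measurable_funTS.
- by apply: erestrict_ge0.
apply: eq_integral => a _; rewrite /fubini_G -(ge0_integral_period (k := fun b => K (b, a)) _ _ _ c)//.
  rewrite [RHS]integral_mkcond; apply: eq_integral => b _; rewrite !patchE.
  by congr (if _ then _ else _); apply/idP/idP; rewrite !inE /strip/= in_itv.
exact: measurable_fun_pair1.
Qed.

(** The norm controls one strip of width [2 * pi]; countably many translates of it cover the
    plane. *)
Lemma ae_eq0_periodic u : cmeas u -> beta_periodic u -> nrm2GH u = 0%E ->
  {ae mu2, forall x, u x = 0}.
Proof.
move=> mu_ pu u0; have mq := measurable_csqE mu_.
have q0 x : (0 <= (csq (u x))%:E)%E by rewrite lee_fin csq_ge0.
have S c : {ae mu2, forall x, strip c x -> u x = 0}.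
  have mS : measurable_fun (strip c) (fun x => (csq (u x))%:E) by exact: measurable_funTS.
  have [k _] := ae_eq_integral_abs mu2 (measurable_strip c) mS.
  have : (\int[mu2]_(x in strip c) `|(csq (u x))%:E| = 0)%E.
    under eq_integral do rewrite gee0_abs//.
    by rewrite integral_strip// => b a; rewrite pu.
  move=> /k; apply: ae2_imp => x j xG; have := j xG => -[]; exact: csq_eq0.
have H : {ae mu2, forall x, forall n : nat,
    (strip (n%:R * (2 * pi)) x -> u x = 0) /\ (strip (- (n%:R * (2 * pi))) x -> u x = 0)}.
  by apply: ae_foralln => n; exact: ae2_and.
apply: ae2_imp H => x H; have P0 := @pi2_gt0 R.
pose k := Num.floor (x.1 / (2 * pi)).
have k1 : k%:~R * (2 * pi) <= x.1 by rewrite -ler_pdivlMr// Num.Theory.floor_le_tmp.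
have k2 : x.1 < k%:~R * (2 * pi) + 2 * pi.
  rewrite -[X in _ + X]mul1r -mulrDl -ltr_pdivrMr//.
  by have := Num.Theory.floorD1_gt (x.1 / (2 * pi)); rewrite intrD.
have : strip (k%:~R * (2 * pi)) x by rewrite /strip/= k1 k2.
case: k {k1 k2} => n; first by have [h _] := H n; exact: h.
by rewrite NegzE mulrNz mulNr; have [_ h] := H n.+1; exact: h.
Qed.

End Invariance.

(** * The two orthogonal families *)

Section RidgeFunctions.
Variable R : realType.
Local Notation C := (R[i]).
Local Notation mu := (@lebesgue_measure R).
Local Notation mu2 := (mu \x mu)%E.
Local Notation GH := (@GHdom R).
Implicit Types (a b : R) (u v h : R * R -> C) (P Q : {poly R}).

(** [cosca ^+ 3] is the derivative of the bounded function [sinca]. It is the dominating function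
    for the squares of ridge functions, which carry [cosca ^+ 4]. *)
Lemma integral_cosca3 : (\int[mu2]_(x in GH) (cosca x.2 ^+ 3)%:E < +oo)%E.
Proof.
have c0 a : 0 <= cosca a by rewrite ltW ?cosca_gt0.
rewrite ge0_integral_GH2//; last 2 first.
- by mfun.
- by move=> x; rewrite lee_fin exprn_ge0.
have muA : mu (@arc R) = (2 * pi)%:E.
  by rewrite arcE lebesgue_measure_itv/= lte_fin pi2_gt0 -EFinD subr0.
have P0 := @pi2_gt0 R.
have mA := @measurable_arc R.
have -> : (\int[mu]_a \int[mu]_(b in @arc R) (cosca (b, a).2 ^+ 3)%:E =
    \int[mu]_a ((2 * pi)%:E * (cosca a ^+ 3)%:E))%E.
  by apply: eq_integral => a _; rewrite /= integral_cst// muleC; congr (_ * _)%E; exact: muA.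
rewrite ge0_integralZl//; last 3 first.
- by mfun.
- by move=> a _; rewrite lee_fin exprn_ge0.
- by rewrite lee_fin ltW.
apply: lte_mul_pinfty => //; first by rewrite lee_fin ltW.
have dphi (a : R) : is_derive a (1:R) (@sinca R) (cosca a ^+ 3) by exact: is_derive_sinca.
have w0 (a : R) : 0 < cosca a ^+ 3 by rewrite exprn_gt0 ?cosca_gt0.
have cw : continuous (fun a : R => cosca a ^+ 3).
  by move=> a; apply: (cvg_comp (@cosca R) (fun y => y ^+ 3)); [exact: continuous_cosca|exact: exprn_continuous].
have -> : (\int[mu]_a (cosca a ^+ 3)%:E = \int[mu]_(x in `](-1)%R, 1%R[) 1)%E.
  rewrite (ge0_integral_substitution dphi w0 cw (@cvgy_sinca R) (@cvgNy_sinca R) (g := fun=> 1%E))//.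
  by apply: eq_integral => x _; rewrite mul1e.
have lt11 : -1 < 1 :> R by lra.
have m0 : mu `](-1)%R, 1%R[ = (1 - -1)%:E by rewrite lebesgue_measure_itv/= lte_fin lt11 -EFinB.
by rewrite integral_cst// mul1e; apply: (@le_lt_trans _ _ (1 - -1)%:E); [rewrite -m0|exact: ltry].
Qed.

Lemma L2GH_dom h (B : R) : cmeas h -> beta_periodic h -> 0 <= B ->
  (forall x, csq (h x) <= B * cosca x.2 ^+ 3) -> L2GH h.
Proof.
move=> mh ph B0 hB; split => //; have mG := @measurable_GH R.
have c0 a : 0 <= cosca a by rewrite ltW ?cosca_gt0.
have mc : measurable_fun GH (fun x : R * R => (cosca x.2 ^+ 3)%:E) by apply: measurable_funTS; mfun.
apply: (@le_lt_trans _ _ (\int[mu2]_(x in GH) (B%:E * (cosca x.2 ^+ 3)%:E))%E).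
  apply: ge0_le_integral => //.
  - by move=> x _; rewrite lee_fin csq_ge0.
  - by apply: measurable_funTS; exact: measurable_csqE.
  - by apply: measurable_funTS; mfun.
  - by move=> x _; rewrite -EFinM lee_fin.
rewrite ge0_integralZl//; last by move=> x _; rewrite lee_fin exprn_ge0.
apply: lte_mul_pinfty => //; exact: integral_cosca3.
Qed.

Lemma horner_bounded P : exists2 B, 0 <= B & forall y, 0 <= y <= 1 -> `|P.[y]| <= B.
Proof.
elim/poly_ind: P => [|P c [B B0 IH]].
  by exists 0 => // y _; rewrite horner0 normr0.
exists (B + `|c|) => [|y y01]; first by rewrite addr_ge0.
rewrite hornerMXaddC (le_trans (ler_normD _ _))// lerD2r normrM.
have /andP[y0 y1] := y01; rewrite -[leRHS]mulr1 ler_pM ?IH//.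
by rewrite ger0_norm.
Qed.

Lemma measurable_horner P : measurable_fun setT (fun y => P.[y]).
Proof.
elim/poly_ind: P => [|P c IH].
  by under eq_fun do rewrite horner0; exact: measurable_cst.
under eq_fun do rewrite hornerMXaddC.
by apply: measurable_funD => //; apply: measurable_funM.
Qed.

Lemma csq_expi (t : R) : csq (expi t : C) = 1.
Proof. exact: cos2Dsin2. Qed.

Lemma expi_natD2pi (m : nat) (t : R) : expi (m%:R * (t + 2 * pi)) = expi (m%:R * t) :> C.
Proof.
rewrite mulrDr /expi cos_natD2pi; congr Complex.
rewrite -!cosBpihalf addrAC; exact: cos_natD2pi.
Qed.

Lemma gam2pi b a : gam (b + 2 * pi) a = gam b a + 2 * pi.
Proof. by rewrite /gam; ring. Qed.

Let cmeas_expi (m : nat) : cmeas (fun x : R * R => expi (m%:R * gam x.1 x.2) : C).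
Proof. by split; rewrite /= /gam; mfun. Qed.

Let c01 a : 0 <= cosca a ^+ 2 <= 1.
Proof. by rewrite sqr_ge0 exprn_ile1 ?cosca_le1// ltW ?cosca_gt0. Qed.

Let c4 a : (cosca a ^+ 2) ^+ 2 <= cosca a ^+ 3.
Proof. by rewrite -exprM ler_wiXn2l ?cosca_le1// ltW ?cosca_gt0. Qed.

Let s1 a j : (sinca a ^+ j) ^+ 2 <= 1.
Proof.
rewrite -exprM mulnC exprM exprn_ile1 ?sqr_ge0//.
by rewrite sqr_sinca lerBlDr lerDl sqr_ge0.
Qed.

Lemma L2GH_fbasis m j : L2GH (fbasis m j : R * R -> C).
Proof.
apply: (@L2GH_dom _ 1) => //.
- by apply: cmeasM; [exact: cmeas_expi|split => //=; mfun].
- by move=> b a; rewrite /fbasis /= gam2pi expi_natD2pi.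
move=> x; rewrite /fbasis csqM csq_expi !mul1r /csq /= expr0n addr0 exprMn.
by rewrite (le_trans _ (c4 x.2))// ler_piMr ?sqr_ge0.
Qed.

Lemma L2GH_Fb m P : L2GH (Fb m P : R * R -> C).
Proof.
have [B B0 HB] := horner_bounded P.
apply: (@L2GH_dom _ (B ^+ 2)); rewrite ?sqr_ge0//.
- apply: cmeasM; [exact: cmeas_expi|split => //=].
  have mP := measurable_horner P.
  have mPc : measurable_fun setT (fun x : R * R => P.[cosca x.2 ^+ 2]).
    by apply: (measurableT_comp mP); mfun.
  by mfun.
- by move=> b a; rewrite /Fb /= gam2pi expi_natD2pi.
move=> x; rewrite /Fb csqM csq_expi mul1r /csq /= expr0n addr0.
have -> : (cosca x.2 ^+ 2 * (sinca x.2 ^+ odd m * P.[cosca x.2 ^+ 2])) ^+ 2 =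
    P.[cosca x.2 ^+ 2] ^+ 2 * ((cosca x.2 ^+ 2) ^+ 2 * (sinca x.2 ^+ odd m) ^+ 2) by ring.
have e2 := mulr_ge0 (sqr_ge0 (cosca x.2 ^+ 2)) (sqr_ge0 (sinca x.2 ^+ odd m)).
apply: (ler_pM (sqr_ge0 _) e2).
  by rewrite -[leLHS]real_normK ?num_real// lerXn2r ?nnegrE ?HB.
by rewrite (le_trans _ (c4 x.2))// ler_piMr ?sqr_ge0.
Qed.

Lemma Fb_rot m P c x : Fb m P (x.1 + c, x.2) = expi (m%:R * c) * Fb m P x :> C.
Proof.
rewrite /Fb [RHS]mulrA -expiD; congr (expi _ * _); rewrite /gam /=; ring.
Qed.

Let ipGH_rot c m P m' Q : ipGH (fun x => expi (m%:R * c) * Fb m P x : C) (fun x => expi (m'%:R * c) * Fb m' Q x) =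
   ipGH (Fb m P) (Fb m' Q : R * R -> C).
Proof.
have L1 := L2GH_Fb m P; have L2 := L2GH_Fb m' Q.
rewrite -[RHS](ipGH_ginvariant (@ginvariant_rot R c) L1 L2).
by congr ipGH; apply/funext => x; rewrite -Fb_rot.
Qed.

Let ipGH_rot_conj c m P m' Q : ipGH (fun x => expi (m%:R * c) * Fb m P x : C) (fun x => (expi (m'%:R * c) * Fb m' Q x)^*%C) =
   ipGH (Fb m P) (fun x => (Fb m' Q x)^*%C : C).
Proof.
have L1 := L2GH_Fb m P; have L2 := L2GH_conj (L2GH_Fb m' Q).
rewrite -[RHS](ipGH_ginvariant (@ginvariant_rot R c) L1 L2).
by congr ipGH; apply/funext => x; rewrite -Fb_rot.
Qed.

Let expi_pi : expi pi = -1 :> C.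
Proof. by rewrite /expi cospi sinpi; apply: cplx_eq; rewrite /= ?oppr0. Qed.

Let conj_expi (t : R) : (expi t : C)^*%C = expi (- t).
Proof. by rewrite /expi cosN sinN. Qed.

Let eq0N (z : C) : - z = z -> z = 0.
Proof.
move=> /eqP; rewrite -subr_eq0 -opprD oppr_eq0 -mulr2n mulrn_eq0 => /orP[//|/eqP]; exact.
Qed.

Let L2Z c m P : L2GH (fun x => expi (m%:R * c) * Fb m P x : C).
Proof. exact: L2GHZ (L2GH_Fb m P). Qed.

(** The rotation by [pi / (m - m')] preserves the inner product and also multiplies it by [-1]. *)
Lemma ipGH_Fb_neq m P m' Q : m != m' -> ipGH (Fb m P) (Fb m' Q : R * R -> C) = 0.
Proof.
move=> mm; pose c := pi / (m%:R - m'%:R) : R.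
have d0 : m%:R - m'%:R != 0 :> R by rewrite subr_eq0 eqr_nat.
have L1 := L2GH_Fb m P; have L2 := L2GH_Fb m' Q.
apply: eq0N; rewrite -[RHS](ipGH_rot c) ipGHZr// ipGHZl// mulrA conj_expi -expiD.
rewrite (_ : - (m'%:R * c) + m%:R * c = pi) ?expi_pi ?mulN1r//.
by rewrite /c; field.
Qed.

(** The same rotation argument, with angle [pi / (m + m')] since conjugation reverses the frequency
    [m']. *)
Lemma ipGH_Fb_conj m P m' Q : (0 < m + m')%N -> ipGH (Fb m P) (fun x => (Fb m' Q x)^*%C : C) = 0.
Proof.
move=> mm; pose c := pi / (m%:R + m'%:R) : R.
have d0 : m%:R + m'%:R != 0 :> R by rewrite -natrD pnatr_eq0 -lt0n.
have L1 := L2GH_Fb m P; have L2 := L2GH_conj (L2GH_Fb m' Q).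
apply: eq0N; rewrite -[RHS](ipGH_rot_conj c).
rewrite (_ : (fun x => (expi (m'%:R * c) * Fb m' Q x)^*%C) = (fun x => (expi (m'%:R * c))^*%C * (Fb m' Q x)^*%C)); last first.
  by apply/funext => x; rewrite rmorphM.
rewrite ipGHZr// ipGHZl// mulrA conj_expi conj_expi opprK -expiD.
rewrite (_ : m'%:R * c + m%:R * c = pi) ?expi_pi ?mulN1r//.
by rewrite /c; field.
Qed.

(** At equal frequencies the exponentials cancel, so the inner product sees only the product of the
    polynomials and the parity of the frequency. Factors can then be moved across and the frequency
    lowered. *)
Lemma ipGH_Fb_prod m P Q m' P' Q' : odd m = odd m' -> P * Q = P' * Q' ->
  ipGH (Fb m P) (Fb m Q) = ipGH (Fb m' P') (Fb m' Q' : R * R -> C).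
Proof.
move=> mm PQ.
have E k P1 Q1 x : Fb k P1 x * (Fb k Q1 x)^*%C =
    Complex ((cosca x.2 ^+ 2 * sinca x.2 ^+ odd k) ^+ 2 * (P1 * Q1).[cosca x.2 ^+ 2]) 0 :> C.
  rewrite /Fb hornerM; set t := k%:R * _; have := cos2Dsin2 t => ct.
  apply: cplx_eq; rewrite !cE /=; last by ring.
  rewrite -[RHS]mul1r -ct; ring.
by rewrite /ipGH; congr Complex; apply: eq_Rintegral => x _; rewrite !E mm PQ.
Qed.

Lemma expiDnpi (m : nat) (t : R) : expi (m%:R * (t + pi)) = (-1) ^+ m * expi (m%:R * t) :> C.
Proof.
elim: m => [|m IH]; first by rewrite !mul0r expr0 mul1r.
have -> : m.+1%:R * (t + pi) = m%:R * (t + pi) + (t + pi) by rewrite -natr1; ring.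
have -> : m.+1%:R * t = m%:R * t + t by rewrite -natr1; ring.
rewrite (expiD (m%:R * (t + pi))) IH (expiD t pi) (expiD (m%:R * t)) expi_pi exprS; ring.
Qed.

Lemma fbasis_SA m j x : fbasis m j (SA x) = (-1) ^+ (m + j) * fbasis m j x :> C.
Proof.
case: x => b a; rewrite /fbasis gam_SA expiDnpi [(SA _).2]/= coscaN sincaN exprD -!mulrA; congr (_ * _).
rewrite [RHS]mulrCA; congr (_ * _).
have -> : (-1) ^+ j = Complex ((-1) ^+ j) 0 :> C.
  by rewrite complexR_exp; congr (_ ^+ _); apply: cplx_eq; rewrite /= ?oppr0.
rewrite -complexR_mul (exprNn (sinca a) j) /=; congr Complex; ring.
Qed.

Lemma Fb_SA m P x : Fb m P (SA x) = Fb m P x :> C.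
Proof.
case: x => b a; rewrite /Fb gam_SA expiDnpi [(SA _).2]/= coscaN sincaN.
rewrite -signr_odd exprNn; case: (odd m); rewrite ?expr1 ?expr0 ?mul1r// !mulN1r.
by apply: cplx_eq; rewrite !cE /=; ring.
Qed.

Lemma ipGH_sumr (I : Type) (r : seq I) (c : I -> C) (v : I -> R * R -> C) u :
  L2GH u -> (forall i, L2GH (v i)) ->
  L2GH (fun x => \sum_(i <- r) c i * v i x) /\
  ipGH u (fun x => \sum_(i <- r) c i * v i x) = \sum_(i <- r) (c i)^*%C * ipGH u (v i).
Proof.
move=> Lu Lv; elim: r => [|i r [L IH]].
  under eq_fun do rewrite big_nil; split; first exact: L2GH0.
  rewrite big_nil; have := ipGHC (L2GH0 R) Lu; rewrite ipGH0l => ->; exact: conjc0.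
under eq_fun do rewrite big_cons /=.
rewrite big_cons -IH; have Lz := L2GHZ (c i) (Lv i).
by split; [exact: L2GHD|rewrite ipGHDr// ipGHZr].
Qed.

(** Substituting [cosca^2 = 1 - sinca^2] gives a polynomial in [sinca] of degree below [m],
    precisely the exponents to which the range of [I0] is orthogonal. *)
Lemma Fb_fbasis m P : (size P <= m./2)%N -> exists c : nat -> C,
  Fb m P = (fun x => \sum_(j < m) c j * fbasis m j x).
Proof.
move=> sP; pose T : {poly R} := 'X^(odd m) * (P \Po (1 - 'X ^+ 2)).
have sT : (size T <= m)%N.
  rewrite /T; have [->|P0] := eqVneq P 0; first by rewrite comp_poly0 mulr0 size_poly0.
  have s2 : size (1 - 'X ^+ 2 : {poly R}) = 3%N.
    by rewrite addrC size_polyDl ?size_polyN ?size_polyXn ?size_poly1.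
  have := size_comp_poly P (1 - 'X ^+ 2); rewrite s2 /= => sc.
  have sp0 : (0 < size P)%N by rewrite size_poly_gt0.
  rewrite (leq_trans (size_polyMleq _ _))// size_polyXn /=.
  rewrite -[X in (_ <= X)%N](odd_double_half m) leq_add2l -muln2.
  rewrite (leq_trans (leqSpred _))// sc (leq_trans _ (leq_mul sP (leqnn 2)))//.
  by rewrite -[X in (_ <= X * 2)%N](prednK sp0) mulSn addnC addn2 ltnS leqnSn.
exists (fun j => Complex T`_j 0); apply/funext => -[b a].
rewrite /Fb /fbasis; under eq_bigr do rewrite mulrCA -complexR_mul.
rewrite -mulr_sumr; congr (_ * _).
have E : T.[sinca a] = sinca a ^+ odd m * P.[cosca a ^+ 2].
  by rewrite /T hornerM hornerXn horner_comp !hornerE sqr_sinca subKr.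
rewrite /= -E (horner_coef_wide _ sT) mulr_sumr.
elim/big_ind2 : _ => //.
  by move=> x1 x2 y1 y2 <- <-; apply: cplx_eq; rewrite !cE /= ?addr0.
by move=> i _; congr Complex; ring.
Qed.

Lemma fbasis_Fb m j : odd m = odd j -> fbasis m j = Fb m ((1 - 'X) ^+ j./2) :> (R * R -> C).
Proof.
move=> mj; apply/funext => x; rewrite /fbasis /Fb; congr (_ * Complex (_ * _) _).
by rewrite !hornerE -sqr_sinca -exprM -exprD mj mul2n odd_double_half.
Qed.

Let fbasisE m j x : fbasis m j x =
  Complex (cosca x.2 ^+ 2 * (cos (m%:R * gam x.1 x.2) * sinca x.2 ^+ j))
          (cosca x.2 ^+ 2 * (sin (m%:R * gam x.1 x.2) * sinca x.2 ^+ j)) :> C.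
Proof. by rewrite /fbasis /expi; apply: cplx_eq; rewrite !cE /=; ring. Qed.

(** The real and imaginary parts of [u], weighted by [cosca ^+ 2] to make them integrable, have all
    their trigonometric moments equal to 0, hence vanish almost everywhere; and the weight has no
    zero. *)
Lemma fbasis_total u : L2GH u ->
  (forall m j, ipGH u (fbasis m j) = 0 /\ ipGH u (fun x => (fbasis m j x)^*%C) = 0) -> nrm2GH u = 0%E.
Proof.
move=> Lu u0; have [[mr mi] pu _] := Lu.
pose r x := cre (u x); pose s x := cim (u x).
have mG : measurable (GH : set (measurableTypeR R * measurableTypeR R)) by exact: measurable_GH.
have mc : measurable_fun setT (fun x : R * R => cosca x.2 ^+ 2) by mfun.
have E0 x : fbasis 0 0 x = Complex (cosca x.2 ^+ 2) 0 :> C.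
  by rewrite fbasisE mul0r cos0 sin0 expr0 !mulr1 mulr0.
have [ir is_] := integrable_ip Lu (L2GH_fbasis 0 0).
have iR : mu2.-integrable GH (EFin \o (fun x => r x * cosca x.2 ^+ 2)).
  by apply: eq_integrable ir => // x _; congr EFin; rewrite E0 creM cre_conj cim_conj /= oppr0 mulr0 subr0.
have iS : mu2.-integrable GH (EFin \o (fun x => s x * cosca x.2 ^+ 2)).
  by apply: eq_integrable is_ => // x _; congr EFin; rewrite E0 cimM cre_conj cim_conj /= oppr0 mulr0 add0r.
have mR : measurable_fun setT (fun x => r x * cosca x.2 ^+ 2) by exact: measurable_funM.
have mS : measurable_fun setT (fun x => s x * cosca x.2 ^+ 2) by exact: measurable_funM.
pose wR := wint (fun x => r x * cosca x.2 ^+ 2); pose wS := wint (fun x => s x * cosca x.2 ^+ 2).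
pose ct m j := @trigs R m j 0; pose st m j := @trigs R m j (- (pi / 2)).
have bt m j th := bmeas_trigs m j th : bmeas (@trigs R m j th).
have ctE m j x : ct m j x = cos (m%:R * gam x.1 x.2) * sinca x.2 ^+ j by rewrite /ct /trigs addr0.
have stE m j x : st m j x = sin (m%:R * gam x.1 x.2) * sinca x.2 ^+ j by rewrite /st /trigs cosBpihalf.
have iw (W : R * R -> R) phi : measurable_fun setT W -> mu2.-integrable GH (EFin \o W) -> bmeas phi ->
    mu2.-integrable GH (EFin \o (fun x => W x * phi x)) by move=> mW iW; exact: integrable_wint.
have key m j : [/\ wR (ct m j) = 0, wR (st m j) = 0, wS (ct m j) = 0 & wS (st m j) = 0].
  have irc := iw _ _ mR iR (bt m j 0); have irs := iw _ _ mR iR (bt m j (- (pi / 2))).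
  have isc := iw _ _ mS iS (bt m j 0); have iss := iw _ _ mS iS (bt m j (- (pi / 2))).
  have [g1 g2] := u0 m j.
  have h1 : Rintegral (@leb2 R) GH (fun x => cre (u x * (fbasis m j x)^*%C)) = 0 := congr1 (@cre R) g1.
  have h2 : Rintegral (@leb2 R) GH (fun x => cim (u x * (fbasis m j x)^*%C)) = 0 := congr1 (@cim R) g1.
  have h3 : Rintegral (@leb2 R) GH (fun x => cre (u x * ((fbasis m j x)^*%C)^*%C)) = 0 := congr1 (@cre R) g2.
  have h4 : Rintegral (@leb2 R) GH (fun x => cim (u x * ((fbasis m j x)^*%C)^*%C)) = 0 := congr1 (@cim R) g2.
  (* Pairing with [fbasis] and with its conjugate gives four linear relations, which determine the
     four real moments. *)
  have e1 : wR (ct m j) + wS (st m j) = 0.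
    rewrite -[RHS]h1 /wR /wS /wint -(RintegralD mG irc iss).
    by apply: eq_Rintegral => x _; rewrite -/(ct m j x) -/(st m j x) ctE stE fbasisE !cE /=; rewrite -/(r x) -/(s x); ring.
  have e2 : wS (ct m j) - wR (st m j) = 0.
    rewrite -[RHS]h2 /wR /wS /wint -(RintegralB mG isc irs).
    by apply: eq_Rintegral => x _; rewrite -/(ct m j x) -/(st m j x) ctE stE fbasisE !cE /=; rewrite -/(r x) -/(s x); ring.
  have e3 : wR (ct m j) - wS (st m j) = 0.
    rewrite -[RHS]h3 /wR /wS /wint -(RintegralB mG irc iss).
    by apply: eq_Rintegral => x _; rewrite -/(ct m j x) -/(st m j x) ctE stE fbasisE !cE /=; rewrite -/(r x) -/(s x); ring.
  have e4 : wS (ct m j) + wR (st m j) = 0.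
    rewrite -[RHS]h4 /wR /wS /wint -(RintegralD mG isc irs).
    by apply: eq_Rintegral => x _; rewrite -/(ct m j x) -/(st m j x) ctE stE fbasisE !cE /=; rewrite -/(r x) -/(s x); ring.
  by clear -e1 e2 e3 e4; split; lra.
have an (W : R * R -> R) : measurable_fun setT W -> mu2.-integrable GH (EFin \o W) ->
    (forall m j, wint W (ct m j) = 0 /\ wint W (st m j) = 0) -> {ae mu2, forall x, GH x -> W x = 0}.
  move=> mW iW h; apply: (ae_eq0_of_annih mW iW) => m j th; have [h1 h2] := h m j.
  have bZ k th' : bmeas (fun x => k * @trigs R m j th' x) by apply: bmeasM => //; exact: bmeas_cst.
  transitivity (wint W (fun x => cos th * ct m j x + - sin th * st m j x)).
    congr wint; apply/funext => x; rewrite ctE stE mul1r /trigs cosD; ring.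
  have z1 := wintZ mW iW (cos th) (bt m j 0); have z2 := wintZ mW iW (- sin th) (bt m j (- (pi / 2))).
  have z := wintD mW iW (bZ (cos th) 0) (bZ (- sin th) (- (pi / 2))).
  by apply: (etrans z); rewrite z1 z2 -/(ct m j) -/(st m j) h1 h2 !mulr0 addr0.
have aR := an _ mR iR (fun m j => conj (let: And4 a _ _ _ := key m j in a) (let: And4 _ b _ _ := key m j in b)).
have aS := an _ mS iS (fun m j => conj (let: And4 _ _ a _ := key m j in a) (let: And4 _ _ _ b := key m j in b)).
have mq : measurable_fun GH (fun x => (csq (u x))%:E) by apply: measurable_funTS; apply: measurable_csqE; case: Lu.
have [_ k] := ae_eq_integral_abs mu2 mG mq.
transitivity (\int[mu2]_(x in GH) `|(csq (u x))%:E|)%E.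
  by apply: eq_integral => x _; rewrite gee0_abs// lee_fin csq_ge0.
apply: k; apply: ae2_imp (ae2_and aR aS) => x [/= h1 h2] xG.
have c0 : cosca x.2 ^+ 2 != 0 by rewrite expf_neq0// lt0r_neq0// cosca_gt0.
move: (h1 xG) (h2 xG) => /eqP; rewrite mulf_eq0 (negbTE c0) orbF => /eqP r0 /eqP.
by rewrite mulf_eq0 (negbTE c0) orbF => /eqP s0; rewrite /csq -/(r x) -/(s x) r0 s0 expr0n addr0.
Qed.

End RidgeFunctions.

(** * Triangular spanning of polynomials *)

Section PolynomialSubspaces.
Variables (F : fieldType) (K : {poly F} -> Prop) (n : nat).
Hypotheses (K0 : K 0) (KD : forall P Q, K P -> K Q -> K (P + Q)) (KZ : forall c P, K P -> K (c *: P)).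

(* [K] contains, for [j < n], an element of size at most [n] with lowest term in ['X^j], and an
   element of every size larger than [n]. *)
Lemma poly_subspace_full :
  (forall j, (j < n)%N -> exists Q, [/\ K ('X^j * Q), Q`_0 != 0 & (size ('X^j * Q)%R <= n)%N]) ->
  (forall l, exists Q, K Q /\ size Q = (n + l).+1) -> forall P, K P.
Proof.
move=> low high.
(* Only the top [k] of the [n] coefficients may be nonzero. In the induction step the lowest of
   them, at index [n - k.+1], is removed by the element with that lowest term. *)
have low_all k (P : {poly F}) : (size P <= n)%N -> (forall i, (i + k < n)%N -> P`_i = 0) -> K P.
  elim: k P => [|k IH] P sP P0.
    suff -> : P = 0 by [].
    apply/polyP => i; rewrite coef0; have [ni|ni] := leqP n i; last by rewrite P0 ?addn0.
    by rewrite nth_default// (leq_trans sP).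
  have [nk|kn] := leqP n k.
    by apply: IH => // i; rewrite ltnNge (leq_trans nk (leq_addl _ _)).
  pose j := (n - k.+1)%N; have jn : (j < n)%N by rewrite /j ltn_subrL/= (leq_ltn_trans _ kn).
  have [Q [KQ Q0 sQ]] := low j jn; pose c := P`_j / Q`_0.
  rewrite -(subrK (c *: ('X^j * Q)) P); apply: KD; last exact: KZ.
  apply: IH => [|i ik].
    rewrite (leq_trans (size_polyD _ _))// geq_max sP size_polyN.
    by rewrite (leq_trans (size_scale_leq _ _)).
  rewrite coefB coefZ coefXnM; have [ij|ij] := ltnP i j.
    by rewrite mulr0 subr0 P0// addnC -ltn_subRL.
  have -> : i = j.
    by apply/eqP; rewrite eqn_leq ij andbT -ltnS /j subnSK// ltn_subRL addnC.
  by rewrite subnn divfK// subrr.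
(* Beyond size [n] the leading coefficient is removed instead, by the element of the same size. *)
have up N (P : {poly F}) : (size P <= n + N)%N -> K P.
  elim: N P => [|N IH] P sP.
    by apply: (low_all n) => [|i]; [rewrite -(addn0 n)|rewrite ltnNge leq_addl].
  have [Q [KQ sQ]] := high N; have Q0 : lead_coef Q != 0 by rewrite lead_coef_eq0 -size_poly_gt0 sQ.
  pose c := P`_(n + N) / lead_coef Q.
  rewrite -(subrK (c *: Q) P); apply: KD; last exact: KZ.
  apply: IH; apply/leq_sizeP => i ni; rewrite coefB coefZ.
  move: ni; rewrite leq_eqVlt => /orP[/eqP <-|ni].
    by rewrite /c lead_coefE sQ /= divfK ?subrr//; move: Q0; rewrite lead_coefE sQ.
  by rewrite (leq_sizeP _ _ sP) ?addnS// (nth_default _ (_ : size Q <= i)%N) ?sQ// mulr0 subrr.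
by move=> P; apply: (up (size P)); exact: leq_addl.
Qed.

End PolynomialSubspaces.

(** * Closed spans and invariance under scattering *)

Section Spaces.
Variable R : realType.
Local Notation C := (R[i]).
Local Notation mu := (@lebesgue_measure R).
Local Notation mu2 := (mu \x mu)%E.
Local Notation GH := (@GHdom R).
Implicit Types (a b : R) (u v h : R * R -> C) (P Q : {poly R}) (S : set (R * R -> C)).

Lemma nrm2GH_ae0 u : cmeas u -> {ae mu2, forall x, u x = 0} -> nrm2GH u = 0%E.
Proof.
move=> mu_ u0; have mG : measurable (GH : set (measurableTypeR R * measurableTypeR R)) by exact: measurable_GH.
have mq : measurable_fun GH (fun x => (csq (u x))%:E) by apply: measurable_funTS; exact: measurable_csqE.
have [_ k] := ae_eq_integral_abs mu2 mG mq.
transitivity (\int[mu2]_(x in GH) `|(csq (u x))%:E|)%E.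
  by apply: eq_integral => x _; rewrite gee0_abs// lee_fin csq_ge0.
by apply: k; apply: ae2_imp u0 => x h _; rewrite h csq0.
Qed.

Lemma ipGH_ae u u' v : L2GH u -> L2GH u' -> L2GH v -> {ae mu2, forall x, u x = u' x} ->
  ipGH u v = ipGH u' v.
Proof.
move=> L1 L2 Lv uu; have Lb := L2GHB L1 L2.
have n0 : nrm2GH (fun x => u x - u' x) = 0%E.
  apply: nrm2GH_ae0; first by case: Lb.
  by apply: ae2_imp uu => x ->; rewrite subrr.
apply/eqP; rewrite -subr_eq0 -ipGHBl//; apply/eqP; apply: NGH_csq_ip => //.
by rewrite /NGH n0.
Qed.

Lemma nonzero_near0 P : P`_0 != 0 -> exists2 d, 0 < d & forall y, 0 <= y < d -> P.[y] != 0.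
Proof.
elim/poly_ind: P => [|P c _]; first by rewrite coef0 eqxx.
rewrite coefD coefMX coefC /= add0r => c0; have [B B0 HB] := horner_bounded P.
have cn : 0 < `|c| by rewrite normr_gt0.
exists (Num.min 1 (`|c| / (B + 1))); first by rewrite lt_min ltr01 divr_gt0// ltr_wpDl.
move=> y /andP[y0]; rewrite lt_min => /andP[y1 yc]; rewrite hornerMXaddC.
apply/eqP => /eqP; rewrite addr_eq0 => /eqP h.
have : `|P.[y] * y| = `|c| by rewrite h normrN.
rewrite normrM (ger0_norm y0) => e.
move: yc; rewrite ltr_pdivlMr ?ltr_wpDl// -e ltNge => /negP; apply.
by rewrite [leRHS]mulrC ler_wpM2r// (le_trans (HB _ _)) ?lerDl// y0 ltW.
Qed.

(** As the constant term of [P] is nonzero, ['X^n * P] has no zero in a punctured neighbourhood of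
    0, that is, for large [a]. So the function vanishes nowhere on some unit square, which is not
    negligible. *)
Lemma NGH_Fb_gt0 m P n : P`_0 != 0 -> 0 < NGH (Fb m ('X^n * P) : R * R -> C).
Proof.
move=> P0; rewrite lt_def NGH_ge0 andbT; apply/eqP => N0.
have L := L2GH_Fb m ('X^n * P); have [mF pF _] := L.
have n0 : nrm2GH (Fb m ('X^n * P) : R * R -> C) = 0%E by rewrite nrm2GHE// N0.
have [N [mN muN sN]] := ae_eq0_periodic mF pF n0.
have [d d0 Hd] := nonzero_near0 P0.
(* For [a >= A] one has [cosca a ^+ 2 = (1 + a ^+ 2)^-1 < d], and [a > 0] makes [sinca a]
   nonzero. *)
pose A := 1 + d^-1; have A0 : 0 < A by rewrite addr_gt0 ?invr_gt0.
have Fne (x : R * R) : A <= x.2 -> Fb m ('X^n * P) x != 0 :> C.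
  move=> Ax; have x0 : 0 < x.2 by exact: lt_le_trans Ax.
  have c0 : 0 < cosca x.2 by exact: cosca_gt0.
  have s0 : 0 < sinca x.2 by rewrite sincaE mulr_gt0.
  have e0 : expi (m%:R * gam x.1 x.2) != 0 :> C.
    by apply/eqP => e0; have := csq_expi (m%:R * gam x.1 x.2); rewrite e0 csq0 => /esym/eqP; rewrite oner_eq0.
  have cd : cosca x.2 ^+ 2 < d.
    have d1 : 0 < d^-1 by rewrite invr_gt0.
    rewrite sqr_cosca -[ltRHS]invrK ltf_pV2 ?posrE ?ltr_pwDl ?sqr_ge0//.
    have h1 : d^-1 < x.2 by apply: lt_le_trans Ax; rewrite /A ltrDr.
    have h2 : 1 <= x.2 by apply: le_trans Ax; rewrite /A lerDl ltW.
    by rewrite expr2; nra.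
  rewrite /Fb mulf_neq0//; apply/eqP => /(congr1 (@cre R)) /= /eqP; apply/negP.
  have c2 : cosca x.2 ^+ 2 != 0 by rewrite expf_neq0// lt0r_neq0.
  rewrite hornerM hornerXn; apply: (mulf_neq0 c2); apply: mulf_neq0.
    by rewrite expf_neq0// lt0r_neq0.
  by apply: mulf_neq0; [exact: expf_neq0|apply: Hd; rewrite sqr_ge0].
pose I : set (measurableTypeR R) := `[0, 1]%classic.
pose I' : set (measurableTypeR R) := `[A, A + 1]%classic.
have mI : measurable I by exact: measurable_itv.
have mI' : measurable I' by exact: measurable_itv.
have II : I `*` I' `<=` N.
  move=> x [_]; rewrite /I' /= in_itv/= => /andP[h _]; apply: sN => /= e.
  by have := Fne x h; rewrite e eqxx.
have : (mu2 (I `*` I') <= mu2 N)%E.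
  by apply: le_measure => //; rewrite inE//; exact: measurableX.
have -> : mu2 (I `*` I') = (mu I * mu I')%E by exact: product_measure1E.
have -> : mu I = 1%E by rewrite /I lebesgue_measure_itv/= lte_fin ltr01 -EFinB subr0.
have -> : mu I' = 1%E.
  by rewrite /I' lebesgue_measure_itv/= lte_fin ltrDl ltr01 -EFinB addrC addKr.
by rewrite muN mul1e lee_fin ler10.
Qed.

Lemma ipGH_lincomb S h g : (forall v, S v -> L2GH v) -> L2GH h -> lincomb S g ->
  (forall v, S v -> ipGH h v = 0) -> L2GH g /\ ipGH h g = 0.
Proof.
move=> SL Lh [n [c [v [Sv ->]]]] hv.
have [L ->] := ipGH_sumr (index_enum 'I_n) c Lh (fun i => SL _ (Sv i)).
by split => //; rewrite big1// => i _; rewrite hv ?mulr0.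
Qed.

Lemma ipGH_L2span S h g : (forall v, S v -> L2GH v) -> L2GH h -> L2span S g ->
  (forall v, S v -> ipGH h v = 0) -> ipGH h g = 0.
Proof.
move=> SL Lh Sg hv; have Lg : L2GH g by case: Sg.
rewrite ipGHC// -[RHS](@conjc0 R); congr (_^*%C).
apply: (L2closure_ortho Sg Lh) => s Ss; have [[ms ps _] i0] := ipGH_lincomb SL Lh Ss hv; first by split.
by move=> Ls; rewrite ipGHC// i0 conjc0.
Qed.

Lemma lsubspace_lincomb S : (forall v, S v -> L2GH v) -> lsubspace (lincomb S).
Proof.
move=> SL; split.
- by move=> s Ss; have [] := ipGH_lincomb SL (L2GH0 R) Ss (fun v _ => ipGH0l v).
- exists 0, (fun=> 0), (fun _ _ => 0); split; first by case.
  by apply/funext => x; rewrite big_ord0.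
- move=> s t [n [c [v [Sv ->]]]] [m [d [w [Sw ->]]]].
  exists (n + m)%N, (fun i => match fintype.split i with inl j => c j | inr j => d j end),
    (fun i => match fintype.split i with inl j => v j | inr j => w j end); split.
    by move=> i; case: (fintype.split i).
  apply/funext => x; rewrite big_split_ord /=; congr (_ + _); apply: eq_bigr => i _.
    by rewrite (unsplitK (inl i : 'I_n + 'I_m)).
  by rewrite (unsplitK (inr i : 'I_n + 'I_m)).
- move=> k s [n [c [v [Sv ->]]]]; exists n, (fun i => k * c i), v; split => //.
  by apply/funext => x; rewrite mulr_sumr; apply: eq_bigr => i _; rewrite mulrA.
Qed.

Lemma L2closure_mono S S' : S `<=` S' -> L2closure S `<=` L2closure S'.
Proof.
move=> SS h [Lh hS]; split => // e e0; have [g [Sg ge]] := hS e e0.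
by exists g; split => //; exact: SS.
Qed.

Definition sainv u := forall x, u (SA x) = u x.

Lemma cmeas_SA u : cmeas u -> cmeas (fun x => u (SA x)).
Proof. by move=> mu_; exact: (cmeas_comp (@measurable_SA R) mu_). Qed.

Lemma periodic_SA u : beta_periodic u -> beta_periodic (fun x => u (SA x)).
Proof. by move=> pu; exact: (periodic_comp (@SA2pi R) pu). Qed.

Lemma nrm2GH_SA u : cmeas u -> beta_periodic u -> nrm2GH (fun x => u (SA x)) = nrm2GH u.
Proof. by move=> mu_ pu; exact: (nrm2GH_ginvariant (@ginvariant_SA R) mu_ pu). Qed.

(** For an invariant [g] near [h], the defect [h \o SA - h] equals [w \o SA - w] with [w = h - g].
    Its norm is at most 4 times that of [w] because [SA] preserves norms; hence the tolerance
    [e / 4]. *)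
Lemma L2closure_L2plus S : (forall g, S g -> [/\ cmeas g, beta_periodic g & sainv g]) ->
  L2closure S `<=` @L2plus R.
Proof.
move=> Sg h [Lh hS]; split => //; have [mh ph _] := Lh.
pose d x := h (SA x) - h x.
have md : cmeas d by apply: cmeasB => //; exact: cmeas_SA.
have pd : beta_periodic d by move=> b a; rewrite /d ph periodic_SA.
suff d0 : nrm2GH d = 0%E.
  apply: ae2_imp (ae_eq0_periodic md pd d0) => x /eqP; rewrite subr_eq0 => /eqP //.
apply/eqP; rewrite eq_le nrm2GH_ge0 andbT; apply/lee_addgt0Pr => e e0; rewrite add0e.
have [g [/Sg[mg pg ig] hg]] := hS (e / 4) (divr_gt0 e0 (ltr0n R 4)).
pose w x := h x - g x.
have mw : cmeas w by exact: cmeasB.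
have pw : beta_periodic w by move=> b a; rewrite /w ph pg.
have -> : d = (fun x => w (SA x) + -1 * w x).
  by apply/funext => x; rewrite /d /w ig; ring.
have mw1 : cmeas (fun x => -1 * w x) by apply: cmeasM => //; exact: cmeas_cst.
apply: (le_trans (nrm2GHD_le (cmeas_SA mw) mw1)).
rewrite nrm2GH_SA// nrm2GHZ//.
have -> : csq (-1 : C) = 1 by rewrite csqN /csq /= expr1n expr0n addr0.
rewrite mul1e; have := ltW hg; rewrite -/w; have := nrm2GH_ge0 w.
case: (nrm2GH w) => // r r0; rewrite -?EFinM -?EFinD !lee_fin ler_pdivlMr//; lra.
Qed.

End Spaces.

(** * Orthonormality of the tensor transforms and orthogonality of the summands *)

Section Families.
Variable R : realType.
Local Notation C := (R[i]).
Local Notation mu := (@lebesgue_measure R).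
Local Notation mu2 := (mu \x mu)%E.
Local Notation GH := (@GHdom R).
Implicit Types (a b : R) (u v h f g : R * R -> C) (P Q : {poly R}) (S : set (R * R -> C)).

(** [I_{p,2q}] without its constant, where [q = n.+1] encodes the condition [q >= 1]. *)
Definition Ifb p n : R * R -> C := Fb (p + 2 * n.+1) ('X^n * momentpoly R p (4 * n.+1)).

Definition Icst p n : C := Complex (2^-1 ^+ (2 * n).+1 * (-1) ^+ n.+1 * (-1) ^+ p) 0.

Lemma Ipq_Ifb p n : Ipq p (2 * n.+1) = (fun x => Icst p n * Ifb p n x).
Proof. by apply/funext => x; rewrite Ipq_Fb. Qed.

Lemma csq_Icst_gt0 p n : 0 < csq (Icst p n).
Proof.
rewrite /csq /= expr0n addr0 lt_def sqr_ge0 andbT expf_neq0// !mulf_neq0 ?signr_eq0//.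
Qed.

Lemma L2GH_Ifb p n : L2GH (Ifb p n).
Proof. exact: L2GH_Fb. Qed.

Lemma L2GH_Ipq p n : L2GH (@Ipq R p (2 * n.+1)).
Proof. by rewrite Ipq_Ifb; apply: L2GHZ; exact: L2GH_Ifb. Qed.

Lemma NGH_Ipq_gt0 p n : 0 < NGH (@Ipq R p (2 * n.+1)).
Proof.
rewrite Ipq_Ifb NGHZ; last exact: L2GH_Ifb.
by rewrite mulr_gt0 ?csq_Icst_gt0// NGH_Fb_gt0// momentpoly0.
Qed.

(** The factor ['X^n] and the degree [p./2] of the moment polynomial together just reach the
    threshold [m./2] of [I0_Fb_ortho]. *)
Lemma size_Ifb p n : (size ('X^n * momentpoly R p (4 * n.+1))%R <= (p + 2 * n.+1)./2)%N.
Proof.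
rewrite (leq_trans (size_polyMleq _ _))// size_polyXn size_momentpoly// addSn /=.
by rewrite mul2n halfD odd_double andbF add0n doubleK addnC addSnnS.
Qed.

Lemma I0_Fb_ortho f m P : xhalfL2D f -> L2GH (I0 f) -> (size P <= m./2)%N ->
  ipGH (I0 f) (Fb m P) = 0 /\ ipGH (I0 f) (fun x => (Fb m P x)^*%C) = 0.
Proof.
move=> xf Lf /Fb_fbasis[c E].
have Lb := L2GH_fbasis R m; have Lc j := L2GH_conj (Lb j).
split.
  have [_ ip] := ipGH_sumr (index_enum 'I_m) (fun j => c j) Lf (fun j => Lb j).
  by rewrite E ip big1// => j _; have [-> _] := I0_fbasis xf (ltn_ord j); rewrite mulr0.
have [_ ip] := ipGH_sumr (index_enum 'I_m) (fun j => (c j)^*%C) Lf (fun j => Lc j).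
rewrite (_ : (fun x => _) = (fun x => \sum_(j < m) (c j)^*%C * (fbasis m j x)^*%C)).
  by rewrite ip big1// => j _; have [_ ->] := I0_fbasis xf (ltn_ord j); rewrite mulr0.
by apply/funext => x; rewrite E rmorph_sum; apply: eq_bigr => j _; rewrite rmorphM.
Qed.

Lemma I0_kapbdf_fun p l : I0 (kapbdf p (2 * l.+1)) =
  (fun x => Complex ((-1) ^+ p) 0 * Fb p ('X^l * momentpoly R p (2 * l.+1)) x).
Proof. by apply/funext => x; rewrite I0_kapbdf. Qed.

Lemma L2GH_I0_kapbdf p l : L2GH (I0 (@kapbdf R p (2 * l.+1))).
Proof. by rewrite I0_kapbdf_fun; apply: L2GHZ; exact: L2GH_Fb. Qed.

Lemma xhalfL2D_kapbdf_even p l : xhalfL2D (@kapbdf R p (2 * l.+1)).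
Proof. by rewrite mulnS; exact: xhalfL2D_kapbdf. Qed.

Lemma sign_neq0 p : Complex ((-1) ^+ p) 0 != 0 :> C.
Proof. by apply/eqP => /(congr1 (@cre R)) /= /eqP; rewrite signr_eq0. Qed.

(* The product of the two ridge polynomials is refactored so that the first factor becomes the ray
   transform of a function, and the second has low degree. *)
Let Ifb_ortho_lt p n p' n' : (n < n')%N -> ipGH (Ifb p n) (Ifb p' n') = 0.
Proof.
move=> nn; have [mm|mm] := eqVneq (p + 2 * n.+1)%N (p' + 2 * n'.+1)%N; last exact: ipGH_Fb_neq.
rewrite /Ifb -mm.
(* A factor ['X^(n+1)] moves to the left. As [4 (n+1) = 2 (2n+2)], the left polynomial is now that
   of the transform of [kapbdf p (4 * n.+1)], at the frequency [p], which has the parity of [m]; the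
   right one shrinks to size at most [p./2]. *)
rewrite (@ipGH_Fb_prod _ _ _ _ p ('X^((2 * n).+1) * momentpoly R p (4 * n.+1))
  ('X^(n' - n.+1) * momentpoly R p' (4 * n'.+1))); last 2 first.
- by rewrite oddD mul2n odd_double addbF.
- rewrite mulrACA [RHS]mulrACA -!exprD; congr ('X^_ * _).
  by rewrite -[in LHS](subnKC nn) addnA addnS addnn mul2n.
have xf := xhalfL2D_kapbdf_even p (2 * n).+1; have Lf := L2GH_I0_kapbdf p (2 * n).+1.
have sz : (size ('X^(n' - n.+1) * momentpoly R p' (4 * n'.+1))%R <= p./2)%N.
  rewrite (leq_trans (size_polyMleq _ _))// size_polyXn size_momentpoly// addSn /=.
  have -> : p = (p' + 2 * (n' - n))%N.
    apply/eqP; rewrite -(eqn_add2r (2 * n.+1)) mm -addnA -mulnDr; apply/eqP; congr (_ + 2 * _)%N.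
    by rewrite addnS subnK// ltnW.
  by rewrite mul2n halfD odd_double andbF add0n doubleK addnS -addSn subnSK// addnC.
have [h _] := I0_Fb_ortho xf Lf sz; move: h; rewrite I0_kapbdf_fun.
have L1 := L2GH_Fb p ('X^((2 * n).+1) * momentpoly R p (2 * (2 * n).+2)).
have L2 := L2GH_Fb p ('X^(n' - n.+1) * momentpoly R p' (4 * n'.+1)).
rewrite ipGHZl// => /eqP; rewrite mulf_eq0 (negbTE (sign_neq0 _)) /= => /eqP.
by rewrite (_ : (2 * (2 * n).+2 = 4 * n.+1)%N)// !mulnS mulnA.
Qed.

Lemma Ifb_ortho p n p' n' : (p, n) != (p', n') -> ipGH (Ifb p n) (Ifb p' n') = 0.
Proof.
move=> pn; have [nn|nn|nn] := ltngtP n n'; first exact: Ifb_ortho_lt.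
  by rewrite ipGHC ?Ifb_ortho_lt ?conjc0//; exact: L2GH_Ifb.
apply: ipGH_Fb_neq; rewrite nn eqn_add2r; move: pn; rewrite nn.
by apply: contra => /eqP ->.
Qed.

Lemma ipGH_conj u v : L2GH u -> L2GH v ->
  ipGH (fun x => (u x)^*%C) (fun x => (v x)^*%C) = (ipGH u v)^*%C.
Proof.
move=> Lu Lv; have Lv' := L2GH_conj Lv; rewrite -ipGHC//; rewrite /ipGH; congr Complex.
  by apply: eq_Rintegral => x _; rewrite conjcK !cE; ring.
by apply: eq_Rintegral => x _; rewrite conjcK !cE; ring.
Qed.

Definition hcst p n : C := Icst p n / Complex (normGH (@Ipq R p (2 * n.+1))) 0.

Lemma Ihat_Ifb p n : Ihat p (2 * n.+1) = (fun x => hcst p n * Ifb p n x).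
Proof. by apply/funext => x; rewrite /Ihat Ipq_Fb /hcst mulrAC. Qed.

Lemma L2GH_Ihat p n : L2GH (@Ihat R p (2 * n.+1)).
Proof. by rewrite Ihat_Ifb; apply: L2GHZ; exact: L2GH_Ifb. Qed.

Lemma Ihat_norm p n : ipGH (Ihat p (2 * n.+1)) (@Ihat R p (2 * n.+1)) = 1.
Proof.
have L := L2GH_Ipq p n; have N0 := NGH_Ipq_gt0 p n.
rewrite ipGHxx; last exact: L2GH_Ihat.
set N := normGH (@Ipq R p (2 * n.+1)).
have NE : N ^+ 2 = NGH (@Ipq R p (2 * n.+1)) by rewrite sqr_sqrtr// NGH_ge0.
have N1 : N != 0 by rewrite -sqrf_eq0 NE lt0r_neq0.
have iN : (Complex N 0)^-1 = Complex N^-1 0 :> C.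
  have N2 : Complex N 0 != 0 :> C by apply/eqP => /(congr1 (@cre R)) /= /eqP; apply/negP.
  by apply: (mulfI N2); rewrite divff// -complexR_mul divff.
rewrite (_ : Ihat p (2 * n.+1) = (fun x => Complex N^-1 0 * @Ipq R p (2 * n.+1) x)).
  by rewrite NGHZ// -NE /csq /= expr0n addr0 -exprMn mulVf// expr1n.
by apply/funext => x; rewrite /Ihat -/N iN mulrC.
Qed.

Lemma Ihat_ortho p n p' n' : ipGH (Ihat p (2 * n.+1)) (@Ihat R p' (2 * n'.+1)) =
  (if (p == p') && (n.+1 == n'.+1) then 1 else 0).
Proof.
case: ifPn => [/andP[/eqP <- /eqP[<-]]|pn]; first exact: Ihat_norm.
have L1 := L2GH_Ifb p n; have L2 := L2GH_Ifb p' n'.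
rewrite !Ihat_Ifb ipGHZl//; last exact: L2GHZ.
by rewrite ipGHZr// Ifb_ortho ?mulr0.
Qed.

Lemma Ifb_Ifb_conj p n p' n' : ipGH (Ifb p n) (fun x => (Ifb p' n' x)^*%C) = 0.
Proof. by apply: ipGH_Fb_conj; rewrite addn_gt0 addnS. Qed.

Local Notation HS := [set @Ihat R p (2 * q) | p in [set: nat] & q in [set q : nat | (0 < q)%N]].
Local Notation HC := [set @Ihat_conj R p (2 * q) | p in [set: nat] & q in [set q : nat | (0 < q)%N]].

Lemma HSP v : HS v -> exists p n, v = (fun x => hcst p n * Ifb p n x).
Proof. by move=> [p _ [[//|n] _ <-]]; exists p, n; rewrite Ihat_Ifb. Qed.

Lemma HCP v : HC v -> exists p n, v = (fun x => (hcst p n)^*%C * (Ifb p n x)^*%C).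
Proof.
move=> [p _ [[//|n] _ <-]]; exists p, n; apply/funext => x.
by rewrite /Ihat_conj Ihat_Ifb rmorphM.
Qed.

Lemma L2GH_HS v : HS v -> L2GH v.
Proof. by move=> /HSP[p [n ->]]; apply: L2GHZ; exact: L2GH_Ifb. Qed.

Lemma L2GH_HC v : HC v -> L2GH v.
Proof. by move=> /HCP[p [n ->]]; apply: L2GHZ; apply: L2GH_conj; exact: L2GH_Ifb. Qed.

Let ZL2 p n : L2GH (fun x => (Ifb p n x)^*%C).
Proof. apply: L2GH_conj; exact: L2GH_Ifb. Qed.

Local Notation A := (L2closure (@I0 R @` (@xhalfL2D R))).

Let Aok s : (@I0 R @` (@xhalfL2D R)) s -> cmeas s /\ beta_periodic s.
Proof. by move=> [f xf <-]; split; [exact: cmeas_I0|exact: I0_periodic]. Qed.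

Lemma A_Ifb f p n : A f -> ipGH f (Ifb p n) = 0.
Proof.
move=> Af; apply: (L2closure_ortho Af (L2GH_Ifb p n) Aok) => _ [g xg <-] Lg.
by have [] := I0_Fb_ortho xg Lg (size_Ifb p n).
Qed.

Lemma A_Ifb_conj f p n : A f -> ipGH f (fun x => (Ifb p n x)^*%C) = 0.
Proof.
move=> Af; apply: (L2closure_ortho Af (ZL2 p n) Aok) => _ [g xg <-] Lg.
by have [] := I0_Fb_ortho xg Lg (size_Ifb p n).
Qed.

Lemma A_B f g : A f -> L2span HS g -> ipGH f g = 0.
Proof.
move=> Af Bg; have [Lf _] := Af; apply: (ipGH_L2span L2GH_HS Lf Bg) => v /HSP[p [n ->]].
by rewrite ipGHZr ?A_Ifb ?mulr0//; exact: L2GH_Ifb.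
Qed.

Lemma A_Bc f g : A f -> L2span HC g -> ipGH f g = 0.
Proof.
move=> Af Bg; have [Lf _] := Af; apply: (ipGH_L2span L2GH_HC Lf Bg) => v /HCP[p [n ->]].
by rewrite ipGHZr ?A_Ifb_conj ?mulr0//; exact: ZL2.
Qed.

Lemma B_Ifb_conj f p n : L2span HS f -> ipGH f (fun x => (Ifb p n x)^*%C) = 0.
Proof.
move=> Bf; have [Lf _] := Bf; have L := ZL2 p n.
rewrite ipGHC// (ipGH_L2span L2GH_HS L Bf) ?conjc0// => v /HSP[p' [n' ->]].
have L' := L2GH_Ifb p' n'.
by rewrite ipGHZr// ipGHC// Ifb_Ifb_conj conjc0 mulr0.
Qed.

Lemma Bc_Ifb f p n : L2span HC f -> ipGH f (Ifb p n) = 0.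
Proof.
move=> Bf; have [Lf _] := Bf; have L := L2GH_Ifb p n.
rewrite ipGHC// (ipGH_L2span L2GH_HC L Bf) ?conjc0// => v /HCP[p' [n' ->]].
by rewrite ipGHZr ?Ifb_Ifb_conj ?mulr0.
Qed.

Lemma B_Bc f g : L2span HS f -> L2span HC g -> ipGH f g = 0.
Proof.
move=> Bf Bg; have [Lf _] := Bf; apply: (ipGH_L2span L2GH_HC Lf Bg) => v /HCP[p [n ->]].
by rewrite ipGHZr ?B_Ifb_conj ?mulr0//; exact: ZL2.
Qed.

Lemma A_L2plus : A `<=` @L2plus R.
Proof.
apply: L2closure_L2plus => _ [f xf <-]; split; [exact: cmeas_I0|exact: I0_periodic|].
have [v mv E] := I0_xhalf xf; move=> [b a]; rewrite !E gam_SA /= J0_pi//.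
Qed.

Lemma lincomb_ok S : (forall v, S v -> [/\ cmeas v, beta_periodic v & sainv v]) ->
  forall g, lincomb S g -> [/\ cmeas g, beta_periodic g & sainv g].
Proof.
move=> Sok g [n [c [v [Sv ->]]]]; split.
- suff : forall r : seq 'I_n, cmeas (fun x => \sum_(i <- r) c i * v i x) by apply.
  elim=> [|i r IH].
    rewrite (_ : (fun x => _) = (fun=> 0)); first exact: cmeas_cst.
    by apply/funext => x; rewrite big_nil.
  rewrite (_ : (fun x => _) = (fun x => c i * v i x + \sum_(j <- r) c j * v j x)).
    apply: cmeasD IH; apply: cmeasM; first exact: cmeas_cst.
    by have [] := Sok _ (Sv i).
  by apply/funext => x; rewrite big_cons.
- by move=> b a; apply: eq_bigr => i _; have [_ -> _] := Sok _ (Sv i).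
- by move=> x; apply: eq_bigr => i _; have [_ _ ->] := Sok _ (Sv i).
Qed.

Lemma B_L2plus : L2span HS `<=` @L2plus R.
Proof.
apply: L2closure_L2plus; apply: lincomb_ok => v Sv; have [mv pv _] := L2GH_HS Sv; split => //.
by have [p [n ->]] := HSP Sv; move=> x; rewrite /Ifb Fb_SA.
Qed.

Lemma Bc_L2plus : L2span HC `<=` @L2plus R.
Proof.
apply: L2closure_L2plus; apply: lincomb_ok => v Sv; have [mv pv _] := L2GH_HC Sv; split => //.
by have [p [n ->]] := HCP Sv; move=> x; rewrite /Ifb Fb_SA.
Qed.

End Families.

(** * The decomposition *)

Section Decomposition.
Variable R : realType.
Local Notation C := (R[i]).
Local Notation mu := (@lebesgue_measure R).
Local Notation mu2 := (mu \x mu)%E.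
Implicit Types (a b y : R) (u v w h f g s : R * R -> C) (P Q : {poly R}) (S : set (R * R -> C)).

Lemma L2D_le u v w (k1 k2 : R) : cmeas w -> L2D u -> L2D v -> 0 <= k1 -> 0 <= k2 ->
  (forall z, csq (w z) <= k1 * csq (u z) + k2 * csq (v z)) -> L2D w.
Proof.
move=> mw [mu_ uf] [mv vf] k10 k20 wle; split => //.
pose F u' (z : R * R) := (csq (u' z) * hypdens z)%:E : \bar R.
have h0 (z : R * R) : 0 <= hypdens z by rewrite /hypdens divr_ge0 ?sqr_ge0.
have mh : measurable_fun setT (@hypdens R) by rewrite /hypdens /r2; mfun.
have mF u' : cmeas u' -> measurable_fun (@Disk R) (F u').
  move=> mu'; apply: measurable_funTS; apply/measurable_EFinP.
  by have := measurable_csq mu' => mq; exact: measurable_funM.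
have F0 u' z : (0 <= F u' z)%E by rewrite lee_fin mulr_ge0// csq_ge0.
have mD := @measurable_disk R.
apply: (@le_lt_trans _ _ (\int[mu2]_(z in @Disk R) (k1%:E * F u z + k2%:E * F v z))%E).
  apply: ge0_le_integral => //.
  - by move=> z _; exact: (F0 w).
  - exact: mF.
  - by apply: emeasurable_funD; apply: measurable_funeM; exact: mF.
  - move=> z _; rewrite /F -!EFinM -EFinD lee_fin (mulrA k1) (mulrA k2) -mulrDl.
    by rewrite ler_wpM2r.
have m1 u' (k : R) : cmeas u' -> measurable_fun (@Disk R) (fun z => k%:E * F u' z)%E.
  by move=> mu'; apply: measurable_funeM; exact: mF.
have p1 u' (k : R) z : 0 <= k -> (0 <= k%:E * F u' z)%E by move=> k0; rewrite mule_ge0.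
rewrite ge0_integralD//; [|by move=> z _; exact: p1|exact: m1|by move=> z _; exact: p1|exact: m1].
rewrite !ge0_integralZl//; [|exact: mF|exact: mF].
apply: lte_add_pinfty; apply: lte_mul_pinfty => //.
Qed.

Lemma xhalfL2DD u v : xhalfL2D u -> xhalfL2D v -> xhalfL2D (fun z => u z + v z).
Proof.
move=> [u' [Lu Eu]] [v' [Lv Ev]]; exists (fun z => u' z + v' z); split.
  have [m1 _] := Lu; have [m2 _] := Lv.
  apply: (@L2D_le u' v' _ 2 2) => //; first exact: cmeasD.
  by move=> z; exact: csqD_le.
by move=> z dz; rewrite Eu// Ev// mulrDr.
Qed.

Lemma xhalfL2DZ (c : C) u : xhalfL2D u -> xhalfL2D (fun z => c * u z).
Proof.
move=> [u' [Lu Eu]]; exists (fun z => c * u' z); split.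
  have [m1 _] := Lu; apply: (@L2D_le u' u' _ (csq c) 0) => //; rewrite ?csq_ge0//.
    by apply: cmeasM => //; exact: cmeas_cst.
  by move=> z; rewrite csqM mul0r addr0.
by move=> z dz; rewrite Eu// mulrCA.
Qed.

Lemma xhalfL2D_conj u : xhalfL2D u -> xhalfL2D (fun z => (u z)^*%C).
Proof.
move=> [u' [Lu Eu]]; exists (fun z => (u' z)^*%C); split.
  have [m1 _] := Lu; apply: (@L2D_le u' u' _ 1 0) => //; first exact: cmeas_conj.
  by move=> z; rewrite csq_conj mul0r mul1r addr0.
by move=> z dz; rewrite Eu// rmorphM; congr (_ * _); apply: cplx_eq; rewrite ?cE //= oppr0.
Qed.

Lemma cintegrableD (f1 f2 : R -> C) : cintegrable f1 -> cintegrable f2 ->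
  cintegrable (fun t => f1 t + f2 t) /\ cint (fun t => f1 t + f2 t) = cint f1 + cint f2.
Proof.
move=> i1 i2; have [|] := @cint_sum R bool [:: true; false] (fun b : bool => if b then f1 else f2).
  by case.
rewrite [X in _ = X -> _]big_cons big_seq1 => h1 h2.
have E : (fun t => \sum_(i <- [:: true; false]) (if i then f1 else f2) t) = (fun t => f1 t + f2 t).
  by apply/funext => t; rewrite big_cons big_seq1.
by rewrite -E.
Qed.

Lemma cintegrable_conj (f : R -> C) : cintegrable f ->
  cintegrable (fun t => (f t)^*%C) /\ cint (fun t => (f t)^*%C) = (cint f)^*%C.
Proof.
move=> [i1 i2]; split.
  split; first by under eq_fun do rewrite cre_conj.
  under eq_fun do rewrite cim_conj.
  by rewrite (_ : _ \o _ = (fun t => - (EFin \o (fun t => cim (f t))) t)%E)//; exact: integrableN.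
apply: cplx_eq; rewrite ?cE /=; first by under eq_Rintegral do rewrite cre_conj.
transitivity (Rintegral mu setT (fun t => -1 * cim (f t))).
  by apply: eq_Rintegral => t _; rewrite cim_conj mulN1r.
by rewrite RintegralZl// mulN1r.
Qed.

(* Membership in [x^{1/2} L^2] does not make the integrals along every geodesic converge; the extra
   conditions make [I0] linear pointwise. *)
Definition ray_regular v :=
  [/\ xhalfL2D v, cmeas v & forall y a, cintegrable (fun t => v (kpoint y a t))].

Lemma I0_ray_regular v x : ray_regular v -> I0 v x = J0 v (gam x.1 x.2) x.2.
Proof. by move=> [_ mv _]; case: x => b a; exact: I0_J0. Qed.

Lemma I0D u v : ray_regular u -> ray_regular v ->
  ray_regular (fun z => u z + v z) /\ I0 (fun z => u z + v z) = (fun x => I0 u x + I0 v x).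
Proof.
move=> ru rv; have [xu mu_ iu] := ru; have [xv mv iv] := rv.
have r : ray_regular (fun z => u z + v z).
  split; [exact: xhalfL2DD|exact: cmeasD|].
  by move=> g a; have [] := cintegrableD (iu g a) (iv g a).
split => //; apply/funext => x; rewrite !I0_ray_regular//.
by have [] := cintegrableD (iu (gam x.1 x.2) x.2) (iv (gam x.1 x.2) x.2).
Qed.

Lemma I0Z (c : C) u : ray_regular u ->
  ray_regular (fun z => c * u z) /\ I0 (fun z => c * u z) = (fun x => c * I0 u x).
Proof.
move=> ru; have [xu mu_ iu] := ru.
have r : ray_regular (fun z => c * u z).
  split; [exact: xhalfL2DZ|by apply: cmeasM => //; exact: cmeas_cst|].
  by move=> g a; exact: (cintegrableZ c (iu g a)).
split => //; apply/funext => x; rewrite !I0_ray_regular//.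
exact: (cintZ c (iu (gam x.1 x.2) x.2)).
Qed.

Lemma I0_conj u : ray_regular u ->
  ray_regular (fun z => (u z)^*%C) /\ I0 (fun z => (u z)^*%C) = (fun x => (I0 u x)^*%C).
Proof.
move=> ru; have [xu mu_ iu] := ru.
have r : ray_regular (fun z => (u z)^*%C).
  split; [exact: xhalfL2D_conj|exact: cmeas_conj|].
  by move=> g a; have [] := cintegrable_conj (iu g a).
split => //; apply/funext => x; rewrite !I0_ray_regular//.
by have [] := cintegrable_conj (iu (gam x.1 x.2) x.2).
Qed.

Lemma ray_regular_kapbdf p l : ray_regular (@kapbdf R p (2 * l.+1)).
Proof.
split; [exact: xhalfL2D_kapbdf_even|exact: cmeas_kapbdf|] => g a.
under eq_fun do rewrite kapbdf_kpoint; apply: cintegrableZ.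
by have [] := @cint_moment R a p (2 * l.+1) isT.
Qed.

(** The part of the range on which the projection theorem can be used: it is a linear subspace of
    [L2GH], stable under conjugation, and contains the transforms of all [kapbdf p (2 * l.+1)]. *)
Definition regular_I0 : set (R * R -> C) :=
  [set s | exists v, [/\ ray_regular v, L2GH (I0 v) & s = I0 v]].

Lemma lsubspace_regular_I0 : lsubspace regular_I0.
Proof.
split.
- by move=> s [v [_ Lv ->]].
- have r0 : ray_regular (fun=> 0).
    have [r _] := I0Z 0 (ray_regular_kapbdf 0 0).
    by move: r; congr ray_regular; apply/funext => z; rewrite mul0r.
  have E : I0 (fun=> 0 : C) = (fun=> 0).
    have [_ E] := I0Z 0 r0; move: E; under eq_fun do rewrite mul0r.
    by move=> ->; apply/funext => x; rewrite mul0r.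
  by exists (fun=> 0); split => //; rewrite E; exact: L2GH0.
- move=> s t [u [ru Lu ->]] [v [rv Lv ->]]; have [r E] := I0D ru rv.
  by exists (fun z => u z + v z); split; [exact: r|rewrite E; exact: L2GHD|rewrite E].
- move=> c s [u [ru Lu ->]]; have [r E] := I0Z c ru.
  by exists (fun z => c * u z); split; [exact: r|rewrite E; exact: L2GHZ|rewrite E].
Qed.

Lemma regular_I0_kapbdf p l : regular_I0 (I0 (@kapbdf R p (2 * l.+1))).
Proof.
by exists (kapbdf p (2 * l.+1)); split; [exact: ray_regular_kapbdf|exact: L2GH_I0_kapbdf|].
Qed.

Lemma regular_I0_conj s : regular_I0 s -> regular_I0 (fun x => (s x)^*%C).
Proof.
move=> [v [rv Lv ->]]; have [r E] := I0_conj rv.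
by exists (fun z => (v z)^*%C); split; [exact: r|rewrite E; exact: L2GH_conj|rewrite E].
Qed.

Local Notation HS := [set @Ihat R p (2 * q) | p in [set: nat] & q in [set q : nat | (0 < q)%N]].
Local Notation HC := [set @Ihat_conj R p (2 * q) | p in [set: nat] & q in [set q : nat | (0 < q)%N]].
Local Notation A := (L2closure (@I0 R @` (@xhalfL2D R))).

Lemma regular_I0_sub : L2closure regular_I0 `<=` A.
Proof. by apply: L2closure_mono => _ [v [[xv _ _] _ ->]]; exists v. Qed.

Lemma sub_L2closure S s : S s -> L2GH s -> L2closure S s.
Proof.
move=> Ss Ls; split => // e e0; exists s; split => //.
rewrite (_ : (fun x => _) = (fun=> 0)); last by apply/funext => x; rewrite subrr.
rewrite nrm2GHE; last exact: L2GH0.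
rewrite (_ : NGH _ = 0) ?lte_fin//; have := ipGHxx (L2GH0 R); rewrite ipGH0l.
by move=> /(congr1 (@cre R)).
Qed.

Lemma lincomb_self S v : S v -> lincomb S v.
Proof.
move=> Sv; exists 1%N, (fun=> 1), (fun=> v); split => //.
by apply/funext => x; rewrite big_ord1 mul1r.
Qed.

Lemma FbD m P Q : Fb m (P + Q) = (fun x => Fb m P x + Fb m Q x) :> (R * R -> C).
Proof.
apply/funext => x; rewrite /Fb -mulrDr; congr (_ * _).
by apply: cplx_eq; rewrite cE /= ?addr0// hornerD; ring.
Qed.

Lemma FbZ m (c : R) P : Fb m (c *: P) = (fun x => Complex c 0 * Fb m P x) :> (R * R -> C).
Proof.
apply/funext => x; rewrite /Fb [RHS]mulrCA; congr (_ * _).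
by rewrite hornerZ; apply: cplx_eq; rewrite !cE /=; ring.
Qed.

(* On the frequency [m] the two families are [s^(odd m) c^2] times polynomials in [c^2] of sizes
   filling [1, 2, ...]. *)
Lemma Fb_ortho_full u : L2GH u -> (forall p n, ipGH u (Ifb p n) = 0) ->
  (forall p l, ipGH u (I0 (kapbdf p (2 * l.+1))) = 0) ->
  forall m P, ipGH u (Fb m P) = 0.
Proof.
move=> Lu uI uJ m; apply: (@poly_subspace_full R (fun P => ipGH u (Fb m P) = 0) m./2).
- rewrite -(scale0r (1 : {poly R})) FbZ ipGHZr//; last exact: L2GH_Fb.
  by apply/eqP; rewrite mulf_eq0 conjc_eq0 eqxx.
- by move=> P Q KP KQ; rewrite FbD ipGHDr ?KP ?KQ ?addr0//; exact: L2GH_Fb.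
- by move=> c P KP; rewrite FbZ ipGHZr ?KP ?mulr0//; exact: L2GH_Fb.
(* The transform with [n = j] and [p = m - 2 * j.+1] has frequency [m]; the condition [j < m./2]
   makes this subtraction exact. *)
- move=> j jm; exists (momentpoly R (m - 2 * j.+1) (4 * j.+1)).
  have mE : (m = m - 2 * j.+1 + 2 * j.+1)%N.
    rewrite subnK// mul2n -geq_half_double; exact: jm.
  split; last by rewrite {2}mE; exact: size_Ifb.
    by rewrite {1}mE; exact: uI.
  exact: momentpoly0.
- move=> l; exists ('X^l * momentpoly R m (2 * l.+1))%R; split; last first.
    by rewrite mulrC size_mulXn -?size_poly_eq0 size_momentpoly// addnS addnC.
  have := uJ m l; rewrite I0_kapbdf_fun ipGHZr//; last exact: L2GH_Fb.
  by move=> /eqP; rewrite mulf_eq0 conjc_eq0 (negbTE (sign_neq0 _ _)) => /eqP.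
Qed.

(** If [m] and [j] have the same parity, [fbasis m j] is one of the [Fb]. Otherwise [SA] changes its
    sign while it fixes [u], so the pairing equals its own opposite. *)
Lemma fbasis_ortho u : L2GH u -> {ae mu2, forall x, u (SA x) = u x} ->
  (forall m P, ipGH u (Fb m P) = 0) -> forall m j, ipGH u (fbasis m j) = 0.
Proof.
move=> Lu uS uF m j; have [mj|mj] := boolP (odd m == odd j).
  by rewrite (fbasis_Fb R (eqP mj)).
have Lb := L2GH_fbasis R m j; have LuS := L2GH_ginvariant (@measurable_SA R) (@ginvariant_SA R) (@SA2pi R) Lu.
have := ipGH_ginvariant (@ginvariant_SA R) Lu Lb.
have LbS := L2GH_ginvariant (@measurable_SA R) (@ginvariant_SA R) (@SA2pi R) Lb.
rewrite (ipGH_ae LuS Lu)//.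
rewrite (_ : fbasis m j \o _ = (fun x => -1 * fbasis m j x)); last first.
  apply/funext => x; rewrite /comp fbasis_SA -signr_odd oddD.
  by move: mj; case: (odd m); case: (odd j).
rewrite ipGHZr// => h; apply/eqP.
have : ipGH u (fbasis m j) *+ 2 = 0.
  rewrite mulr2n -{1}h; set z := ipGH _ _.
  by apply: cplx_eq; rewrite !cE /=; ring.
by move=> /eqP; rewrite mulrn_eq0.
Qed.

(** The functions to which [u] is orthogonal are stable under conjugation, so [Fb_ortho_full]
    applies to [u] and to its conjugate; this covers the positive and negative frequencies that
    totality requires. *)
Lemma L2plus_complete u : L2GH u -> {ae mu2, forall x, u (SA x) = u x} ->
  (forall s, regular_I0 s -> ipGH u s = 0) -> (forall p n, ipGH u (Ifb p n) = 0) ->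
  (forall p n, ipGH u (fun x => (Ifb p n x)^*%C) = 0) -> {ae mu2, forall x, u x = 0}.
Proof.
move=> Lu uS uA uB uC; have [mu_ pu _] := Lu; apply: ae_eq0_periodic => //.
have Lc := L2GH_conj Lu.
have cuS : {ae mu2, forall x, (u (SA x))^*%C = (u x)^*%C} by apply: ae2_imp uS => x ->.
have conj_ip s : L2GH s -> ipGH u (fun x => (s x)^*%C) = (ipGH (fun x => (u x)^*%C) s)^*%C.
  move=> Ls; rewrite -(ipGH_conj Lc Ls); congr ipGH.
  by apply/funext => x; rewrite conjcK.
have uF := Fb_ortho_full Lu uB (fun p l => uA _ (regular_I0_kapbdf p l)).
have cB p n : ipGH (fun x => (u x)^*%C) (Ifb p n) = 0.
  have := uC p n; rewrite conj_ip; last exact: L2GH_Ifb.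
  by move=> h; rewrite -[LHS](@conjcK R) h conjc0.
have cA p l : ipGH (fun x => (u x)^*%C) (I0 (kapbdf p (2 * l.+1))) = 0.
  have := uA _ (regular_I0_conj (regular_I0_kapbdf p l)).
  rewrite conj_ip; last exact: L2GH_I0_kapbdf.
  by move=> h; rewrite -[LHS](@conjcK R) h conjc0.
have cF := Fb_ortho_full Lc cB cA.
apply: fbasis_total => // m j; split; first exact: fbasis_ortho.
rewrite conj_ip; last exact: L2GH_fbasis.
by rewrite (fbasis_ortho Lc cuS cF) conjc0.
Qed.

Lemma hcst_neq0 p n : hcst R p n != 0.
Proof.
apply/eqP => h0; have := Ihat_norm R p n; rewrite Ihat_Ifb h0 ipGHZl.
- by rewrite mul0r => /eqP; rewrite eq_sym oner_eq0.
- exact: L2GH_Ifb.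
- by apply: L2GHZ; exact: L2GH_Ifb.
Qed.

Lemma L2plus_lin u v (c : C) : L2plus u -> L2plus v -> L2plus (fun x => u x + c * v x).
Proof.
move=> [Lu uS] [Lv vS]; split; first by apply: L2GHD => //; exact: L2GHZ.
by apply: ae2_imp (ae2_and uS vS) => x [-> ->].
Qed.

(** That [u] and [v] still agree almost everywhere after composition with [SA] follows from the
    invariance of the norm of [u - v]. *)
Lemma L2plus_ae u v : L2GH u -> L2plus v -> {ae mu2, forall x, u x = v x} -> L2plus u.
Proof.
move=> Lu [Lv vS] uv; split => //.
pose d x := u x - v x; have [md pd _] := L2GHB Lu Lv.
have d0 : nrm2GH d = 0%E by apply: nrm2GH_ae0 => //; apply: ae2_imp uv => x; rewrite /d => ->; rewrite subrr.
have dS : {ae mu2, forall x, d (SA x) = 0}.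
  by apply: ae_eq0_periodic; rewrite ?nrm2GH_SA//; [exact: cmeas_SA|exact: periodic_SA].
apply: ae2_imp (ae2_and (ae2_and uv vS) dS) => x [[-> <-]] /eqP.
by rewrite subr_eq0 => /eqP.
Qed.

(** [h] is projected on each of the three subspaces separately. By their mutual orthogonality the
    remainder is orthogonal to all of them, it inherits the invariance under [SA], and completeness
    makes it vanish. *)
Lemma L2plus_decomposition h : L2plus h ->
  exists f g k, [/\ A f, L2span HS g, L2span HC k & {ae mu2, forall x, h x = f x + g x + k x}].
Proof.
move=> hp; have [Lh hS] := hp.
have [f [Af' fP]] := projection lsubspace_regular_I0 Lh.
have [g [Bg gP]] := projection (lsubspace_lincomb (@L2GH_HS R)) Lh.
have [k [Ck kP]] := projection (lsubspace_lincomb (@L2GH_HC R)) Lh.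
have Af := regular_I0_sub Af'.
have [[Lf _] [Lg _] [Lk _]] := And3 Af Bg Ck.
exists f, g, k; split => //; pose u x := h x - f x - g x - k x.
have Lhf := L2GHB Lh Lf; have Lhfg := L2GHB Lhf Lg; have Lu : L2GH u := L2GHB Lhfg Lk.
have ipu s : L2GH s -> ipGH u s = ipGH h s - ipGH f s - ipGH g s - ipGH k s.
  by move=> Ls; rewrite !ipGHBl.
have ipB v s : L2GH v -> L2GH s -> ipGH (fun x => h x - v x) s = 0 -> ipGH h s = ipGH v s.
  by move=> Lv Ls; rewrite ipGHBl// => /eqP; rewrite subr_eq0 => /eqP.
suff : {ae mu2, forall x, u x = 0}.
  by apply: ae2_imp => x; rewrite /u => /eqP; rewrite !subr_eq0 => /eqP <-; ring.
apply: L2plus_complete => //.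
- have := L2plus_lin (-1) (L2plus_lin (-1) (L2plus_lin (-1) hp (A_L2plus Af)) (B_L2plus Bg)) (Bc_L2plus Ck).
  by move=> [_]; apply: ae2_imp => x; rewrite !mulN1r.
- move=> s rs; have Ls : L2GH s by case: rs => v [_ Lv ->].
  have As : A s by apply: regular_I0_sub; exact: sub_L2closure.
  rewrite ipu// (ipB _ _ Lf Ls (fP _ rs)) subrr sub0r.
  by rewrite ipGHC// (A_B As Bg) [ipGH k s]ipGHC// (A_Bc As Ck) conjc0 subr0 oppr0.
- move=> p n; have Ls := L2GH_Ifb R p n.
  have e : ipGH h (Ifb p n) = ipGH g (Ifb p n).
    apply: ipB => //; have : lincomb HS (fun x => hcst R p n * Ifb p n x).
      by apply: lincomb_self; rewrite -Ihat_Ifb; exists p => //; exists n.+1.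
    move=> /gP; rewrite ipGHZr//; last exact: L2GHB.
    by move=> /eqP; rewrite mulf_eq0 conjc_eq0 (negbTE (hcst_neq0 p n)) => /eqP.
  by rewrite ipu// e (A_Ifb p n Af) subr0 subrr sub0r (Bc_Ifb p n Ck) oppr0.
- move=> p n; have Ls := L2GH_conj (L2GH_Ifb R p n).
  have e : ipGH h (fun x => (Ifb p n x)^*%C) = ipGH k (fun x => (Ifb p n x)^*%C).
    apply: ipB => //; have : lincomb HC (fun x => (hcst R p n)^*%C * (Ifb p n x)^*%C).
      apply: lincomb_self; exists p => //; exists n.+1 => //.
      by apply/funext => x; rewrite /Ihat_conj Ihat_Ifb rmorphM.
    move=> /kP; rewrite ipGHZr//; last exact: L2GHB.
    by move=> /eqP; rewrite mulf_eq0 conjcK (negbTE (hcst_neq0 p n)) => /eqP.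
  by rewrite ipu// e (A_Ifb_conj p n Af) (B_Ifb_conj p n Bg) !subr0 subrr.
Qed.

End Decomposition.

Theorem theorem2p8 (R : realType) :
  let A := L2closure (@I0 R @` (@xhalfL2D R)) in
  let B := L2span [set @Ihat R p (2 * q) | p in [set: nat] & q in [set q : nat | (0 < q)%N]] in
  let Bc := L2span [set @Ihat_conj R p (2 * q) | p in [set: nat] & q in [set q : nat | (0 < q)%N]] in
  (* orthonormality of the two families *)
  (forall p q, (0 < q)%N -> L2GH (@Ihat R p (2 * q)) /\ L2GH (@Ihat_conj R p (2 * q))) /\
  (forall p q p' q', (0 < q)%N -> (0 < q')%N ->
     ipGH (@Ihat R p (2 * q)) (@Ihat R p' (2 * q')) = (if (p == p') && (q == q') then 1 else 0)) /\
  (forall p q p' q', (0 < q)%N -> (0 < q')%N ->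
     ipGH (@Ihat_conj R p (2 * q)) (@Ihat_conj R p' (2 * q')) = (if (p == p') && (q == q') then 1 else 0)) /\
  (* mutual orthogonality of the three summands *)
  (forall f g, A f -> B g -> ipGH f g = 0) /\
  (forall f g, A f -> Bc g -> ipGH f g = 0) /\
  (forall f g, B f -> Bc g -> ipGH f g = 0) /\
  (* L^2_+ is their (orthogonal) sum *)
  (forall h, L2GH h ->
     (@L2plus R h <-> exists f g k, [/\ A f, B g, Bc k &
                      {ae @leb2 R, forall x, h x = f x + g x + k x}])).
Proof.
split; first by move=> p [//|n] _; split; [exact: L2GH_Ihat|apply: L2GH_conj; exact: L2GH_Ihat].
split; first by move=> p [//|n] p' [//|n'] _ _; exact: Ihat_ortho.
split.
  move=> p [//|n] p' [//|n'] _ _; rewrite /Ihat_conj ipGH_conj; [|exact: L2GH_Ihat|exact: L2GH_Ihat].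
  by rewrite Ihat_ortho; case: ifP => _; rewrite ?conjc0 ?conjc1.
split; first by move=> f g; exact: A_B.
split; first by move=> f g; exact: A_Bc.
split; first by move=> f g; exact: B_Bc.
move=> h Lh; split; first exact: L2plus_decomposition.
move=> [f [g [k [Af Bg Ck E]]]].
apply: (L2plus_ae Lh (L2plus_lin 1 (L2plus_lin 1 (A_L2plus Af) (B_L2plus Bg)) (Bc_L2plus Ck))).
by apply: ae2_imp E => x ->; rewrite !mul1r.
Qed.
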